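(* Let $\mathbb{T}$ denote the center of the unitary group $\mathrm{U}(n)$. For every $\lambda > -1$, consider the space of sequences \[ \mathcal{ST}^{(\lambda)}(\mathbb{T},n) = \left\{ \left( \frac{\kappa!\,(n-1)!}{(n+\kappa-1)!}\, \mathrm{tr}(T_a^{(\lambda)}|_{\mathcal{P}_\kappa(\mathbb{C}^n)}) \right)_{\kappa\in\mathbb{N}} \;:\; a\in L^\infty(\mathbb{B}^n)^{\mathbb{T}} \right\}. \] Then the $C^*$-algebra generated by the set $\mathcal{ST}^{(\lambda)}(\mathbb{T},n)$ and the norm closure of $\mathcal{ST}^{(\lambda)}(\mathbb{T},n)$ in $\ell^\infty(\mathbb{N})$ are both equal to $\mathrm{SO}(\mathbb{N})$.
   Context: Here $\mathbb{N}=\{0,1,2,\dots\}$. $\mathbb{B}^n$ is the open unit ball of $\mathbb{C}^n$ with Lebesgue measure $v$. For $\lambda>-1$, $dv_\lambda(z) = c_\lambda (1-|z|^2)^\lambda dv(z)$ with $c_\lambda = \frac{\Gamma(n+\lambda+1)}{\pi^n\Gamma(\lambda+1)}$, and $\mathcal{A}^2_\lambda(\mathbb{B}^n)$ is the closed subspace of holomorphic functions in $L^2(\mathbb{B}^n,v_\lambda)$, with orthogonal projection $B_\lambda$. For $a\in L^\infty(\mathbb{B}^n)$ the Toeplitz operator is $T_a^{(\lambda)}(f)=B_\lambda(af)$ on $\mathcal{A}^2_\lambda(\mathbb{B}^n)$. $L^\infty(\mathbb{B}^n)^{\mathbb{T}}$ is the space of $a\in L^\infty(\mathbb{B}^n)$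 such that, for every $t\in\mathbb{T}$ (unit complex numbers, identified with scalar unitary matrices), $a(tz)=a(z)$ for almost every $z$. $\mathcal{P}_\kappa(\mathbb{C}^n)$ is the space of homogeneous holomorphic polynomials on $\mathbb{C}^n$ of degree $\kappa$; it is invariant under $T_a^{(\lambda)}$ for $a\in L^\infty(\mathbb{B}^n)^{\mathbb{T}}$. The space of bounded slowly oscillating sequences is \[ \mathrm{SO}(\mathbb{N}) = \{ x\in\ell^\infty(\mathbb{N}) : \lim_{\frac{r+1}{s+1}\to 1}|x_r-x_s| = 0 \}. \] *)

(* Defs.v *)
From HB Require Import structures.
From mathcomp Require Import all_boot all_order all_algebra.
From mathcomp Require Import all_classical all_reals all_analysis.
From mathcomp Require Import complex.

Set Implicit Arguments.
Unset Strict Implicit.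
Unset Printing Implicit Defensive.
Import Order.TTheory GRing.Theory Num.Theory.
Import numFieldNormedType.Exports.
Local Open Scope classical_set_scope.
Local Open Scope ring_scope.

(* R[i] behind a definition returning a numClosedFieldType: the topological and
   normed-module instances of MathComp-Analysis are keyed on the sort of a
   numFieldType and are not found on R[i] itself. *)
Definition Cx (R : realType) : numClosedFieldType := R[i].

Definition ReC {R : realType} (w : Cx R) : R := complex.Re w.
Definition ImC {R : realType} (w : Cx R) : R := complex.Im w.
Definition mkC {R : realType} (x y : R) : Cx R := Complex x y.

Notation Cn R n := 'rV[Cx R]_n.

(* The sigma-finite instance that the library declares on m1 \x m2 is shadowed
   by the one for subprobabilities, so the fact is proved again. *)
Lemma sigma_finite_prod d1 d2 (T1 : measurableType d1) (T2 : measurableType d2)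
    (R : realType) (m1 : {sigma_finite_measure set T1 -> \bar R})
    (m2 : {sigma_finite_measure set T2 -> \bar R}) :
  sigma_finite setT (m1 \x m2)%E.
Proof.
have /sigma_finiteP[F [TF ndF Foo]] := sigma_finiteT m1.
have /sigma_finiteP[G [TG ndG Goo]] := sigma_finiteT m2.
exists (fun n => F n `*` G n).
  rewrite -setXTT TF TG predeqE => -[x y]; split.
    move=> [/= [n _ Fnx] [k _ Gky]]; exists (maxn n k) => //; split.
    - by move: x Fnx; exact/subsetPset/ndF/leq_maxl.
    - by move: y Gky; exact/subsetPset/ndG/leq_maxr.
  by move=> [n _ []/= ? ?]; split; exists n.
move=> k; have [? ?] := Foo k; have [? ?] := Goo k.
split; first exact: measurableX.
by rewrite product_measure1E// lte_mul_pinfty// ge0_fin_numE.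
Qed.

Section measure_on_Cn.
Context {R : realType}.

Let RR : Type := (measurableTypeR R * measurableTypeR R)%type.

Definition coordRR n (i : 'I_n) (z : Cn R n) : RR :=
  (ReC (z ord0 i), ImC (z ord0 i)).

Definition Cn_display : measure_display.
Proof. exact. Qed.

Let Cn_set0 n : g_sigma_preimage (@coordRR n) set0.
Proof. exact: sigma_algebra0. Qed.

Let Cn_setC n A :
  g_sigma_preimage (@coordRR n) A -> g_sigma_preimage (@coordRR n) (~` A).
Proof. exact: sigma_algebraC. Qed.

Let Cn_bigcup n (F : _^nat) :
  (forall i, g_sigma_preimage (@coordRR n) (F i)) ->
  g_sigma_preimage (@coordRR n) (\bigcup_i F i).
Proof. exact: sigma_algebra_bigcup. Qed.

(* The Borel sigma-algebra of C^n, as the product sigma-algebra of R^(2n). *)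
HB.instance Definition _ n := @isMeasurable.Build Cn_display
  (Cn R n) (g_sigma_preimage (@coordRR n)) (@Cn_set0 n) (@Cn_setC n)
  (@Cn_bigcup n).

Lemma measurable_coordRR n (i : 'I_n) :
  measurable_fun [set: Cn R n] (@coordRR n i).
Proof.
move=> _ Y mY; rewrite setTI; apply: sub_sigma_algebra => /=.
rewrite -bigcup_seq/=; exists i => /=; first by rewrite mem_index_enum.
by exists Y => //; rewrite setTI.
Qed.

Lemma measurable_fun_coordRRP d (T : measurableType d) n (f : T -> Cn R n) :
  (forall i, measurable_fun [set: T] (coordRR i \o f)) ->
  measurable_fun [set: T] f.
Proof.
move=> mf.
suff H : g_sigma_preimage (fun i => @coordRR n i \o f) `<=` measurable.
  move=> _ A mA; rewrite setTI; apply: H; rewrite g_sigma_preimage_comp.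
  by exists A => //; rewrite setTI.
apply: smallest_sub; first exact: sigma_algebra_measurable.
case: n => [|n] in f mf *; first by rewrite big_ord0.
rewrite -bigcup_mkord_ord; apply: bigcup_sub => i Ii.
by move=> A [B mB <-]; exact: mf.
Qed.

Definition Ccons n (p : RR * Cn R n) : Cn R n.+1 :=
  row_mx (mkC p.1.1 p.1.2)%:M p.2.

Lemma measurable_Ccons n : measurable_fun setT (@Ccons n).
Proof.
apply: measurable_fun_coordRRP => i.
case: (splitP (i : 'I_(1 + n))) => j ij.
- rewrite (_ : _ \o _ = fst); first exact: measurable_fst.
  apply/funext => -[[x y] w]; rewrite /coordRR /Ccons /=.
  have -> : i = lshift n j by apply: val_inj.
  by rewrite (@row_mxEl _ 1 1 n) (ord1 j) mxE eqxx mulr1n.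
- rewrite (_ : _ \o _ = coordRR j \o snd).
    apply: measurableT_comp; first exact: measurable_coordRR.
    exact: measurable_snd.
  apply/funext => -[[x y] w]; rewrite /coordRR /Ccons /=.
  have -> : i = rshift 1 j by apply: val_inj.
  by rewrite (@row_mxEr _ 1 1 n).
Qed.

Definition Cuncons n (z : Cn R n.+1) : RR * Cn R n :=
  (coordRR ord0 z, @rsubmx _ 1 1 n z).

Lemma CconsK n : cancel (@Ccons n) (@Cuncons n).
Proof.
case=> -[x y] w; rewrite /Ccons /Cuncons /coordRR /=.
rewrite (@row_mxKr _ 1 1 n); congr (_, _).
have -> : ord0 = lshift n (0 : 'I_1) :> 'I_(1 + n) by apply: val_inj.
by rewrite (@row_mxEl _ 1 1 n) mxE eqxx mulr1n.
Qed.

Lemma measurable_Cuncons n : measurable_fun setT (@Cuncons n).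
Proof.
apply: measurable_fun_pair; first exact: measurable_coordRR.
apply: measurable_fun_coordRRP => i.
rewrite (_ : _ \o _ = coordRR (rshift 1 i : 'I_n.+1)).
  exact: measurable_coordRR.
by apply/funext => z; rewrite /coordRR /= mxE.
Qed.

Definition lebesgueC : set RR -> \bar R :=
  (@lebesgue_measure R \x @lebesgue_measure R)%E.

HB.instance Definition _ := Measure.on lebesgueC.

HB.instance Definition _ := Measure_isSigmaFinite.Build _ _ _
  lebesgueC (sigma_finite_prod lebesgue_measure lebesgue_measure).

Section step.
Variables (n : nat) (mu : {sigma_finite_measure set (Cn R n) -> \bar R}).

Definition lebesgue_step : set (Cn R n.+1) -> \bar R :=
  pushforward (lebesgueC \x mu)%E (@Ccons n).

Let step0 : lebesgue_step set0 = 0%E.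
Proof. by rewrite /lebesgue_step /pushforward preimage_set0 measure0. Qed.

Let step_ge0 A : (0 <= lebesgue_step A)%E.
Proof. by rewrite /lebesgue_step /pushforward; exact: measure_ge0. Qed.

Let step_sigma_additive : semi_sigma_additive lebesgue_step.
Proof.
move=> F mF tF mUF; rewrite /lebesgue_step /pushforward preimage_bigcup.
have mpre A : measurable A -> measurable (@Ccons n @^-1` A).
  by move=> mA; rewrite -[X in measurable X]setTI; exact: measurable_Ccons.
apply: measure_semi_sigma_additive.
- by move=> k; exact: mpre.
- apply/trivIsetP => /= i j _ _ ij; rewrite -preimage_setI.
  by move/trivIsetP : tF => /(_ _ _ _ _ ij) ->//; rewrite preimage_set0.
- by rewrite -preimage_bigcup; exact: mpre.
Qed.

HB.instance Definition _ := isMeasure.Build _ _ _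
  lebesgue_step step0 step_ge0 step_sigma_additive.

Let step_sigma_finite : sigma_finite setT lebesgue_step.
Proof.
have [F TF Foo] := sigma_finite_prod lebesgueC mu.
exists (fun k => @Cuncons n @^-1` F k).
  by rewrite -preimage_bigcup -TF preimage_setT.
move=> k; have [mF Fk] := Foo k; split.
  by rewrite -[X in measurable X]setTI; exact: measurable_Cuncons.
rewrite /lebesgue_step /pushforward -comp_preimage.
rewrite (_ : _ @^-1` _ = F k)//.
by apply/seteqP; split => p /=; rewrite CconsK.
Qed.

HB.instance Definition _ := Measure_isSigmaFinite.Build _ _ _
  lebesgue_step step_sigma_finite.

End step.

Fixpoint lebesgueCn n : {sigma_finite_measure set (Cn R n) -> \bar R} :=
  match n return {sigma_finite_measure set (Cn R n) -> \bar R} with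
  | 0 => dirac (0 : Cn R 0)
  | m.+1 => lebesgue_step (lebesgueCn m)
  end.

End measure_on_Cn.

Section bergman.
Context {R : realType}.

Definition absC (w : Cx R) : R := ReC `|w|.

Definition sqnorm n (z : Cn R n) : R := \sum_(i < n) absC (z ord0 i) ^+ 2.

Definition uball n : set (Cn R n) := [set z | sqnorm z < 1].

Definition Gamma (s : R) : R :=
  Rintegral lebesgue_measure `]0, +oo[ (fun t => t `^ (s - 1) * expR (- t)).

Definition bergman_weight n (lambda : R) (z : Cn R n) : R :=
  Gamma (n%:R + lambda + 1) / (pi ^+ n * Gamma (lambda + 1))
  * (1 - sqnorm z) `^ lambda.

Definition cmeasurable_fun n (D : set (Cn R n)) (f : Cn R n -> Cx R) :=
  measurable_fun D (ReC \o f) /\ measurable_fun D (ImC \o f).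

(* Functions on the ball are represented by functions on C^n of which only the
   values on the ball matter. *)
Definition L2_ball n (lambda : R) : set (Cn R n -> Cx R) :=
  [set f | cmeasurable_fun (@uball n) f /\
    (\int[lebesgueCn n]_(z in @uball n)
       (absC (f z) ^+ 2 * bergman_weight lambda z)%:E < +oo)%E].

Definition inner n (lambda : R) (f g : Cn R n -> Cx R) : Cx R :=
  mkC
    (Rintegral (lebesgueCn n) (@uball n)
       (fun z => ReC (f z * (g z)^*) * bergman_weight lambda z))
    (Rintegral (lebesgueCn n) (@uball n)
       (fun z => ImC (f z * (g z)^*) * bergman_weight lambda z)).

(* Differentials are Cx R-linear here, so this is complex differentiability. *)
Definition holomorphic_ball n (f : Cn R n -> Cx R) :=
  forall z, @uball n z -> differentiable f z.

Definition bergman n (lambda : R) : set (Cn R n -> Cx R) :=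
  [set f | L2_ball lambda f /\ holomorphic_ball f].

(* The element of the Bergman space such that f minus it is orthogonal to the
   Bergman space; it is determined on the ball. *)
Definition bergman_proj n (lambda : R) (f : Cn R n -> Cx R) : Cn R n -> Cx R :=
  xget (fun=> 0) [set g | bergman lambda g /\
    forall h, bergman lambda h -> inner lambda (fun z => f z - g z) h = 0].

Definition toeplitz n (lambda : R) (a f : Cn R n -> Cx R) : Cn R n -> Cx R :=
  bergman_proj lambda (fun z => a z * f z).

Definition Linf_ball n : set (Cn R n -> Cx R) :=
  [set a | cmeasurable_fun (@uball n) a /\
    exists M : R,
      {ae lebesgueCn n, forall z, @uball n z -> absC (a z) <= M}].

Definition Linf_ball_T n : set (Cn R n -> Cx R) :=
  [set a | @Linf_ball n a /\
    forall t : Cx R, `|t| = 1 ->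
      {ae lebesgueCn n, forall z, @uball n z -> a (t *: z) = a z}].

Definition homog_poly n (kappa : nat) : set (Cn R n -> Cx R) :=
  [set f | exists c : {ffun 'I_n -> 'I_kappa.+1} -> Cx R,
    forall z : Cn R n, f z =
      \sum_(alpha : {ffun 'I_n -> 'I_kappa.+1}
              | (\sum_(i < n) alpha i == kappa)%N)
        c alpha * \prod_(i < n) z ord0 i ^+ alpha i].

Definition is_basis n (V : set (Cn R n -> Cx R)) m (e : 'I_m -> Cn R n -> Cx R) :=
  (forall i, V (e i)) /\
  forall f, V f ->
    exists! c : 'cV[Cx R]_m, forall z, f z = \sum_(i < m) c i ord0 * e i z.

(* Trace of the matrix of T|_V in a basis of V; it does not depend on the basis,
   and is 0 by convention if V has no finite basis or is not T-invariant.
   T acts on functions on the ball, whence the restriction on z. *)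
Definition trace_on n (V : set (Cn R n -> Cx R))
    (T : (Cn R n -> Cx R) -> Cn R n -> Cx R) : Cx R :=
  xget 0 [set t | exists m (e : 'I_m -> Cn R n -> Cx R) (M : 'M[Cx R]_m),
    [/\ is_basis V e,
        forall j z, @uball n z -> T (e j) z = \sum_(i < m) M i j * e i z
      & t = \tr M]].

Definition ST n (lambda : R) : set (nat -> Cx R) :=
  [set (fun kappa : nat =>
          (kappa`! * n.-1`!)%:R / ((n + kappa).-1)`!%:R
          * trace_on (@homog_poly n kappa) (toeplitz lambda a))
   | a in @Linf_ball_T n].

End bergman.

Section sequences.
Context {R : realType}.

Definition linf : set (nat -> Cx R) :=
  [set x | exists M : R, forall k, absC (x k) <= M].

Definition linf_closure (S : set (nat -> Cx R)) : set (nat -> Cx R) :=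
  [set x | linf x /\ forall eps : R, 0 < eps ->
    exists2 s, S s & forall k, absC (x k - s k) <= eps].

Definition is_Cstar_subalg (A : set (nat -> Cx R)) :=
  [/\ A `<=` linf,
      [/\ A (fun=> 0),
          forall x y, A x -> A y -> A (fun k => x k + y k)
        & forall (c : Cx R) x, A x -> A (fun k => c * x k)],
      forall x y, A x -> A y -> A (fun k => x k * y k),
      forall x, A x -> A (fun k => (x k)^*)
    & linf_closure A `<=` A].

Definition Cstar_generated (S : set (nat -> Cx R)) : set (nat -> Cx R) :=
  smallest is_Cstar_subalg S.

Definition SO : set (nat -> Cx R) :=
  [set x | linf x /\
    forall eps : R, 0 < eps -> exists2 delta : R, 0 < delta &
      forall r s : nat, `|r.+1%:R / s.+1%:R - 1| < delta ->
        absC (x r - x s) < eps].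

End sequences.

(* Main.v *)
(** On homogeneous polynomials of degree k the normalised trace of T_a is the
    mean gamma_a(k) of a against the probability measure with density proportional to
    |z|^(2k) (1 - |z|^2)^lambda: the compression of T_a is given by the monomials, since
    the component of degree k of a holomorphic function, its Fourier coefficient along
    the rotations z -> e^(it) z, is a polynomial. The steps of gamma_a are O(1/k), which
    gives slow oscillation. Conversely radial symbols produce the moment sequences of
    x^(k+n-1) (1-x)^(q-1) on [0,1], q = lambda + 1, and these are dense in SO(N): for
    large q the density concentrates, so that a slowly oscillating sequence can be read
    off as a function of 1/(1-x); the exponent q is lowered one unit at a time by
    differentiating along dilations of 1 - x; finitely many terms are corrected with
    sequences close to Kronecker deltas. *)
From HB Require Import structures.
Require Import Defs.
From mathcomp Require Import all_boot all_order all_algebra.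
From mathcomp Require Import all_classical all_reals all_analysis.
From mathcomp Require Import measurable_realfun complex ring lra.

Set Implicit Arguments.
Unset Strict Implicit.
Unset Printing Implicit Defensive.
Import Order.TTheory GRing.Theory Num.Theory.
Import numFieldNormedType.Exports.
Local Open Scope classical_set_scope.
Local Open Scope ring_scope.

(** * Complex numbers through real and imaginary parts, and their polar form *)

Section complex_numbers.
Context {R : realType}.
Implicit Types (x y : R) (u v w : Cx R).

(** The element chosen by [bergman_proj] is known only through orthogonality to every holomorphic
    square-integrable function, so polynomials must be compared with arbitrary holomorphic
    functions. These are given as pointwise differentiable functions, which is why Cauchy theory is
    developed from Goursat's bisection on.

    In the density part the obstacle is that under x^N (1-x)^(q-1) the ratio of 1-x to its mean
    keeps a variance of about 1/q however large N is: only a large exponent concentrates the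
    density, while lambda fixes q. To descend, integrate g(x) - t^q g(1 - t(1-x)) against the
    density of exponent q. Undoing the dilation turns this into the integral of g(x) times x^N - (x
    - h(1-x))_+^N, where t = 1/(1+h). To first order this factor is h N x^(N-1) (1-x); after
    division by q h the exponent has become q+1, with the right normalisation because B(N+1,q+1) =
    q/(N+1+q) B(N+1,q). The error is O(h) + O(1/N): h is fixed by the accuracy wanted, and the
    O(1/N) leaves finitely many indices out. *)

Definition RC x : Cx R := mkC x 0.

Definition cis x : Cx R := mkC (cos x) (sin x).

Lemma Cx_eq u v : ReC u = ReC v -> ImC u = ImC v -> u = v.
Proof. by case: u v => [a b] [c d] /= -> ->. Qed.

Lemma ReC_mk x y : ReC (mkC x y) = x. Proof. by []. Qed.
Lemma ReCD u v : ReC (u + v) = ReC u + ReC v.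
Proof. by case: u v => [a b] [c d]. Qed.
Lemma ImCD u v : ImC (u + v) = ImC u + ImC v.
Proof. by case: u v => [a b] [c d]. Qed.
Lemma ReCN u : ReC (- u) = - ReC u. Proof. by case: u. Qed.
Lemma ImCN u : ImC (- u) = - ImC u. Proof. by case: u. Qed.
Lemma ReCB u v : ReC (u - v) = ReC u - ReC v.
Proof. by rewrite ReCD ReCN. Qed.
Lemma ImCB u v : ImC (u - v) = ImC u - ImC v.
Proof. by rewrite ImCD ImCN. Qed.
Lemma ReCM u v : ReC (u * v) = ReC u * ReC v - ImC u * ImC v.
Proof. by case: u v => [a b] [c d]. Qed.
Lemma ImCM u v : ImC (u * v) = ReC u * ImC v + ImC u * ReC v.
Proof. by case: u v => [a b] [c d]. Qed.
Lemma ReC_conj u : ReC u^* = ReC u. Proof. by case: u. Qed.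
Lemma ImC_conj u : ImC u^* = - ImC u. Proof. by case: u. Qed.

Lemma RCD x y : RC (x + y) = RC x + RC y.
Proof. by apply: Cx_eq; rewrite ?ReCD ?ImCD /= ?addr0. Qed.
Lemma RCN x : RC (- x) = - RC x.
Proof. by apply: Cx_eq; rewrite ?ReCN ?ImCN /= ?oppr0. Qed.
Lemma RCB x y : RC (x - y) = RC x - RC y.
Proof. by rewrite RCD RCN. Qed.
Lemma RCM x y : RC (x * y) = RC x * RC y.
Proof. by apply: Cx_eq; rewrite ?ReCM ?ImCM /=; ring. Qed.
Lemma RC0 : RC 0 = 0. Proof. by []. Qed.
Lemma RC1 : RC 1 = 1. Proof. by []. Qed.
Lemma RC_nat k : RC k%:R = k%:R.
Proof. by elim: k => // k IH; rewrite -!natr1 RCD IH. Qed.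
Lemma RCX x k : RC (x ^+ k) = RC x ^+ k.
Proof. by elim: k => // k IH; rewrite !exprS RCM IH. Qed.
Lemma RC_sum I (r : seq I) (P : pred I) (F : I -> R) :
  RC (\sum_(i <- r | P i) F i) = \sum_(i <- r | P i) RC (F i).
Proof. by elim/big_rec2: _ => // i u v _ <-; rewrite RCD. Qed.
Lemma RC_inj : injective RC. Proof. by move=> x y []. Qed.
Lemma RC_eq0 x : (RC x == 0) = (x == 0).
Proof. by apply/eqP/eqP => [[]|->]. Qed.
Lemma RCV x : RC x^-1 = (RC x)^-1.
Proof.
have [->|x0] := eqVneq x 0; first by rewrite invr0 RC0 invr0.
have : RC x * RC x^-1 = 1 by rewrite -RCM divff.
by move/(congr1 (fun u => (RC x)^-1 * u)); rewrite mulKf ?RC_eq0// mulr1.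
Qed.
Lemma RC_div x y : RC (x / y) = RC x / RC y.
Proof. by rewrite RCM RCV. Qed.
Lemma ReC_RCM x u : ReC (RC x * u) = x * ReC u.
Proof. by rewrite ReCM /= mul0r subr0. Qed.
Lemma ImC_RCM x u : ImC (RC x * u) = x * ImC u.
Proof. by rewrite ImCM /= mul0r addr0. Qed.
(** The norm of [Cx R] takes its values in [Cx R]; this equation carries identities and inequalities
    between norms over to the real-valued [absC]. *)
Lemma normCE w : `|w| = RC (absC w).
Proof.
rewrite /absC; have := normr_real w; case: (`|w|) => a b.
by rewrite (complex_real a b) => /eqP ->.
Qed.
Lemma absCE w : absC w = Num.sqrt (ReC w ^+ 2 + ImC w ^+ 2).
Proof. by case: w => a b; rewrite /absC /ReC normc_def. Qed.
Lemma sqr_absC w : absC w ^+ 2 = ReC w ^+ 2 + ImC w ^+ 2.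
Proof. by rewrite absCE sqr_sqrtr// addr_ge0 ?sqr_ge0. Qed.
Lemma absC_ge0 w : 0 <= absC w. Proof. by rewrite absCE sqrtr_ge0. Qed.
Lemma absCM u v : absC (u * v) = absC u * absC v.
Proof. by apply: RC_inj; rewrite RCM -!normCE normrM. Qed.
Lemma absC0 : absC (0 : Cx R) = 0. Proof. by rewrite /absC normr0. Qed.
Lemma absC1 : absC (1 : Cx R) = 1. Proof. by rewrite /absC normr1. Qed.
Lemma absCN u : absC (- u) = absC u. Proof. by rewrite /absC normrN. Qed.
Lemma absCX u k : absC (u ^+ k) = absC u ^+ k.
Proof. by elim: k => [|k IH]; rewrite ?absC1// !exprS absCM IH. Qed.
Lemma absCV u : absC u^-1 = (absC u)^-1.
Proof. by apply: RC_inj; rewrite RCV -!normCE normfV. Qed.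
Lemma absC_conj u : absC u^* = absC u.
Proof. by rewrite !absCE ReC_conj ImC_conj sqrrN. Qed.
Lemma absC_eq0 u : (absC u == 0) = (u == 0).
Proof. by rewrite -RC_eq0 -normCE normr_eq0. Qed.
Lemma absC_RC x : absC (RC x) = `|x|.
Proof. by rewrite absCE /= expr0n addr0 sqrtr_sqr. Qed.
Lemma ReC_le w : `|ReC w| <= absC w.
Proof.
by rewrite -(ler_pXn2r (n:=2))// ?nnegrE ?absC_ge0// sqr_absC real_normK ?num_real// lerDl sqr_ge0.
Qed.
Lemma ImC_le w : `|ImC w| <= absC w.
Proof.
by rewrite -(ler_pXn2r (n:=2))// ?nnegrE ?absC_ge0// sqr_absC real_normK ?num_real// lerDr sqr_ge0.
Qed.
Lemma absC_le w : absC w <= `|ReC w| + `|ImC w|.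
Proof.
rewrite -(ler_pXn2r (n:=2))// ?nnegrE ?absC_ge0// ?addr_ge0// sqr_absC.
rewrite -(real_normK (num_real (ReC w))) -(real_normK (num_real (ImC w))).
have := normr_ge0 (ReC w); have := normr_ge0 (ImC w); nra.
Qed.
Lemma absCD u v : absC (u + v) <= absC u + absC v.
Proof.
by have := ler_normD u v; rewrite !normCE -RCD lecR.
Qed.
Lemma absCB u v : absC (u - v) <= absC u + absC v.
Proof. by rewrite (le_trans (absCD _ _))// absCN. Qed.
Lemma absC_distC u v : absC (u - v) = absC (v - u).
Proof. by rewrite -absCN opprB. Qed.
Lemma absC_dist_trans w u v : absC (u - v) <= absC (u - w) + absC (w - v).
Proof. by rewrite (_ : u - v = u - w + (w - v)) ?absCD//; ring. Qed.
Lemma absC_sum I (r : seq I) (P : pred I) (F : I -> Cx R) :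
  absC (\sum_(i <- r | P i) F i) <= \sum_(i <- r | P i) absC (F i).
Proof.
elim/big_rec2: _ => [|i x y _ xy]; first by rewrite absC0.
by rewrite (le_trans (absCD _ _))// lerD2l.
Qed.
Lemma absC_prod I (r : seq I) (P : pred I) (F : I -> Cx R) :
  absC (\prod_(i <- r | P i) F i) = \prod_(i <- r | P i) absC (F i).
Proof. by elim/big_rec2: _ => [|i x y _ <-]; rewrite ?absC1 ?absCM. Qed.

Lemma absC_cis x : absC (cis x) = 1.
Proof. by rewrite absCE /= cos2Dsin2 sqrtr1. Qed.
Lemma cisD x y : cis (x + y) = cis x * cis y.
Proof. by apply: Cx_eq; rewrite ?ReCM ?ImCM /= ?cosD ?sinD; ring. Qed.
Lemma cis0 : cis 0 = 1.
Proof. by apply: Cx_eq; rewrite /= ?cos0 ?sin0. Qed.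
Lemma cisNM x : cis (- x) * cis x = 1.
Proof. by rewrite -cisD addNr cis0. Qed.
Lemma cis_conj x : (cis x)^* = cis (- x).
Proof. by apply: Cx_eq; rewrite ?ReC_conj ?ImC_conj /= ?cosN ?sinN. Qed.
Lemma cisVE x : (cis x)^-1 = cis (- x).
Proof.
apply: (@mulIf _ (cis x)); last by rewrite cisNM mulVf// -absC_eq0 absC_cis oner_eq0.
by rewrite -absC_eq0 absC_cis oner_eq0.
Qed.
Lemma cis2pi x : cis (x + pi *+ 2) = cis x.
Proof. by rewrite /cis cosD2pi sinD2pi. Qed.
Lemma conjCM_abs u : u * u^* = RC (absC u ^+ 2).
Proof. by rewrite RCX -normCE normCK. Qed.

(** The angle is [acos (ReC w / absC w)] up to sign: its sine has the same square as
    [ImC w / absC w], which leaves two cases. *)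
Lemma polarC w : exists t, w = RC (absC w) * cis t.
Proof.
have [->|w0] := eqVneq w 0; first by exists 0; rewrite absC0 RC0 mul0r.
set r := absC w; have r0 : 0 < r by rewrite lt_neqAle eq_sym absC_eq0 w0 absC_ge0.
have r0' := lt0r_neq0 r0.
have E : (ReC w / r) ^+ 2 + (ImC w / r) ^+ 2 = 1.
  by rewrite !expr_div_n -mulrDl -sqr_absC divff// expf_neq0.
have c1 : -1 <= ReC w / r <= 1.
  by rewrite -ler_norml -(ler_pXn2r (n:=2))// ?nnegrE// expr1n real_normK ?num_real// -E lerDl sqr_ge0.
have S : sin (acos (ReC w / r)) ^+ 2 = (ImC w / r) ^+ 2.
  have := cos2Dsin2 (acos (ReC w / r)); rewrite acosK// -E; lra.
have {S} [S|S] : sin (acos (ReC w / r)) = ImC w / r \/ sin (acos (ReC w / r)) = - (ImC w / r).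
    by move/eqP : S; rewrite eqf_sqr => /orP[] /eqP; [left|right].
- exists (acos (ReC w / r)); apply: Cx_eq; rewrite ?ReC_RCM ?ImC_RCM /= ?acosK// ?S; by rewrite mulrC divfK.
- exists (- acos (ReC w / r)); apply: Cx_eq; rewrite ?ReC_RCM ?ImC_RCM /= ?cosN ?sinN ?acosK// ?S ?opprK; by rewrite mulrC divfK.
Qed.

End complex_numbers.

(** * Lebesgue integrals of complex-valued functions *)

Section complex_integral.
Context {R : realType} d {T : measurableType d} (mu : {measure set T -> \bar R}).
Implicit Types (D : set T) (f g : T -> Cx R).

Definition Cint D f : Cx R :=
  mkC (Rintegral mu D (fun x => ReC (f x))) (Rintegral mu D (fun x => ImC (f x))).

Definition cintegrable D f :=
  mu.-integrable D (EFin \o (fun x => ReC (f x))) /\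
  mu.-integrable D (EFin \o (fun x => ImC (f x))).

Lemma eq_Cint D f g : (forall x, D x -> f x = g x) -> Cint D f = Cint D g.
Proof.
move=> fg; apply: Cx_eq; apply: eq_Rintegral => x; rewrite inE => Dx;
by rewrite fg.
Qed.

Lemma eq_cintegrable D f g : measurable D -> (forall x, D x -> f x = g x) ->
  cintegrable D f -> cintegrable D g.
Proof.
move=> mD fg [f1 f2]; split; [move: f1|move: f2]; apply: eq_integrable => // x;
by rewrite inE => Dx /=; rewrite fg.
Qed.

Variables (D : set T) (mD : measurable D).

Lemma cintegrableD f g : cintegrable D f -> cintegrable D g ->
  cintegrable D (fun x => f x + g x).
Proof.
move=> [f1 f2] [g1 g2]; split.
  apply: eq_integrable (integrableD mD f1 g1) => // x _ /=; by rewrite ReCD.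
apply: eq_integrable (integrableD mD f2 g2) => // x _ /=; by rewrite ImCD.
Qed.

Lemma cintegrableZ c f : cintegrable D f -> cintegrable D (fun x => c * f x).
Proof.
move=> [f1 f2]; split.
  apply: eq_integrable (integrableB mD (integrableZl mD (ReC c) f1) (integrableZl mD (ImC c) f2)) => // x _ /=.
  by rewrite ReCM.
apply: eq_integrable (integrableD mD (integrableZl mD (ReC c) f2) (integrableZl mD (ImC c) f1)) => // x _ /=.
by rewrite ImCM.
Qed.

Lemma cintegrableN f : cintegrable D f -> cintegrable D (fun x => - f x).
Proof.
move=> fi; apply: eq_cintegrable (cintegrableZ (-1) fi) => // x _.
by rewrite mulN1r.
Qed.

Lemma cintegrable0 : cintegrable D (fun=> 0).
Proof. by split; exact: integrable0. Qed.

Lemma cintegrable_sum I (r : seq I) (P : pred I) (F : I -> T -> Cx R) :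
  (forall i, P i -> cintegrable D (F i)) ->
  cintegrable D (fun x => \sum_(i <- r | P i) F i x).
Proof.
move=> Fi; elim: r => [|i r IH].
  by apply: eq_cintegrable cintegrable0 => // x _; rewrite big_nil.
case: (boolP (P i)) => Pi.
  by apply: eq_cintegrable (cintegrableD (Fi i Pi) IH) => // x _; rewrite big_cons Pi.
by apply: eq_cintegrable IH => // x _; rewrite big_cons (negbTE Pi).
Qed.

Lemma CintD f g : cintegrable D f -> cintegrable D g ->
  Cint D (fun x => f x + g x) = Cint D f + Cint D g.
Proof.
move=> [f1 f2] [g1 g2]; apply: Cx_eq; rewrite ?ReCD ?ImCD /=.
  by rewrite -RintegralD//; apply: eq_Rintegral => x _; rewrite ReCD.
by rewrite -RintegralD//; apply: eq_Rintegral => x _; rewrite ImCD.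
Qed.

Lemma CintZ c f : cintegrable D f -> Cint D (fun x => c * f x) = c * Cint D f.
Proof.
move=> [f1 f2]; apply: Cx_eq; rewrite ?ReCM ?ImCM /=.
  rewrite -!RintegralZl// -RintegralB//; [|exact: (integrableZl mD (ReC c) f1)|exact: (integrableZl mD (ImC c) f2)].
  by apply: eq_Rintegral => x _; rewrite ReCM.
rewrite -!RintegralZl// -RintegralD//; [|exact: (integrableZl mD (ReC c) f2)|exact: (integrableZl mD (ImC c) f1)].
by apply: eq_Rintegral => x _; rewrite ImCM.
Qed.

Lemma CintN f : cintegrable D f -> Cint D (fun x => - f x) = - Cint D f.
Proof.
move=> fi; rewrite -mulN1r -CintZ//; apply: eq_Cint => x _.
by rewrite mulN1r.
Qed.

Lemma CintB f g : cintegrable D f -> cintegrable D g ->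
  Cint D (fun x => f x - g x) = Cint D f - Cint D g.
Proof.
by move=> fi gi; rewrite -CintN// -CintD//; exact: cintegrableN.
Qed.

Lemma Cint0 : Cint D (fun=> 0) = 0.
Proof. by apply: Cx_eq; rewrite /= Rintegral_cst// mul0r. Qed.

Lemma Cint_sum I (r : seq I) (P : pred I) (F : I -> T -> Cx R) :
  (forall i, P i -> cintegrable D (F i)) ->
  Cint D (fun x => \sum_(i <- r | P i) F i x) = \sum_(i <- r | P i) Cint D (F i).
Proof.
move=> Fi; elim: r => [|i r IH].
  rewrite big_nil -[RHS]Cint0; apply: eq_Cint => x _; by rewrite big_nil.
rewrite big_cons; case: (boolP (P i)) => Pi.
  rewrite -IH -CintD//; [|exact: Fi|exact: cintegrable_sum].
  by apply: eq_Cint => x _; rewrite big_cons Pi.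
by rewrite -IH; apply: eq_Cint => x _; rewrite big_cons (negbTE Pi).
Qed.

Lemma cintegrable_measurable f : cintegrable D f ->
  measurable_fun D (ReC \o f) /\ measurable_fun D (ImC \o f).
Proof.
by move=> [/measurable_int/measurable_EFinP f1 /measurable_int/measurable_EFinP f2].
Qed.

Lemma measurable_absC f : measurable_fun D (ReC \o f) ->
  measurable_fun D (ImC \o f) -> measurable_fun D (fun x => absC (f x)).
Proof.
move=> f1 f2.
rewrite (_ : (fun x => _) = (fun x => Num.sqrt (ReC (f x) ^+ 2 + ImC (f x) ^+ 2))); last first.
  by apply/funext => x; rewrite absCE.
have mS : measurable_fun setT (@Num.sqrt R).
  by apply: continuous_measurable_fun; exact: sqrt_continuous.
apply: (measurableT_comp mS).
by apply: measurable_funD; apply: measurable_funX.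
Qed.

Lemma cintegrable_absP f : measurable_fun D (ReC \o f) ->
  measurable_fun D (ImC \o f) ->
  mu.-integrable D (EFin \o (fun x => absC (f x))) -> cintegrable D f.
Proof.
move=> f1 f2 fi; split.
  apply: (le_integrable mD _ _ fi); first exact/measurable_EFinP.
  by move=> x Dx /=; rewrite lee_fin [leRHS]ger0_norm ?absC_ge0// ReC_le.
apply: (le_integrable mD _ _ fi); first exact/measurable_EFinP.
by move=> x Dx /=; rewrite lee_fin [leRHS]ger0_norm ?absC_ge0// ImC_le.
Qed.

Lemma integrable_absC f : cintegrable D f ->
  mu.-integrable D (EFin \o (fun x => absC (f x))).
Proof.
move=> [f1 f2]; have [m1 m2] := cintegrable_measurable (conj f1 f2).
apply: (le_integrable mD _ _ (integrableD mD (integrable_abse f1) (integrable_abse f2))).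
  by apply/measurable_EFinP; exact: measurable_absC.
move=> x Dx /=; rewrite lee_fin ger0_norm ?absC_ge0//.
by rewrite ger0_norm ?absC_le// addr_ge0.
Qed.

(** A unit factor rotates the integral onto the nonnegative real axis, where only the real part of
    the integrand counts. *)
Lemma absC_Cint_le f : cintegrable D f ->
  absC (Cint D f) <= Rintegral mu D (fun x => absC (f x)).
Proof.
move=> fi; have [t It] := polarC (Cint D f).
have E : absC (Cint D f) = ReC (Cint D (fun x => cis (- t) * f x)).
  by rewrite CintZ// {2}It mulrCA cisNM mulr1.
rewrite E /=; have [g1 g2] := cintegrableZ (cis (- t)) fi.
apply: le_Rintegral => //; first exact: integrable_absC.
move=> x Dx; apply: le_trans (ler_norm _) _.
by rewrite (le_trans (ReC_le _))// absCM absC_cis mul1r.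
Qed.

End complex_integral.

(** * Paths in the complex plane: continuity, derivatives, integrals over real intervals *)

Section paths.
Context {R : realType}.
Implicit Types (f g : R -> Cx R).

(** Paths are handled through real and imaginary parts, to which the fundamental theorem of calculus
    and the mean value theorem for real functions apply. *)
Definition ccont f x :=
  {for x, continuous (fun t => ReC (f t))} /\ {for x, continuous (fun t => ImC (f t))}.

Definition cderiv f x (d : Cx R) :=
  is_derive x (1 : R) (fun t => ReC (f t)) (ReC d) /\
  is_derive x (1 : R) (fun t => ImC (f t)) (ImC d).

Lemma ccont_cst c x : ccont (fun=> c) x.
Proof. by split; exact: cvg_cst. Qed.

Lemma ccontD f g x : ccont f x -> ccont g x -> ccont (fun t => f t + g t) x.
Proof.
move=> [f1 f2] [g1 g2]; split.
  rewrite (_ : (fun t => _) = (fun t => ReC (f t) + ReC (g t))); last by apply/funext => t; rewrite ReCD.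
  exact: continuousD.
rewrite (_ : (fun t => _) = (fun t => ImC (f t) + ImC (g t))); last by apply/funext => t; rewrite ImCD.
exact: continuousD.
Qed.

Lemma ccontM f g x : ccont f x -> ccont g x -> ccont (fun t => f t * g t) x.
Proof.
move=> [f1 f2] [g1 g2]; split.
  rewrite (_ : (fun t => _) = (fun t => ReC (f t) * ReC (g t) - ImC (f t) * ImC (g t))); last by apply/funext => t; rewrite ReCM.
  by apply: continuousB; exact: continuousM.
rewrite (_ : (fun t => _) = (fun t => ReC (f t) * ImC (g t) + ImC (f t) * ReC (g t))); last by apply/funext => t; rewrite ImCM.
by apply: continuousD; exact: continuousM.
Qed.

Lemma ccontN f x : ccont f x -> ccont (fun t => - f t) x.
Proof.
move=> fx; rewrite (_ : (fun t => _) = (fun t => -1 * f t)); last by apply/funext => t; rewrite mulN1r.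
exact: (ccontM (ccont_cst _ _) fx).
Qed.

Lemma ccontB f g x : ccont f x -> ccont g x -> ccont (fun t => f t - g t) x.
Proof. by move=> fx gx; apply: ccontD => //; exact: ccontN. Qed.

Lemma ccontX f k x : ccont f x -> ccont (fun t => f t ^+ k) x.
Proof.
move=> fx; elim: k => [|k IH]; first exact: ccont_cst.
rewrite (_ : (fun t => _) = (fun t => f t * f t ^+ k)); last by apply/funext => t; rewrite exprS.
exact: ccontM.
Qed.

Lemma ccont_sum I (r : seq I) (P : pred I) (F : I -> R -> Cx R) x :
  (forall i, P i -> ccont (F i) x) -> ccont (fun t => \sum_(i <- r | P i) F i t) x.
Proof.
move=> Fi; elim: r => [|i r IH].
  rewrite (_ : (fun t => _) = (fun=> 0)); first exact: ccont_cst.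
  by apply/funext => t; rewrite big_nil.
case: (boolP (P i)) => Pi.
  rewrite (_ : (fun t => _) = (fun t => F i t + \sum_(i <- r | P i) F i t)).
    by apply: ccontD => //; exact: Fi.
  by apply/funext => t; rewrite big_cons Pi.
rewrite (_ : (fun t => _) = (fun t => \sum_(i <- r | P i) F i t))//.
by apply/funext => t; rewrite big_cons (negbTE Pi).
Qed.

Lemma ccont_eps f x : (forall eps, 0 < eps -> exists2 d : R, 0 < d &
  forall t, `|t - x| < d -> absC (f t - f x) <= eps) -> ccont f x.
Proof.
move=> H; split; apply/cvgrPdist_le => e e0; have [d d0 Hd] := H e e0;
  near=> t; have td : `|t - x| < d
    by rewrite distrC; near: t; apply/nbhs_ballP; exists d.
- rewrite -ReCB (le_trans (ReC_le _))// absC_distC; exact: Hd.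
- rewrite -ImCB (le_trans (ImC_le _))// absC_distC; exact: Hd.
Unshelve. all: by end_near. Qed.

Lemma eps_ccont f x : ccont f x -> forall eps, 0 < eps -> exists2 d : R, 0 < d &
  forall t, `|t - x| < d -> absC (f t - f x) <= eps.
Proof.
move=> [/cvgrPdist_le f1 /cvgrPdist_le f2] e e0.
have e2 : 0 < e / 2 by rewrite divr_gt0.
have := f1 _ e2; have := f2 _ e2 => /nbhs_ballP[d1 d10 H1] /nbhs_ballP[d2 d20 H2].
exists (Num.min d1 d2); first by rewrite lt_min d10 d20.
move=> t; rewrite lt_min distrC => /andP[t1 t2].
rewrite absC_distC (le_trans (absC_le _))// (splitr e) ReCB ImCB.
apply: lerD; [exact: H2|exact: H1].
Qed.

Lemma cderiv_ccont f x d : cderiv f x d -> ccont f x.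
Proof.
by move=> [f1 f2]; split; apply/differentiable_continuous/derivable1_diffP.
Qed.

Lemma cderiv_eq f x d d' : d = d' -> cderiv f x d -> cderiv f x d'.
Proof. by move=> ->. Qed.

Lemma cderiv_cst c x : cderiv (fun=> c) x 0.
Proof. by split; exact: is_derive_cst. Qed.

Lemma cderivD f g x d e : cderiv f x d -> cderiv g x e ->
  cderiv (fun t => f t + g t) x (d + e).
Proof.
move=> [f1 f2] [g1 g2]; split.
  rewrite (_ : (fun t => _) = (fun t => ReC (f t) + ReC (g t))); last by apply/funext => t; rewrite ReCD.
  by rewrite ReCD; exact: is_deriveD.
rewrite (_ : (fun t => _) = (fun t => ImC (f t) + ImC (g t))); last by apply/funext => t; rewrite ImCD.
by rewrite ImCD; exact: is_deriveD.
Qed.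

Lemma cderivM f g x d e : cderiv f x d -> cderiv g x e ->
  cderiv (fun t => f t * g t) x (d * g x + f x * e).
Proof.
move=> [f1 f2] [g1 g2]; split.
  rewrite (_ : (fun t => _) = (fun t => ReC (f t) * ReC (g t) - ImC (f t) * ImC (g t))); last by apply/funext => t; rewrite ReCM.
  apply: (@is_derive_eq _ _ _ _ _ _ _ _ (is_deriveB (is_deriveM f1 g1) (is_deriveM f2 g2))).
  by rewrite ReCD !ReCM /GRing.scale/=; ring.
rewrite (_ : (fun t => _) = (fun t => ReC (f t) * ImC (g t) + ImC (f t) * ReC (g t))); last by apply/funext => t; rewrite ImCM.
apply: (@is_derive_eq _ _ _ _ _ _ _ _ (is_deriveD (is_deriveM f1 g2) (is_deriveM f2 g1))).
by rewrite ImCD !ImCM /GRing.scale/=; ring.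
Qed.

Lemma cderivZ c f x d : cderiv f x d -> cderiv (fun t => c * f t) x (c * d).
Proof.
move=> fx; apply: cderiv_eq (cderivM (cderiv_cst c x) fx).
by rewrite mul0r add0r.
Qed.

Lemma cderiv_RC x : cderiv RC x 1.
Proof. by split; [exact: is_derive_id|exact: is_derive_cst]. Qed.

Lemma cderiv_cis x : cderiv cis x (mkC 0 1 * cis x).
Proof.
split; rewrite ?ReCM ?ImCM /= ?mul0r ?mul1r ?sub0r ?add0r.
  exact: is_derive_cos.
exact: is_derive_sin.
Qed.

Lemma cderiv_comp_lin f (a b x : R) d : cderiv f (a * x + b) d ->
  cderiv (fun t => f (a * t + b)) x (RC a * d).
Proof.
have D : is_derive x (1 : R) (fun t => a * t + b) a.
  apply: (@is_derive_eq _ _ _ _ _ _ _ _ (is_deriveD (is_deriveZ a (is_derive_id x (1:R))) (is_derive_cst b x (1:R)))).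
  by rewrite addr0 /GRing.scale /= mulr1.
move=> [f1 f2]; split; rewrite ?ReC_RCM ?ImC_RCM.
  by apply: (@is_derive_eq _ _ _ _ _ _ _ _ (@is_derive1_comp _ (fun t => ReC (f t)) (fun t => a * t + b) x _ _ f1 D)); rewrite mulrC.
by apply: (@is_derive_eq _ _ _ _ _ _ _ _ (@is_derive1_comp _ (fun t => ImC (f t)) (fun t => a * t + b) x _ _ f2 D)); rewrite mulrC.
Qed.

Lemma cderiv_cisN x : cderiv (fun t => cis (- t)) x (- mkC 0 1 * cis (- x)).
Proof.
have := @cderiv_comp_lin cis (-1) 0 x _ (cderiv_cis _).
rewrite (_ : (fun t => _) = (fun t => cis (- t))); last by apply/funext => t; rewrite mulN1r addr0.
by apply: cderiv_eq; rewrite mulN1r addr0 RCN RC1 mulrA mulN1r.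
Qed.

Lemma cderivX f x d k : cderiv f x d ->
  cderiv (fun t => f t ^+ k.+1) x (k.+1%:R * f x ^+ k * d).
Proof.
move=> fx; elim: k => [|k IH].
  by apply: cderiv_eq fx; rewrite expr0 !mul1r.
rewrite (_ : (fun t => _) = (fun t => f t * f t ^+ k.+1)); last by apply/funext => t; rewrite exprS.
by apply: cderiv_eq (cderivM fx IH); rewrite -[in RHS]natr1 !exprS; ring.
Qed.

Definition CI (a b : R) f : Cx R := Cint (@lebesgue_measure R) `[a, b] f.

Lemma CI_integrable a b f : (forall x, a <= x <= b -> ccont f x) ->
  cintegrable (@lebesgue_measure R) `[a, b] f.
Proof.
move=> fc; split; apply: continuous_compact_integrable;
  (try exact: segment_compact);
  apply: continuous_in_subspaceT => x; rewrite inE /= in_itv /= => /fc[f1 f2]//.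
Qed.

Lemma eq_CI a b f g : (forall x, a <= x <= b -> f x = g x) -> CI a b f = CI a b g.
Proof. by move=> fg; apply: eq_Cint => x; rewrite /= in_itv /=; exact: fg. Qed.

Lemma Rint_split (a b c : R) (f : R -> R) : a <= b -> b <= c ->
  (@lebesgue_measure R).-integrable `[a, c] (EFin \o f) ->
  \int[@lebesgue_measure R]_(x in `[a, c]) f x =
  \int[@lebesgue_measure R]_(x in `[a, b]) f x + \int[@lebesgue_measure R]_(x in `[b, c]) f x.
Proof.
move=> ab bc fi; have := @Rintegral_itvB R f (BLeft a) (BRight c) b fi.
rewrite !bnd_simp => /(_ ab bc) H.
rewrite -(Rintegral_itv_obnd_cbnd (r := b)) -?H; first by rewrite addrC subrK.
apply: integrableS fi => //; apply: subset_itvr; first by [].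
Qed.

Lemma CI_split a b c f : a <= b -> b <= c -> (forall x, a <= x <= c -> ccont f x) ->
  CI a c f = CI a b f + CI b c f.
Proof.
move=> ab bc fc; have [f1 f2] := CI_integrable fc.
by apply: Cx_eq; rewrite ?ReCD ?ImCD /=; exact: Rint_split.
Qed.

Lemma Rint_FTC (F f : R -> R) (a b : R) : a < b ->
  (forall x, a <= x <= b -> is_derive x (1 : R) F (f x)) ->
  (forall x, a <= x <= b -> {for x, continuous f}) ->
  \int[@lebesgue_measure R]_(x in `[a, b]) f x = F b - F a.
Proof.
move=> ab dF cf; rewrite /Rintegral (@continuous_FTC2 _ _ F)//.
- by apply: continuous_in_subspaceT => x; rewrite inE /= in_itv /=; exact: cf.
- have cF x : a <= x <= b -> {for x, continuous F}.
    by move=> /dF dFx; apply/differentiable_continuous/derivable1_diffP.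
  split.
  + move=> x; rewrite in_itv /= => /andP[ax xb].
    have : is_derive x (1:R) F (f x) by apply: dF; rewrite !ltW.
    by case.
  + by apply: cvg_at_right_filter; apply: cF; rewrite lexx ltW.
  + by apply: cvg_at_left_filter; apply: cF; rewrite lexx ltW.
- move=> x; rewrite in_itv /= => /andP[ax xb]; rewrite derive1E.
  have : is_derive x (1:R) F (f x) by apply: dF; rewrite !ltW.
  by case.
Qed.

Lemma CI_FTC (F f : R -> Cx R) a b : a < b ->
  (forall x, a <= x <= b -> cderiv F x (f x)) ->
  (forall x, a <= x <= b -> ccont f x) -> CI a b f = F b - F a.
Proof.
move=> ab dF cf; apply: Cx_eq; rewrite ?ReCB ?ImCB /=.
  by apply: (@Rint_FTC (fun x => ReC (F x)) (fun x => ReC (f x)) _ _ ab) => x xab; [case: (dF x xab)|case: (cf x xab)].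
by apply: (@Rint_FTC (fun x => ImC (F x)) (fun x => ImC (f x)) _ _ ab) => x xab; [case: (dF x xab)|case: (cf x xab)].
Qed.

Lemma absC_CI_le a b f K : a <= b -> (forall x, a <= x <= b -> ccont f x) ->
  (forall x, a <= x <= b -> absC (f x) <= K) -> absC (CI a b f) <= K * (b - a).
Proof.
move=> ab cf fK; have fi := CI_integrable cf.
apply: (le_trans (absC_Cint_le _ fi)) => //.
have -> : K * (b - a) = \int[@lebesgue_measure R]_(x in `[a, b]) K.
  rewrite Rintegral_cst//= lebesgue_measure_itv /= lte_fin; case: ltP => //= ba.
  by rewrite (_ : b - a = 0) ?mulr0//; apply/eqP; rewrite subr_eq0 eq_le ba ab.
apply: le_Rintegral => //.
- exact: integrable_absC.
- apply: continuous_compact_integrable; first exact: segment_compact.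
  by move=> x; exact: cvg_cst.
Qed.

Lemma CIZ a b c f : (forall x, a <= x <= b -> ccont f x) ->
  CI a b (fun x => c * f x) = c * CI a b f.
Proof. by move=> cf; apply: CintZ => //; exact: CI_integrable. Qed.
Lemma CIB a b f g : (forall x, a <= x <= b -> ccont f x) ->
  (forall x, a <= x <= b -> ccont g x) ->
  CI a b (fun x => f x - g x) = CI a b f - CI a b g.
Proof. by move=> cf cg; apply: CintB => //; exact: CI_integrable. Qed.
Lemma CI_sum I (r : seq I) (P : pred I) a b (F : I -> R -> Cx R) :
  (forall i x, P i -> a <= x <= b -> ccont (F i) x) ->
  CI a b (fun x => \sum_(i <- r | P i) F i x) = \sum_(i <- r | P i) CI a b (F i).
Proof.
by move=> cF; apply: Cint_sum => // i Pi; apply: CI_integrable => x; exact: cF.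
Qed.
Lemma CI_cst a b c : a <= b -> CI a b (fun=> c) = RC (b - a) * c.
Proof.
move=> ab; apply: Cx_eq; rewrite ?ReC_RCM ?ImC_RCM /=;
 rewrite Rintegral_cst//= lebesgue_measure_itv /= lte_fin mulrC; congr (_ * _);
 case: ltP => //= ba; by rewrite (_ : b - a = 0)//; apply/eqP; rewrite subr_eq0 eq_le ba ab.
Qed.

Lemma is_derive1_eps (f : R -> R) x l : is_derive x (1 : R) f l ->
  forall eps, 0 < eps -> exists2 d : R, 0 < d &
  forall h, `|h| < d -> `|f (x + h) - f x - l * h| <= eps * `|h|.
Proof.
move=> [fd fl] e e0.
have : h^-1 *: (f (h *: 1 + x) - f x) @[h --> 0^'] --> l by rewrite -fl; exact: fd.
move=> /cvgrPdist_le/(_ _ e0)/nbhs_ballP[d /= d0 H].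
exists d => // h hd; have [->|h0] := eqVneq h 0.
  by rewrite addr0 subrr mulr0 subr0 normr0 mulr0.
have := H h; rewrite /ball /= sub0r normrN => /(_ hd h0).
rewrite [h *: 1](_ : _ = h); last by rewrite /GRing.scale /= mulr1.
rewrite /GRing.scale /= => H1.
have -> : f (x + h) - f x - l * h = - (h * (l - h^-1 * (f (h + x) - f x))).
  by rewrite [h + x]addrC mulrBr mulVKf//; ring.
by rewrite normrN normrM mulrC ler_wpM2r.
Qed.

(** The mean value theorem gives different intermediate points for the real and the imaginary part,
    whence the factor 2. *)
Lemma cderiv_bound f (d : R -> Cx R) K : (forall x, 0 <= x <= 1 -> cderiv f x (d x)) ->
  (forall x, 0 <= x <= 1 -> absC (d x) <= K) -> absC (f 1 - f 0) <= K *+ 2.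
Proof.
move=> df dK; apply: (le_trans (absC_le _)); rewrite ReCB ImCB mulr2n.
apply: lerD.
- have [c c01 ->] : exists2 c, c \in `]0, 1[%R & ReC (f 1) - ReC (f 0) = ReC (d c) * (1 - 0).
    apply: (@MVT R (fun x => ReC (f x)) (fun x => ReC (d x))) => //.
      by move=> x; rewrite in_itv /= => /andP[x0 x1]; case: (df x); rewrite ?ltW.
    by apply: continuous_in_subspaceT => x; rewrite inE /= in_itv /= => /df /cderiv_ccont[].
  by move: c01; rewrite in_itv /= => /andP[c0 c1]; rewrite subr0 mulr1 (le_trans (ReC_le _))// dK// !ltW.
- have [c c01 ->] : exists2 c, c \in `]0, 1[%R & ImC (f 1) - ImC (f 0) = ImC (d c) * (1 - 0).
    apply: (@MVT R (fun x => ImC (f x)) (fun x => ImC (d x))) => //.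
      by move=> x; rewrite in_itv /= => /andP[x0 x1]; case: (df x); rewrite ?ltW.
    by apply: continuous_in_subspaceT => x; rewrite inE /= in_itv /= => /df /cderiv_ccont[].
  by move: c01; rewrite in_itv /= => /andP[c0 c1]; rewrite subr0 mulr1 (le_trans (ImC_le _))// dK// !ltW.
Qed.

End paths.

(** * Goursat's theorem on rectangles *)

Section goursat.
Context {R : realType}.

(** Goursat's bisection, detached from integrals: if [Phi] is positive on the large rectangle, one
    of the four quarters always keeps at least a quarter of the value. The nested rectangles shrink
    to a point (p, q), where the local bound, quadratic in the size, is eventually too small. *)
Lemma le0_bisection (Phi : R -> R -> R -> R -> R) (S T X Y : R) :
  0 < X -> 0 < Y ->
  (forall s t x y, S <= s -> T <= t -> 0 < x -> 0 < y -> s + x <= S + X ->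
    t + y <= T + Y ->
    Phi s t x y <= Phi s t (x / 2) (y / 2) + Phi (s + x / 2) t (x / 2) (y / 2)
      + Phi s (t + y / 2) (x / 2) (y / 2)
      + Phi (s + x / 2) (t + y / 2) (x / 2) (y / 2)) ->
  (forall p q, S <= p <= S + X -> T <= q <= T + Y -> forall eps, 0 < eps ->
    exists2 d : R, 0 < d & forall s t x y, S <= s -> T <= t -> 0 < x -> 0 < y ->
      s + x <= S + X -> t + y <= T + Y ->
      s <= p <= s + x -> t <= q <= t + y -> x + y < d ->
      Phi s t x y <= eps * (x + y) ^+ 2) ->
  Phi S T X Y <= 0.
Proof.
move=> X0 Y0 Hsub Hloc; rewrite leNgt; apply/negP => Phi0.
pose good (n : nat) (st : R * R) := [/\ S <= st.1, T <= st.2,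
  st.1 + X / 2 ^+ n <= S + X, st.2 + Y / 2 ^+ n <= T + Y &
  Phi S T X Y / 4 ^+ n <= Phi st.1 st.2 (X / 2 ^+ n) (Y / 2 ^+ n)].
have E (Z : R) n : Z / 2 ^+ n / 2 = Z / 2 ^+ n.+1 by rewrite exprS invfM mulrCA mulrC.
have pos (Z : R) n : 0 < Z -> 0 < Z / 2 ^+ n by move=> ?; rewrite divr_gt0// exprn_gt0.
have step n st : good n st -> exists st', good n.+1 st' /\
    [/\ st.1 <= st'.1, st.2 <= st'.2, st'.1 + X / 2 ^+ n.+1 <= st.1 + X / 2 ^+ n &
        st'.2 + Y / 2 ^+ n.+1 <= st.2 + Y / 2 ^+ n].
  case: st => s t [/= Ss Tt sX tY PH].
  have x0 := pos X n X0; have y0 := pos Y n Y0.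
  have x1 := pos X n.+1 X0; have y1 := pos Y n.+1 Y0.
  have Ex : X / 2 ^+ n = X / 2 ^+ n.+1 + X / 2 ^+ n.+1 by rewrite -E -splitr.
  have Ey : Y / 2 ^+ n = Y / 2 ^+ n.+1 + Y / 2 ^+ n.+1 by rewrite -E -splitr.
  have := Hsub s t _ _ Ss Tt x0 y0 sX tY; rewrite !E => sub.
  have PE : Phi S T X Y / 4 ^+ n = Phi S T X Y / 4 ^+ n.+1 *+ 4.
    rewrite exprS invfM mulrCA -mulr_natr; by field; rewrite expf_neq0.
  rewrite Ex Ey in sX tY PH sub; rewrite PE in PH; rewrite /good /= Ex Ey.
  clear Hsub Hloc E pos Phi0 x0 y0 Ex Ey PE good.
  move: (X / 2 ^+ n.+1) (Y / 2 ^+ n.+1) (Phi S T X Y / 4 ^+ n.+1) x1 y1 sX tY PH sub => a b c a0 b0 sX tY PH sub.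
  have {}sub := le_trans PH sub.
  have [h1|h1] := leP c (Phi s t a b).
    by exists (s, t); split; split => //=; clear -Ss Tt a0 b0 sX tY; lra.
  have [h2|h2] := leP c (Phi (s + a) t a b).
    by exists (s + a, t); split; split => //=; clear -Ss Tt a0 b0 sX tY; lra.
  have [h3|h3] := leP c (Phi s (t + b) a b).
    by exists (s, t + b); split; split => //=; clear -Ss Tt a0 b0 sX tY; lra.
  have [h4|h4] := leP c (Phi (s + a) (t + b) a b).
    by exists (s + a, t + b); split; split => //=; clear -Ss Tt a0 b0 sX tY; lra.
  move: h1 h2 h3 h4 sub; move: (Phi s t a b) (Phi (s + a) t a b) (Phi s (t + b) a b) (Phi (s + a) (t + b) a b).
  by clear=> p1 p2 p3 p4; lra.
have g0 : good 0%N (S, T) by split; rewrite /= ?expr0 ?divr1.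
pose nx n st := if pselect (good n st) is left g then projT1 (cid (step n st g)) else st.
pose u := fix u n := if n is m.+1 then nx m (u m) else (S, T).
have gu n : good n (u n).
  elim: n => //= n IH; rewrite /nx; case: pselect => // g.
  by case: (cid _) => st' [].
have su n : [/\ (u n).1 <= (u n.+1).1, (u n).2 <= (u n.+1).2, (u n.+1).1 + X / 2 ^+ n.+1 <= (u n).1 + X / 2 ^+ n &
        (u n.+1).2 + Y / 2 ^+ n.+1 <= (u n).2 + Y / 2 ^+ n].
  rewrite /= /nx; case: pselect => [g|/(_ (gu n))//].
  by case: (cid _) => st' [].
have mono (a : nat -> R) : (forall n, a n <= a n.+1) -> forall m n, (m <= n)%N -> a m <= a n.
  move=> H m n /subnK <-; elim: (n - m)%N => // k IH; exact: le_trans IH (H _).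
have key (a b : nat -> R) Z : 0 < Z -> (forall n, b n = a n + Z / 2 ^+ n) ->
    (forall n, a n <= a n.+1) -> (forall n, b n.+1 <= b n) ->
    exists p, forall n, a n <= p <= b n.
  move=> Z0 bE am bm.
  have ab m n : a m <= b n.
    have bm' k l : (k <= l)%N -> b l <= b k.
      move=> /(mono (fun n => - b n)); rewrite lerN2; apply=> i; by rewrite lerN2.
    apply: (le_trans (mono a am _ _ (leq_maxl m n))).
    apply: (le_trans _ (bm' _ _ (leq_maxr m n))).
    by rewrite bE lerDl ltW// pos.
  have hs : has_sup (range a).
    split; first by exists (a 0%N); exists 0%N.
    by exists (b 0%N) => _ [n _ <-].
  exists (sup (range a)) => n; apply/andP; split.
    by apply: ub_le_sup; [case: hs|exists n].
  by apply: ge_sup; [case: hs|move=> _ [m _ <-]].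
have [p Hp] : exists p, forall n, (u n).1 <= p <= (u n).1 + X / 2 ^+ n.
  by apply: (key _ (fun n => (u n).1 + X / 2 ^+ n) X) => // n; case: (su n).
have [q Hq] : exists q, forall n, (u n).2 <= q <= (u n).2 + Y / 2 ^+ n.
  by apply: (key _ (fun n => (u n).2 + Y / 2 ^+ n) Y) => // n; case: (su n).
have XY0 : 0 < (X + Y) ^+ 2 by rewrite exprn_gt0// addr_gt0.
(* With half of this ratio as eps, the local bound on the n-th rectangle is half of the lower bound
   recorded in [good]. *)
have [|||d d0 Hd] := Hloc p q _ _ (Phi S T X Y / (X + Y) ^+ 2 / 2).
- by have := Hp 0%N; rewrite expr0 divr1.
- by have := Hq 0%N; rewrite expr0 divr1.
- by rewrite !divr_gt0.
have [n Hn] : exists n, (X + Y) / 2 ^+ n < d.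
  exists (Num.truncn ((X + Y) / d)).+1; rewrite ltr_pdivrMr ?exprn_gt0// mulrC -ltr_pdivrMr//.
  apply: (lt_trans (truncnS_gt _)).
  by rewrite -natrX ltr_nat ltn_expl.
have [g1 g2 g3 g4 g5] := gu n.
have := Hd _ _ _ _ g1 g2 (pos X n X0) (pos Y n Y0) g3 g4 (Hp n) (Hq n).
rewrite -mulrDl => /(_ Hn) g6.
have := le_trans g5 g6; rewrite leNgt => /negP; apply.
rewrite expr_div_n -exprM [(n * 2)%N]mulnC exprM (_ : 2 ^+ 2 = 4 :> R); last by rewrite -natrX.
rewrite mulrA ltr_pM2r ?invr_gt0 ?exprn_gt0//.
rewrite mulrAC divfK ?lt0r_neq0//; lra.
Qed.

(** The integral of [G], read as a function of s + i t, along the boundary of the rectangle with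
    lower left corner (s, t) and sides x, y, counterclockwise. *)
Definition rect (G : R -> R -> Cx R) s t x y : Cx R :=
  CI s (s + x) (fun r => G r t) - CI s (s + x) (fun r => G r (t + y))
  + (mkC 0 1 * CI t (t + y) (G (s + x)) - mkC 0 1 * CI t (t + y) (G s)).

(** Complex differentiability at p + i q with derivative [B], in real coordinates. *)
Definition rdiff (G : R -> R -> Cx R) p q (B : Cx R) :=
  forall eps, 0 < eps -> exists2 d : R, 0 < d & forall s t,
    `|s - p| + `|t - q| < d ->
    absC (G s t - G p q - B * mkC (s - p) (t - q)) <= eps * (`|s - p| + `|t - q|).

Lemma absC_mkC_le x y : absC (mkC x y : Cx R) <= `|x| + `|y|.
Proof. exact: absC_le. Qed.

Lemma rdiff_cont G p q B : rdiff G p q B ->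
  forall eps, 0 < eps -> exists2 d : R, 0 < d & forall s t,
    `|s - p| + `|t - q| < d -> absC (G s t - G p q) <= eps.
Proof.
move=> GB e e0; have [d d0 H] := GB _ ltr01.
have K0 : 0 < 1 + absC B by rewrite ltr_pwDl ?absC_ge0.
exists (Num.min d (e / (1 + absC B))); first by rewrite lt_min d0 divr_gt0.
move=> s t; rewrite lt_min => /andP[/H st1]; rewrite ltr_pdivlMr// mulrC => st2.
apply: le_trans (ltW st2); rewrite mulrDl.
rewrite -[G s t - _](subrK (B * mkC (s - p) (t - q))).
apply: (le_trans (absCD _ _)); apply: lerD => //.
by rewrite absCM ler_wpM2l ?absC_ge0// absC_mkC_le.
Qed.

Lemma rdiff_ccont G p q B : rdiff G p q B ->
  ccont (fun s => G s q) p /\ ccont (G p) q.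
Proof.
move=> GB; split; apply: ccont_eps => e e0; have [d d0 H] := rdiff_cont GB e0;
  exists d => // t td; apply: H; by rewrite subrr normr0 ?addr0 ?add0r.
Qed.

Lemma rect_affine A B p q s t x y : 0 < x -> 0 < y ->
  rect (fun s t => A + B * mkC (s - p) (t - q)) s t x y = 0.
Proof.
move=> x0 y0.
have C0 (f : R -> Cx R) k r e : cderiv f r e -> ccont (fun r => A + B * f r + k) r.
  move=> fe; apply: ccontD; last exact: ccont_cst.
  apply: ccontD; first exact: ccont_cst.
  by apply: ccontM; [exact: ccont_cst|exact: cderiv_ccont fe].
have D1 r t' : cderiv (fun s => mkC (s - p) (t' - q) : Cx R) r 1.
  split => /=; last exact: is_derive_cst.
  apply: (@is_derive_eq _ _ _ _ _ _ _ _ (is_deriveB (is_derive_id r (1:R)) (is_derive_cst p r (1:R)))).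
  by rewrite subr0.
have D2 r s' : cderiv (fun t => mkC (s' - p) (t - q) : Cx R) r (mkC 0 1).
  split => /=; first exact: is_derive_cst.
  apply: (@is_derive_eq _ _ _ _ _ _ _ _ (is_deriveB (is_derive_id r (1:R)) (is_derive_cst q r (1:R)))).
  by rewrite subr0.
(* A primitive of the affine function: each side contributes its increment, and the increments
   cancel around the boundary. *)
pose P s t : Cx R := A * mkC (s - p) (t - q) + B / 2 * mkC (s - p) (t - q) ^+ 2.
have H t' : CI s (s + x) (fun r => A + B * mkC (r - p) (t' - q)) = P (s + x) t' - P s t'.
  apply: (CI_FTC (F := fun r => P r t')); first by rewrite ltrDl.
    move=> r _; apply: cderiv_eq (cderivD (cderivZ A (D1 r t')) (cderivZ (B / 2) (cderivX 1 (D1 r t')))).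
    by rewrite expr1; field.
  by move=> r _; have := C0 _ 0 _ _ (D1 r t'); under eq_fun do rewrite addr0.
have V s' : mkC 0 1 * CI t (t + y) (fun r => A + B * mkC (s' - p) (r - q)) = P s' (t + y) - P s' t.
  have cc r : ccont (fun r => A + B * mkC (s' - p) (r - q)) r.
    by have := C0 _ 0 _ _ (D2 r s'); under eq_fun do rewrite addr0.
  rewrite -CIZ; last by move=> r _; exact: cc.
  apply: (CI_FTC (F := fun r => P s' r)); first by rewrite ltrDl.
    move=> r _; apply: cderiv_eq (cderivD (cderivZ A (D2 r s')) (cderivZ (B / 2) (cderivX 1 (D2 r s')))).
    by rewrite expr1; field.
  by move=> r _; apply: ccontM; [exact: ccont_cst|exact: cc].
by rewrite /rect !H !V; ring.
Qed.

Lemma absC_rect_le G s t x y K : 0 <= x -> 0 <= y ->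
  (forall p q, s <= p <= s + x -> t <= q <= t + y -> ccont (fun r => G r q) p /\ ccont (G p) q) ->
  (forall p q, s <= p <= s + x -> t <= q <= t + y -> absC (G p q) <= K) ->
  absC (rect G s t x y) <= 2 * (K * (x + y)).
Proof.
move=> x0 y0 cG GK.
have b (z w : R) : 0 <= w -> (z <= z <= z + w) /\ (z <= z + w <= z + w).
  by move=> w0; rewrite !lexx lerDl w0.
have [s1 s2] := b s x x0; have [t1 t2] := b t y y0.
have H q : t <= q <= t + y -> absC (CI s (s + x) (fun r => G r q)) <= K * x.
  move=> tq; apply: (le_trans (@absC_CI_le _ _ _ _ K _ _ _)) => //.
  - by rewrite lerDl.
  - by move=> p sp; case: (cG p q sp tq).
  - by move=> p sp; exact: GK.
  - by rewrite addrAC subrr add0r.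
have V p : s <= p <= s + x -> absC (mkC 0 1 * CI t (t + y) (G p)) <= K * y.
  move=> sp; rewrite absCM (_ : absC (mkC 0 1) = 1) ?mul1r; last first.
    by rewrite absCE /= expr0n expr1n add0r sqrtr1.
  apply: (le_trans (@absC_CI_le _ _ _ _ K _ _ _)) => //.
  - by rewrite lerDl.
  - by move=> q tq; case: (cG p q sp tq).
  - by move=> q tq; exact: GK.
  - by rewrite addrAC subrr add0r.
apply: (le_trans (absCD _ _)).
have := absCB (CI s (s + x) (fun r => G r t)) (CI s (s + x) (fun r => G r (t + y))).
have := absCB (mkC 0 1 * CI t (t + y) (G (s + x))) (mkC 0 1 * CI t (t + y) (G s)).
have := H t t1; have := H (t + y) t2; have := V s s1; have := V (s + x) s2.
lra.
Qed.

Lemma rectB G1 G2 s t x y : 0 <= x -> 0 <= y ->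
  (forall p q, s <= p <= s + x -> t <= q <= t + y -> ccont (fun r => G1 r q) p /\ ccont (G1 p) q) ->
  (forall p q, s <= p <= s + x -> t <= q <= t + y -> ccont (fun r => G2 r q) p /\ ccont (G2 p) q) ->
  rect (fun p q => G1 p q - G2 p q) s t x y = rect G1 s t x y - rect G2 s t x y.
Proof.
move=> x0 y0 c1 c2.
have b (z w : R) : 0 <= w -> (z <= z <= z + w) /\ (z <= z + w <= z + w).
  by move=> w0; rewrite !lexx lerDl w0.
have [s1 s2] := b s x x0; have [t1 t2] := b t y y0.
have H q : t <= q <= t + y -> CI s (s + x) (fun r => G1 r q - G2 r q) =
    CI s (s + x) (fun r => G1 r q) - CI s (s + x) (fun r => G2 r q).
  by move=> tq; apply: CIB => p sp; [case: (c1 p q sp tq)|case: (c2 p q sp tq)].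
have V p : s <= p <= s + x -> CI t (t + y) (fun r => G1 p r - G2 p r) =
    CI t (t + y) (G1 p) - CI t (t + y) (G2 p).
  by move=> sp; apply: CIB => q tq; [case: (c1 p q sp tq)|case: (c2 p q sp tq)].
by rewrite /rect !H// !V//; ring.
Qed.

Lemma rect_split G s t x y : 0 < x -> 0 < y ->
  (forall p q, s <= p <= s + x -> t <= q <= t + y -> ccont (fun r => G r q) p /\ ccont (G p) q) ->
  rect G s t x y = rect G s t (x / 2) (y / 2) + rect G (s + x / 2) t (x / 2) (y / 2)
      + rect G s (t + y / 2) (x / 2) (y / 2)
      + rect G (s + x / 2) (t + y / 2) (x / 2) (y / 2).
Proof.
move=> x0 y0 cG.
have Ex : s + x / 2 + x / 2 = s + x by rewrite -addrA -splitr.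
have Ey : t + y / 2 + y / 2 = t + y by rewrite -addrA -splitr.
have x2 : 0 < x / 2 by rewrite divr_gt0.
have y2 : 0 < y / 2 by rewrite divr_gt0.
have H q : t <= q <= t + y -> CI s (s + x) (fun r => G r q) =
    CI s (s + x / 2) (fun r => G r q) + CI (s + x / 2) (s + x) (fun r => G r q).
  move=> tq; apply: CI_split; [lra|lra|].
  by move=> p sp; case: (cG p q sp tq).
have V p : s <= p <= s + x -> CI t (t + y) (G p) =
    CI t (t + y / 2) (G p) + CI (t + y / 2) (t + y) (G p).
  move=> sp; apply: CI_split; [lra|lra|].
  by move=> q tq; case: (cG p q sp tq).
rewrite /rect !Ex !Ey (H t); last lra.
rewrite (H (t + y)); last lra.
rewrite (V s); last lra.
rewrite (V (s + x)); last lra.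
ring.
Qed.

Theorem Goursat_rect G S T X Y : 0 < X -> 0 < Y ->
  (forall p q, S <= p <= S + X -> T <= q <= T + Y -> exists B, rdiff G p q B) ->
  rect G S T X Y = 0.
Proof.
move=> X0 Y0 GB.
have cG s t x y : S <= s -> T <= t -> s + x <= S + X -> t + y <= T + Y ->
   forall p q, s <= p <= s + x -> t <= q <= t + y -> ccont (fun r => G r q) p /\ ccont (G p) q.
  move=> Ss Tt sX tY p q sp tq; have [||B] := GB p q; [lra|lra|].
  exact: rdiff_ccont.
apply/eqP; rewrite -absC_eq0 eq_le absC_ge0 andbT.
apply: (@le0_bisection (fun s t x y => absC (rect G s t x y)) S T X Y) => //.
  move=> s t x y Ss Tt x0 y0 sX tY; rewrite (rect_split x0 y0); last exact: cG.
  apply: (le_trans (absCD _ _)); rewrite lerD2r.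
  apply: (le_trans (absCD _ _)); rewrite lerD2r.
  exact: absCD.
move=> p q Sp Tq e e0; have [B HB] := GB p q Sp Tq.
have [d d0 Hd] := HB (e / 2) ltac:(by rewrite divr_gt0).
exists d => // s t x y Ss Tt x0 y0 sX tY sp tq xyd.
(* The affine part of [G] at (p, q) has zero contour integral; the remainder is at most
   [e / 2 * (x + y)] on a rectangle of perimeter [2 * (x + y)]. *)
pose L s t := G p q + B * mkC (s - p) (t - q).
have cL p' q' : ccont (fun r => L r q') p' /\ ccont (L p') q'.
  have := @rdiff_ccont L p' q' B; apply => eps eps0; exists 1 => // s' t' _.
  rewrite (_ : _ - _ - _ = 0); last first.
    rewrite /L opprD addrACA subrr add0r -mulrBr -mulrBr.
    by apply/eqP; rewrite mulf_eq0; apply/orP; right; apply/eqP; apply: Cx_eq; rewrite !(ReCB, ImCB) /=; ring.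
  by rewrite absC0; apply: mulr_ge0; [exact: ltW|exact: addr_ge0].
have cG' := cG s t x y Ss Tt sX tY.
have -> : rect G s t x y = rect (fun a b => G a b - L a b) s t x y.
  by rewrite rectB ?ltW// rect_affine// subr0.
have -> : e * (x + y) ^+ 2 = 2 * (e / 2 * (x + y) * (x + y)) by field.
apply: absC_rect_le; [exact: ltW|exact: ltW| |].
  move=> p' q' sp' tq'; have [c1 c2] := cG' _ _ sp' tq'; have [l1 l2] := cL p' q'.
  by split; exact: ccontB.
move=> p' q' sp' tq'; rewrite /L opprD addrA.
have h : `|p' - p| + `|q' - q| <= x + y.
  apply: lerD; rewrite ler_norml; lra.
apply: (le_trans (Hd _ _ (le_lt_trans h xyd))).
by rewrite ler_wpM2l// divr_ge0 ?ltW.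
Qed.

End goursat.

(** * One complex variable: circle integrals, Cauchy's formula for the derivative, a Taylor
    estimate *)

Section one_complex_variable.
Context {R : realType}.
Implicit Types (F : Cx R -> Cx R) (w a c B : Cx R).

Definition cdiff F w B := forall eps, 0 < eps -> exists2 d : R, 0 < d &
  forall h, absC h < d -> absC (F (w + h) - F w - B * h) <= eps * absC h.

Lemma eps_is_derive1 (f : R -> R) x l :
  (forall eps, 0 < eps -> exists2 d : R, 0 < d &
     forall h, `|h| < d -> `|f (x + h) - f x - l * h| <= eps * `|h|) ->
  is_derive x (1 : R) f l.
Proof.
move=> H.
have C : h^-1 *: (f (h *: 1 + x) - f x) @[h --> 0^'] --> l.
  apply/cvgrPdist_le => e e0; have [d d0 Hd] := H e e0.
  apply/nbhs_ballP; exists d => //= h; rewrite /ball /= sub0r normrN => hd h0.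
  have := Hd h hd; rewrite /GRing.scale /= mulr1.
  have -> : f (x + h) - f x - l * h = - (h * (l - h^-1 * (f (h + x) - f x))).
    by rewrite [h + x]addrC mulrBr mulVKf//; ring.
  by rewrite normrN normrM mulrC ler_pM2r// normr_gt0.
split; first exact: (cvgP _ C).
exact: (cvg_lim _ C).
Qed.

Lemma eps_cderiv (f : R -> Cx R) x l :
  (forall eps, 0 < eps -> exists2 d : R, 0 < d &
     forall h, `|h| < d -> absC (f (x + h) - f x - RC h * l) <= eps * `|h|) ->
  cderiv f x l.
Proof.
move=> H; split; apply: eps_is_derive1 => e e0; have [d d0 Hd] := H e e0;
  exists d => // h /Hd; apply: le_trans.
  by rewrite mulrC -ReC_RCM -!ReCB ReC_le.
by rewrite mulrC -ImC_RCM -!ImCB ImC_le.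
Qed.

Lemma cderiv_eps (f : R -> Cx R) x l : cderiv f x l ->
  forall eps, 0 < eps -> exists2 d : R, 0 < d &
     forall h, `|h| < d -> absC (f (x + h) - f x - RC h * l) <= eps * `|h|.
Proof.
move=> [f1 f2] e e0.
have e2 : 0 < e / 2 by rewrite divr_gt0.
have [d1 d10 H1] := is_derive1_eps f1 e2.
have [d2 d20 H2] := is_derive1_eps f2 e2.
exists (Num.min d1 d2); first by rewrite lt_min d10 d20.
move=> h; rewrite lt_min => /andP[/H1 h1 /H2 h2].
apply: (le_trans (absC_le _)).
rewrite !ReCB !ImCB ReC_RCM ImC_RCM [h * ReC l]mulrC [h * ImC l]mulrC.
by apply: (le_trans (lerD h1 h2)); rewrite -mulrDl -splitr.
Qed.

Lemma cdiff_line F a c x B : cdiff F (a + RC x * c) B ->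
  cderiv (fun x => F (a + RC x * c)) x (c * B).
Proof.
move=> FB; apply: eps_cderiv => e e0.
have K0 : 0 < absC c + 1 by rewrite ltr_wpDl ?absC_ge0.
have [d d0 Hd] := FB (e / (absC c + 1)) ltac:(by rewrite divr_gt0).
exists (d / (absC c + 1)); first by rewrite divr_gt0.
move=> h; rewrite ltr_pdivlMr// => hd.
have -> : a + RC (x + h) * c = a + RC x * c + RC h * c by rewrite RCD; ring.
have hc : absC (RC h * c) <= `|h| * (absC c + 1).
  by rewrite absCM absC_RC ler_wpM2l// lerDl.
have := Hd _ (le_lt_trans hc hd).
rewrite (_ : B * (RC h * c) = RC h * (c * B)); last by ring.
move=> /le_trans; apply.
rewrite -mulrA ler_wpM2l ?(ltW e0)//.
by rewrite mulrC ler_pdivrMr.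
Qed.

Lemma cdiff_affine F a c w B : cdiff F (a + c * w) B ->
  cdiff (fun w => F (a + c * w)) w (c * B).
Proof.
move=> FB e e0.
have K0 : 0 < absC c + 1 by rewrite ltr_wpDl ?absC_ge0.
have [d d0 Hd] := FB (e / (absC c + 1)) ltac:(by rewrite divr_gt0).
exists (d / (absC c + 1)); first by rewrite divr_gt0.
move=> h; rewrite ltr_pdivlMr// => hd.
have -> : a + c * (w + h) = a + c * w + c * h by ring.
have hc : absC (c * h) <= absC h * (absC c + 1).
  by rewrite absCM mulrC ler_wpM2l ?absC_ge0// lerDl.
have := Hd _ (le_lt_trans hc hd).
rewrite (_ : B * (c * h) = c * B * h); last by ring.
move=> /le_trans; apply.
rewrite -mulrA ler_wpM2l ?(ltW e0)//.
by rewrite mulrC ler_pdivrMr.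
Qed.

Lemma cdiff_cont F w B : cdiff F w B -> forall eps, 0 < eps ->
  exists2 d : R, 0 < d & forall h, absC h < d -> absC (F (w + h) - F w) <= eps.
Proof.
move=> FB e e0; have [d d0 H] := FB _ ltr01.
have K0 : 0 < 1 + absC B by rewrite ltr_pwDl ?absC_ge0.
exists (Num.min d (e / (1 + absC B))); first by rewrite lt_min d0 divr_gt0.
move=> h; rewrite lt_min => /andP[/H h1]; rewrite ltr_pdivlMr// mulrC => h2.
apply: le_trans (ltW h2); rewrite mulrDl.
rewrite -[F (w + h) - _](subrK (B * h)).
by apply: (le_trans (absCD _ _)); rewrite absCM lerD2r.
Qed.

Lemma cdiff_quotient F c w B : w != 0 -> cdiff F w B ->
  cdiff (fun v => (F v - c) / v) w ((B * w - (F w - c)) / w ^+ 2).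
Proof.
move=> w0 FB e e0; set K := absC w.
have K0 : 0 < K by rewrite lt_neqAle eq_sym absC_eq0 w0 absC_ge0.
set f0 := F w - c; set N := absC (B * w - f0) + 1.
have N0 : 0 < N by rewrite ltr_wpDl ?absC_ge0.
have [d d0 Hd] := FB (e * K / 4) ltac:(by rewrite divr_gt0// mulr_gt0).
(* [K / 2] keeps [w + h] away from 0; the last bound absorbs the term quadratic in [h]. *)
exists (Num.min d (Num.min (K / 2) (e * K ^+ 3 / (4 * N)))).
  by rewrite !lt_min d0 !divr_gt0//= ?mulr_gt0// exprn_gt0.
move=> h; rewrite !lt_min => /and3P[/Hd hd hK hN].
have wh : K / 2 <= absC (w + h).
  have : K <= absC (w + h) + absC h.
    by apply: le_trans (absCB _ _); rewrite addrK.
  lra.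
have wh0 : w + h != 0.
  by rewrite -absC_eq0; apply: lt0r_neq0; apply: lt_le_trans wh; rewrite divr_gt0.
have -> : (F (w + h) - c) / (w + h) - f0 / w - (B * w - f0) / w ^+ 2 * h =
   (F (w + h) - F w - B * h) / (w + h) - h * (B * w - f0) * h / ((w + h) * w ^+ 2).
  by rewrite /f0; field; rewrite w0 wh0.
apply: (le_trans (absCB _ _)); rewrite !absCM !absCV !absCM -/K -[K * K]expr2.
have i1 : (absC (w + h))^-1 <= 2 / K.
  by rewrite -[2 / K]invf_div lef_pV2 ?posrE// ?divr_gt0//; apply: lt_le_trans wh; rewrite divr_gt0.
rewrite (splitr (e * absC h)); apply: lerD.
  have -> : e * absC h / 2 = e * K / 4 * absC h * (2 / K) by field; rewrite lt0r_neq0.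
  by apply: ler_pM => //; [exact: absC_ge0|rewrite invr_ge0 absC_ge0].
have hh := absC_ge0 h.
apply: (@le_trans _ _ (absC h * N * (e * K ^+ 3 / (4 * N)) * (2 / K / K ^+ 2))).
  apply: ler_pM => //.
  - by rewrite !mulr_ge0 ?absC_ge0.
  - by rewrite invr_ge0 mulr_ge0 ?absC_ge0 ?exprn_ge0// ltW.
  - apply: ler_pM => //; last exact: ltW.
      by rewrite mulr_ge0 ?absC_ge0.
    by rewrite ler_wpM2l// /N lerDl.
  - by rewrite invfM ler_wpM2r// invr_ge0 exprn_ge0// ltW.
rewrite le_eqVlt; apply/orP; left; apply/eqP; field.
by rewrite !lt0r_neq0.
Qed.

(** The exponential of s + i t. In the coordinates s = log |w| and t = arg w an annulus becomes a
    rectangle, so that [Goursat_rect] can compare two concentric circles. *)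
Definition Cexp (s t : R) : Cx R := RC (expR s) * cis t.

Lemma CexpD s t u v : Cexp (s + u) (t + v) = Cexp s t * Cexp u v.
Proof. by rewrite /Cexp expRD RCM cisD; ring. Qed.

Lemma absC_Cexp s t : absC (Cexp s t) = expR s.
Proof. by rewrite absCM absC_cis mulr1 absC_RC ger0_norm// expR_ge0. Qed.

Lemma Cexp_approx eps : 0 < eps -> exists2 d : R, 0 < d & forall u v,
  `|u| + `|v| < d -> absC (Cexp u v - 1 - mkC u v) <= eps * (`|u| + `|v|).
Proof.
(* The factor 8 covers the total coefficients 3 of [e * |u|] and 6 of [e * |v|] in [r1] and [r2]
   below. *)
move=> e0; have [e [e1 le1 le8]] : exists e : R, [/\ 0 < e, e <= 1 & e * 8 <= eps].
  exists (Num.min (eps / 8) 1); rewrite lt_min divr_gt0// ltr01.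
  by rewrite ge_min lexx orbT -ler_pdivlMr// ge_min lexx.
have [d1 d10 H1] := is_derive1_eps (is_derive_expR (0:R)) e1.
have [d2 d20 H2] := is_derive1_eps (is_derive_cos (0:R)) e1.
have [d3 d30 H3] := is_derive1_eps (is_derive_sin (0:R)) e1.
exists (Num.min (Num.min d1 d2) (Num.min d3 e)); first by rewrite !lt_min d10 d20 d30 e1.
move=> u v; rewrite !lt_min => /andP[/andP[a1 a2] /andP[a3 a4]].
have u0 := normr_ge0 u; have v0 := normr_ge0 v.
have := H1 u ltac:(lra); rewrite add0r expR0 mul1r => b1.
have := H2 v ltac:(lra); rewrite add0r cos0 sin0 oppr0 mul0r subr0 => b2.
have := H3 v ltac:(lra); rewrite add0r cos0 sin0 subr0 mul1r => b3.
have c1 : `|expR u - 1| <= 2 * `|u|.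
  have := ler_normD (expR u - 1 - u) u; rewrite subrK.
  have : e * `|u| <= 1 * `|u| by rewrite ler_wpM2r.
  lra.
have c2 : expR u <= 3.
  have := ler_norm (expR u - 1); lra.
have x0 := expR_gt0 u.
have r1 : `|expR u * cos v - 1 - u| <= e * `|u| + 3 * (e * `|v|).
  have -> : expR u * cos v - 1 - u = (expR u - 1 - u) + expR u * (cos v - 1) by ring.
  apply: (le_trans (ler_normD _ _)); apply: lerD => //.
  by rewrite normrM (ger0_norm (ltW x0)); apply: ler_pM => //; exact: ltW.
have r2 : `|expR u * sin v - v| <= 3 * (e * `|v|) + 2 * (e * `|u|).
  have -> : expR u * sin v - v = expR u * (sin v - v) + (expR u - 1) * v by ring.
  apply: (le_trans (ler_normD _ _)); apply: lerD => //.
    by rewrite normrM (ger0_norm (ltW x0)); apply: ler_pM => //; exact: ltW.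
  rewrite normrM; apply: (@le_trans _ _ (2 * `|u| * `|v|)); first by rewrite ler_wpM2r.
  by rewrite -mulrA ler_wpM2l// mulrC ler_wpM2r//; lra.
apply: (le_trans (absC_le _)); rewrite !ReCB !ImCB ReC_RCM ImC_RCM /= subr0.
apply: (le_trans (lerD r1 r2)).
have : 0 <= e * `|v| by rewrite mulr_ge0// ltW.
have : 0 <= e * `|u| by rewrite mulr_ge0// ltW.
have : e * 8 * (`|u| + `|v|) <= eps * (`|u| + `|v|) by rewrite ler_wpM2r// addr_ge0.
lra.
Qed.

Lemma rdiff_Cexp F p q B : cdiff F (Cexp p q) B ->
  rdiff (fun s t => F (Cexp s t)) p q (B * Cexp p q).
Proof.
move=> FB e e0; set w := Cexp p q in FB *; set K := absC w.
have K0 : 0 < K by rewrite /K absC_Cexp expR_gt0.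
have BK : 0 < 2 * (absC B * K + 1) by rewrite mulr_gt0// ltr_wpDl// mulr_ge0 ?absC_ge0// ltW.
pose e1 := Num.min 1 (e / (2 * (absC B * K + 1))).
have e10 : 0 < e1 by rewrite lt_min ltr01 divr_gt0.
have [d1 d10 H1] := Cexp_approx e10.
have [d2 d20 H2] := FB (e / (4 * K)) ltac:(by rewrite divr_gt0// mulr_gt0).
exists (Num.min d1 (d2 / (K * 2))); first by rewrite lt_min d10 divr_gt0// mulr_gt0.
move=> s t; rewrite lt_min ltr_pdivlMr ?mulr_gt0// => /andP[h1 h2].
have := H1 _ _ h1; set N := `|s - p| + `|t - q| in h1 h2 *; set r := Cexp _ _ - _ - _ => rN.
have N0 : 0 <= N by rewrite addr_ge0.
have Es : Cexp s t = w + w * (mkC (s - p) (t - q) + r).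
  have -> : Cexp s t = Cexp (p + (s - p)) (q + (t - q)).
    by rewrite [p + _]addrC subrK [q + _]addrC subrK.
  by rewrite CexpD -/w /r; ring.
have e11 : e1 <= 1 by rewrite ge_min lexx.
have mr : absC (mkC (s - p) (t - q) + r) <= 2 * N.
  apply: (le_trans (absCD _ _)); have := absC_mkC_le (s - p) (t - q); rewrite -/N.
  have : e1 * N <= 1 * N by rewrite ler_wpM2r.
  lra.
have hm : absC (w * (mkC (s - p) (t - q) + r)) <= K * (2 * N).
  by rewrite absCM ler_wpM2l// ltW.
have := H2 _ ltac:(by apply: (le_lt_trans hm); rewrite mulrC -mulrA mulrCA mulrA mulrC mulrA in h2 *; lra).
rewrite -Es => H3.
rewrite (_ : _ - _ - _ = (F (Cexp s t) - F w - B * (w * (mkC (s - p) (t - q) + r))) + B * w * r); last by ring.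
apply: (le_trans (absCD _ _)).
have -> : e * N = e / (4 * K) * (K * (2 * N)) + e / 2 * N by field; rewrite lt0r_neq0.
apply: lerD.
  by apply: (le_trans H3); rewrite ler_wpM2l// divr_ge0 ?(ltW e0)// mulr_ge0// ltW.
rewrite [absC (_ * r)]absCM [absC (B * w)]absCM -/K; apply: (@le_trans _ _ (absC B * K * (e1 * N))).
  by rewrite ler_wpM2l// mulr_ge0 ?absC_ge0 ?(ltW K0).
rewrite mulrA ler_wpM2r//.
apply: (@le_trans _ _ ((absC B * K + 1) * (e / (2 * (absC B * K + 1))))).
  apply: ler_pM; rewrite ?(ltW e10) ?mulr_ge0 ?absC_ge0 ?(ltW K0) ?lerDl//.
  by rewrite /e1 ge_min lexx orbT.
rewrite le_eqVlt; apply/orP; left; apply/eqP; field.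
by rewrite lt0r_neq0// ltr_wpDl// mulr_ge0 ?absC_ge0// ltW.
Qed.

Definition pi2 : R := pi *+ 2.
Lemma pi2_gt0 : 0 < pi2. Proof. by rewrite /pi2 pmulrn_lgt0// pi_gt0. Qed.
Hint Resolve pi2_gt0 : core.
Lemma cis_pi2 t : cis (t + pi2) = cis t. Proof. exact: cis2pi. Qed.

Lemma ccont_circle F r t B : 0 < r -> cdiff F (RC r * cis t) B ->
  ccont (fun t => F (RC r * cis t)) t.
Proof.
move=> r0 FB.
have : cdiff F (Cexp (ln r) t) B by rewrite /Cexp lnK.
by move/rdiff_Cexp/rdiff_ccont => [_]; rewrite /Cexp lnK.
Qed.

Lemma absC_circle (r t : R) : 0 < r -> absC (RC r * cis t) = r.
Proof. by move=> r0; rewrite absCM absC_cis mulr1 absC_RC gtr0_norm. Qed.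

(** Goursat's theorem for [F] composed with [Cexp] on [ln r1, ln r2] x [0, 2 pi]: the sides t = 0
    and t = 2 pi cancel by periodicity, and the other two are the circle integrals. The origin is
    not in the image, so [F] may be singular there. *)
Lemma circle_integral_const F r0 r1 r2 :
  (forall w, 0 < absC w < r0 -> exists B, cdiff F w B) ->
  0 < r1 -> r1 < r2 -> r2 < r0 ->
  CI 0 pi2 (fun t => F (RC r1 * cis t)) = CI 0 pi2 (fun t => F (RC r2 * cis t)).
Proof.
move=> dF r10 r12 r20; have r2p : 0 < r2 by exact: lt_trans r12.
pose G s t := F (Cexp s t).
have X0 : 0 < ln r2 - ln r1 by rewrite subr_gt0 ltr_ln.
have := @Goursat_rect R G (ln r1) 0 (ln r2 - ln r1) pi2 X0 pi2_gt0.
have -> : ln r1 + (ln r2 - ln r1) = ln r2 by rewrite addrC subrK.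
move=> H; have {H} : rect G (ln r1) 0 (ln r2 - ln r1) pi2 = 0.
  apply: H => p q /andP[p1 p2] _.
  have [|B /rdiff_Cexp FB] := dF (Cexp p q); last by exists (B * Cexp p q).
  rewrite absC_Cexp expR_gt0 /= (le_lt_trans _ r20)//.
  by rewrite -[r2]lnK// ler_expR.
rewrite /rect.
have -> : ln r1 + (ln r2 - ln r1) = ln r2 by rewrite addrC subrK.
rewrite add0r.
have -> : CI (ln r1) (ln r2) (fun r => G r pi2) = CI (ln r1) (ln r2) (fun r => G r 0).
  by apply: eq_CI => x _; rewrite /G /Cexp -[pi2]add0r cis_pi2.
rewrite subrr add0r -mulrBr => /eqP; rewrite mulf_eq0 => /orP[/eqP[] /eqP|].
  by rewrite oner_eq0.
rewrite subr_eq0 => /eqP; rewrite /G /Cexp !lnK//.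
Qed.

(** The radius may be shrunk without changing the integral, and near 0 the integrand is close to
    [A]. Only a limit at 0 is asked for, since [circle_derivative] applies this to a difference
    quotient. *)
Lemma circle_mean_value F r0 r A :
  (forall w, 0 < absC w < r0 -> exists B, cdiff F w B) ->
  (forall eps, 0 < eps -> exists2 d : R, 0 < d & forall w, 0 < absC w < d -> absC (F w - A) <= eps) ->
  0 < r < r0 -> CI 0 pi2 (fun t => F (RC r * cis t)) = RC pi2 * A.
Proof.
move=> dF FA /andP[rp r0r].
apply/eqP; rewrite -subr_eq0 -absC_eq0 eq_le absC_ge0 andbT.
apply/ler_addgt0Pr => e e0; rewrite add0r.
have [d d0 Hd] := FA (e / pi2) ltac:(by rewrite divr_gt0).
pose s := Num.min (r / 2) (d / 2).
have sp : 0 < s by rewrite lt_min !divr_gt0.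
have sr : s < r by rewrite gt_min; apply/orP; left; rewrite ltr_pdivrMr// mulr_natr mulr2n ltrDl.
have sd : s < d by rewrite gt_min; apply/orP; right; rewrite ltr_pdivrMr// mulr_natr mulr2n ltrDl.
have -> : RC pi2 * A = CI 0 pi2 (fun=> A) by rewrite CI_cst ?subr0// ltW.
rewrite -(circle_integral_const dF sp sr r0r) -CIB.
- apply: (le_trans (@absC_CI_le _ _ _ _ (e / pi2) _ _ _));
  [exact: ltW| | |].
  + move=> t _; apply: ccontB; last exact: ccont_cst.
    have [|B FB] := dF (RC s * cis t); last exact: (ccont_circle sp FB).
    by rewrite absC_circle// sp /= (lt_trans sr).
  + by move=> t _; apply: Hd; rewrite absC_circle// sp sd.
  + by rewrite subr0 divfK// lt0r_neq0.
- move=> t _; have [|B FB] := dF (RC s * cis t); last exact: (ccont_circle sp FB).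
  by rewrite absC_circle// sp /= (lt_trans sr).
- by move=> t _; exact: ccont_cst.
Qed.

Lemma CI_cisN : CI 0 pi2 (fun t : R => cis (- t)) = 0.
Proof.
rewrite (@CI_FTC R (fun t => mkC 0 1 * cis (- t)))//.
- by rewrite -(cis_pi2 (- pi2)) addNr oppr0 subrr.
- move=> t _; apply: cderiv_eq (cderivZ _ (cderiv_cisN t)).
  by apply: Cx_eq; rewrite !(ReCM, ImCM) !(ReCN, ImCN) /=; ring.
- by move=> t _; exact: cderiv_ccont (cderiv_cisN t).
Qed.

(** The mean value property of the quotient (F w - F 0) / w, whose limit at 0 is [B0]; the
    contribution of F 0 vanishes because [cis (- t)] integrates to 0 over a period. *)
Lemma circle_derivative F r0 r B0 :
  (forall w, absC w < r0 -> exists B, cdiff F w B) -> cdiff F 0 B0 -> 0 < r < r0 ->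
  CI 0 pi2 (fun t => cis (- t) * F (RC r * cis t)) = RC (pi2 * r) * B0.
Proof.
move=> dF F0 rr; have /andP[rp _] := rr.
have rc0 : RC r != 0 by rewrite RC_eq0 lt0r_neq0.
have := @circle_mean_value (fun w => (F w - F 0) / w) r0 r B0 _ _ rr.
rewrite RCM mulrAC => <-; first last.
- move=> e e0; have [d d0 Hd] := F0 e e0; exists d => // w /andP[w0 wd].
  have wn : w != 0 by rewrite -absC_eq0 lt0r_neq0.
  have := Hd w wd; rewrite add0r.
  rewrite (_ : F w - F 0 - B0 * w = ((F w - F 0) / w - B0) * w); last by field.
  by rewrite absCM ler_pM2r.
- move=> w /andP[w0 wr]; have [B FB] := dF w wr.
  have wn : w != 0 by rewrite -absC_eq0 lt0r_neq0.
  by exists ((B * w - (F w - F 0)) / w ^+ 2); exact: cdiff_quotient.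
have cN t : ccont (fun t : R => cis (- t)) t by exact: cderiv_ccont (cderiv_cisN t).
have cF t : ccont (fun t => F (RC r * cis t)) t.
  have [|B FB] := dF (RC r * cis t); last exact: (ccont_circle rp FB).
  by rewrite absC_circle//; case/andP: rr.
have cNF t : ccont (fun t => cis (- t) * F (RC r * cis t)) t by exact: ccontM.
rewrite [CI _ _ (fun t => (F _ - F 0) / _)](eq_CI (g := fun t => (RC r)^-1 * (cis (- t) * F (RC r * cis t)) - (RC r)^-1 * F 0 * cis (- t))); last first.
  by move=> t _; rewrite invfM cisVE; ring.
rewrite CIB; first last.
- by move=> t _; apply: ccontM; [exact: ccont_cst|].
- by move=> t _; apply: ccontM; [exact: ccont_cst|].
rewrite !CIZ; try by move=> t _.
by rewrite CI_cisN mulr0 subr0 mulrC mulVKf.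
Qed.

(** Cauchy's formula is used twice: it bounds [D] by M / r on the disc of radius 2 r, which makes
    [F] Lipschitz there, and applied to differences of [F] it makes [D] Lipschitz at 0 with constant
    2 M / r^2. The radius 4 r leaves room for circles of radius r around all these points. In
    applications r is inversely proportional to an increment, so the bound is quadratic in it. *)
Lemma taylor2 F (D : Cx R -> Cx R) r M : 1 <= r ->
  (forall w, absC w < 4 * r -> cdiff F w (D w)) ->
  (forall w, absC w < 4 * r -> absC (F w) <= M) ->
  absC (F 1 - F 0 - D 0) <= 4 * M / r ^+ 2.
Proof.
move=> r1 dF FM; have r0 : 0 < r by lra.
have M0 : 0 <= M by apply: le_trans (absC_ge0 _) (FM 0 _); rewrite absC0 mulr_gt0.
have shift w : absC w <= 2 * r -> forall v, absC v < 2 * r -> cdiff (fun v => F (w + 1 * v)) v (1 * D (w + 1 * v)).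
  move=> wr v vr; apply: cdiff_affine; apply: dF; rewrite mul1r.
  by apply: (le_lt_trans (absCD _ _)); lra.
have circ w : absC w <= 2 * r ->
    CI 0 pi2 (fun t => cis (- t) * F (w + 1 * (RC r * cis t))) = RC (pi2 * r) * D w.
  move=> wr; have S := shift w wr.
  rewrite (@circle_derivative (fun v => F (w + 1 * v)) (2 * r) r (1 * D (w + 1 * 0))).
  - by rewrite mul1r mulr0 addr0.
  - by move=> v vr; exists (1 * D (w + 1 * v)); exact: S.
  - by apply: S; rewrite absC0 mulr_gt0.
  - by rewrite r0 /=; lra.
have cw w t : absC w <= 2 * r -> ccont (fun t => cis (- t) * F (w + 1 * (RC r * cis t))) t.
  move=> wr; apply: ccontM; first exact: cderiv_ccont (cderiv_cisN t).
  apply: (@ccont_circle (fun v => F (w + 1 * v)) r t) => //.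
  by apply: shift => //; rewrite absC_circle//; lra.
have DM w : absC w <= 2 * r -> absC (D w) <= M / r.
  move=> wr; rewrite ler_pdivlMr// -(@ler_pM2l _ pi2)//.
  have -> : pi2 * (absC (D w) * r) = absC (RC (pi2 * r) * D w).
    by rewrite absCM absC_RC gtr0_norm ?mulr_gt0//; ring.
  rewrite -circ//; apply: (le_trans (@absC_CI_le _ _ _ _ M _ _ _));
  [exact: ltW| | |].
  - by move=> t _; exact: cw.
  - move=> t _; rewrite absCM absC_cis mul1r; apply: FM; rewrite mul1r.
    by apply: (le_lt_trans (absCD _ _)); rewrite absC_circle//; lra.
  - by rewrite subr0 mulrC.
have Lip w w' : absC w <= 2 * r -> absC w' <= 2 * r ->
    absC (F w' - F w) <= (absC (w' - w) * (M / r)) *+ 2.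
  move=> wr wr'.
  have seg x : 0 <= x <= 1 -> absC (w + RC x * (w' - w)) <= 2 * r.
    move=> /andP[x0 x1].
    rewrite (_ : w + _ = RC (1 - x) * w + RC x * w'); last by rewrite RCB RC1; ring.
    apply: (le_trans (absCD _ _)); rewrite !absCM !absC_RC !ger0_norm ?subr_ge0//.
    have : (1 - x) * absC w <= (1 - x) * (2 * r) by rewrite ler_wpM2l// subr_ge0.
    have : x * absC w' <= x * (2 * r) by rewrite ler_wpM2l.
    lra.
  have -> : F w' - F w = F (w + RC 1 * (w' - w)) - F (w + RC 0 * (w' - w)).
    by rewrite RC1 mul1r RC0 mul0r addr0 [w + _]addrC subrK.
  apply: (@cderiv_bound R (fun x => F (w + RC x * (w' - w))) (fun x => (w' - w) * D (w + RC x * (w' - w)))).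
    move=> x x01; apply: cdiff_line; apply: dF.
    apply: (le_lt_trans (seg x x01)); lra.
  by move=> x x01; rewrite absCM ler_wpM2l ?absC_ge0// DM// seg.
have DD w : absC w <= r -> absC (D w - D 0) <= 2 * absC w * M / r ^+ 2.
  move=> wr; have wr2 : absC w <= 2 * r by lra.
  have z2 : absC (0 : Cx R) <= 2 * r by rewrite absC0; lra.
  rewrite ler_pdivlMr ?exprn_gt0// -(@ler_pM2l _ pi2)//.
  have -> : pi2 * (absC (D w - D 0) * r ^+ 2) = absC (RC (pi2 * r) * D w - RC (pi2 * r) * D 0) * r.
    by rewrite -mulrBr absCM absC_RC gtr0_norm ?mulr_gt0//; ring.
  rewrite -!circ// -CIB; try by move=> t _; exact: cw.
  have -> : pi2 * (2 * absC w * M) = (absC w * (M / r)) *+ 2 * pi2 * r.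
    by rewrite -mulr_natr; field; rewrite lt0r_neq0.
  rewrite ler_pM2r//; apply: (le_trans (@absC_CI_le _ _ _ _ ((absC w * (M / r)) *+ 2) _ _ _));
  [exact: ltW| | |].
  - by move=> t _; apply: ccontB; exact: cw.
  - move=> t _; rewrite -mulrBr absCM absC_cis mul1r.
    apply: (le_trans (@Lip _ _ _ _)).
    + by rewrite add0r mul1r absC_circle//; lra.
    + by rewrite mul1r; apply: (le_trans (absCD _ _)); rewrite absC_circle//; lra.
    + by rewrite add0r addrK.
  - by rewrite subr0.
have -> : F 1 - F 0 - D 0 = (F (0 + RC 1 * 1) + RC 1 * (- D 0)) - (F (0 + RC 0 * 1) + RC 0 * (- D 0)).
  by rewrite RC1 RC0 !mul1r !mul0r !add0r addr0 addrAC.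
have -> : 4 * M / r ^+ 2 = 2 * M / r ^+ 2 *+ 2 by rewrite -mulr_natr; ring.
apply: (@cderiv_bound R (fun x => F (0 + RC x * 1) + RC x * (- D 0)) (fun x => 1 * D (0 + RC x * 1) + 1 * (- D 0))).
  move=> x /andP[x0 x1]; apply: cderivD.
    by apply: cdiff_line; apply: dF; rewrite add0r mulr1 absC_RC ger0_norm//; lra.
  apply: cderiv_eq (cderivM (cderiv_RC x) (cderiv_cst (- D 0) x)).
  by rewrite mulr0 addr0.
move=> x /andP[x0 x1]; rewrite !mul1r add0r mulr1.
apply: (le_trans (DD _ _)); rewrite absC_RC ger0_norm//; first lra.
by rewrite ler_wpM2r ?invr_ge0 ?exprn_ge0 ?(ltW r0)// ler_wpM2r//; lra.
Qed.

End one_complex_variable.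

(** * Holomorphic functions on the ball: partial derivatives and homogeneous components *)

Section several_complex_variables.
Context {R : realType} {n : nat}.
Implicit Types (z u v : Cn R n) (h : Cn R n -> Cx R).

Definition nrm1 u : R := \sum_(i < n) absC (u ord0 i).

Lemma nrm1_ge0 u : 0 <= nrm1 u.
Proof. by apply: sumr_ge0 => i _; exact: absC_ge0. Qed.
Lemma nrm1D u v : nrm1 (u + v) <= nrm1 u + nrm1 v.
Proof.
by rewrite /nrm1 -big_split /=; apply: ler_sum => i _; rewrite mxE absCD.
Qed.
Lemma nrm1Z c u : nrm1 (c *: u) = absC c * nrm1 u.
Proof. by rewrite /nrm1 mulr_sumr; apply: eq_bigr => i _; rewrite mxE absCM. Qed.
Lemma nrm1_0 : nrm1 0 = 0.
Proof. by rewrite /nrm1 big1// => i _; rewrite mxE absC0. Qed.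
Lemma nrm1_le u i : absC (u ord0 i) <= nrm1 u.
Proof. by rewrite /nrm1 (bigD1 i)//= lerDl sumr_ge0// => j _; exact: absC_ge0. Qed.
Lemma nrm1_delta i : nrm1 (delta_mx ord0 i) = 1.
Proof.
rewrite /nrm1 (bigD1 i)//= big1 ?addr0; first by rewrite mxE !eqxx absC1.
by move=> j ji; rewrite mxE (negbTE ji) andbF absC0.
Qed.
Lemma nrm1_eq0 u : nrm1 u = 0 -> u = 0.
Proof.
move=> u0; apply/matrixP => a i; rewrite (ord1 a) mxE; apply/eqP.
by rewrite -absC_eq0 eq_le absC_ge0 andbT -u0 nrm1_le.
Qed.

Lemma sqnorm_ge0 z : 0 <= sqnorm z.
Proof. by apply: sumr_ge0 => i _; exact: sqr_ge0. Qed.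
Lemma sqnormZ c z : sqnorm (c *: z) = absC c ^+ 2 * sqnorm z.
Proof. by rewrite /sqnorm mulr_sumr; apply: eq_bigr => i _; rewrite mxE absCM exprMn. Qed.
Lemma coord_le_sqnorm z i : absC (z ord0 i) ^+ 2 <= sqnorm z.
Proof. by rewrite /sqnorm (bigD1 i)//= lerDl sumr_ge0// => j _; exact: sqr_ge0. Qed.

Lemma uball_open z : uball z -> exists2 d : R, 0 < d & forall u, nrm1 u < d -> uball (z + u).
Proof.
rewrite /uball /= => z1.
exists (Num.min 1 ((1 - sqnorm z) / 3)); first by rewrite lt_min ltr01 divr_gt0// subr_gt0.
move=> u; rewrite lt_min ltr_pdivlMr// => /andP[u1 uz].
have N0 := nrm1_ge0 u.
apply: (@le_lt_trans _ _ (sqnorm z + 3 * nrm1 u)); last by rewrite [3 * _]mulrC; lra.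
have -> : 3 * nrm1 u = \sum_(i < n) 3 * absC (u ord0 i) by rewrite mulr_sumr.
rewrite /sqnorm -big_split /=; apply: ler_sum => i _; rewrite mxE.
have a1 := absC_ge0 (u ord0 i); have b1 := absC_ge0 (z ord0 i).
have a2 : absC (u ord0 i) <= 1 by apply: le_trans (nrm1_le u i) (ltW u1).
have b2 : absC (z ord0 i) <= 1.
  rewrite -(@ler_pXn2r _ 2)// ?nnegrE// expr1n.
  by apply: le_trans (coord_le_sqnorm z i) (ltW z1).
apply: (@le_trans _ _ ((absC (z ord0 i) + absC (u ord0 i)) ^+ 2)).
  by rewrite ler_pXn2r ?nnegrE ?absC_ge0 ?addr_ge0// absCD.
nra.
Qed.

Definition cdiffn h z (D : 'I_n -> Cx R) := forall eps, 0 < eps ->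
  exists2 d : R, 0 < d & forall u, nrm1 u < d ->
    absC (h (z + u) - h z - \sum_(i < n) D i * u ord0 i) <= eps * nrm1 u.

Lemma absC_lin_le (D : 'I_n -> Cx R) u :
  absC (\sum_(i < n) D i * u ord0 i) <= (\sum_(i < n) absC (D i)) * nrm1 u.
Proof.
apply: (le_trans (absC_sum _ _ _)); rewrite mulr_suml; apply: ler_sum => i _.
by rewrite absCM ler_wpM2l ?absC_ge0 ?nrm1_le.
Qed.

Lemma cdiffn_cont h z D : cdiffn h z D -> forall eps, 0 < eps ->
  exists2 d : R, 0 < d & forall u, nrm1 u < d -> absC (h (z + u) - h z) <= eps.
Proof.
move=> hD e e0; have [d d0 H] := hD _ ltr01.
set S := \sum_(i < n) absC (D i).
have S0 : 0 <= S by apply: sumr_ge0 => i _; exact: absC_ge0.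
have K0 : 0 < 1 + S by rewrite ltr_pwDl.
exists (Num.min d (e / (1 + S))); first by rewrite lt_min d0 divr_gt0.
move=> u; rewrite lt_min ltr_pdivlMr// [nrm1 u * _]mulrC mulrDl => /andP[/H h1 h2].
apply: le_trans (ltW h2).
rewrite -[h (z + u) - _](subrK (\sum_(i < n) D i * u ord0 i)).
by apply: (le_trans (absCD _ _)); apply: lerD => //; exact: absC_lin_le.
Qed.

Lemma cdiffn_line h z u w D : cdiffn h (z + w *: u) D ->
  cdiff (fun w => h (z + w *: u)) w (\sum_(i < n) D i * u ord0 i).
Proof.
move=> hD e e0; have K0 : 0 < nrm1 u + 1 by rewrite ltr_wpDl ?nrm1_ge0.
have [d d0 H] := hD (e / (nrm1 u + 1)) ltac:(by rewrite divr_gt0).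
exists (d / (nrm1 u + 1)); first by rewrite divr_gt0.
move=> v; rewrite ltr_pdivlMr// => vd.
have vu : nrm1 (v *: u) <= absC v * (nrm1 u + 1).
  by rewrite nrm1Z ler_wpM2l ?absC_ge0// lerDl.
have := H _ (le_lt_trans vu vd).
rewrite scalerDl addrA.
have -> : \sum_(i < n) D i * (v *: u) ord0 i = (\sum_(i < n) D i * u ord0 i) * v.
  by rewrite mulr_suml; apply: eq_bigr => i _; rewrite mxE; ring.
move=> /le_trans; apply; rewrite -mulrA ler_wpM2l ?(ltW e0)//.
by rewrite mulrC ler_pdivrMr.
Qed.

Lemma sum_delta (D : 'I_n -> Cx R) i : \sum_(j < n) D j * (delta_mx ord0 i : Cn R n) ord0 j = D i.
Proof.
rewrite (bigD1 i)//= big1 ?addr0; first by rewrite mxE !eqxx mulr1.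
by move=> j ji; rewrite mxE (negbTE ji) andbF mulr0.
Qed.

Definition has_partials h (D : Cn R n -> 'I_n -> Cx R) :=
  forall z, uball z -> cdiffn h z (D z).

(** [taylor2] on the complex line through z0 + v in the direction u, with u at parameter 1: a disc
    of radius inversely proportional to |u| stays where h is bounded. The constants do not depend on
    v, which is what continuity and differentiability of the partial derivatives rest on. *)
Lemma taylor2n h D z0 : has_partials h D -> uball z0 ->
  exists d C : R, [/\ 0 < d, 0 <= C, forall v, nrm1 v < d -> uball (z0 + v) &
    forall v u, nrm1 v < d -> nrm1 u < d ->
    absC (h (z0 + v + u) - h (z0 + v) - \sum_(i < n) D (z0 + v) i * u ord0 i) <= C * nrm1 u ^+ 2].
Proof.
move=> hD z0b; have [p1 p10 H1] := uball_open z0b.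
have [p2 p20 H2] := cdiffn_cont (hD z0 z0b) ltr01.
have [p [p0 pp1 pp2]] : exists p : R, [/\ 0 < p, p <= p1 & p <= p2].
  by exists (Num.min p1 p2); rewrite lt_min p10 p20 !ge_min !lexx orbT.
pose M := absC (h z0) + 1.
have M0 : 0 <= M by rewrite addr_ge0 ?absC_ge0.
have HM v : nrm1 v < p -> absC (h (z0 + v)) <= M.
  move=> vp; rewrite -[h (z0 + v)](subrK (h z0)) addrC.
  by apply: (le_trans (absCD _ _)); rewrite lerD2l H2// (lt_le_trans vp).
exists (p / 8), (4 * M * 64 / p ^+ 2); split.
- by rewrite divr_gt0.
- by rewrite divr_ge0 ?exprn_ge0 ?(ltW p0)// !mulr_ge0.
- by move=> v vp; apply: H1; lra.
move=> v u vp up; have [u0|u0] := eqVneq (nrm1 u) 0.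
  rewrite (nrm1_eq0 u0) addr0 subrr big1 ?subrr ?absC0 ?nrm1_0; last by move=> i _; rewrite mxE mulr0.
  by rewrite expr0n mulr0.
have up0 : 0 < nrm1 u by rewrite lt_neqAle eq_sym u0 nrm1_ge0.
pose r := p / (8 * nrm1 u).
have r1 : 1 <= r by rewrite ler_pdivlMr ?mulr_gt0// mul1r; lra.
have line w : absC w < 4 * r -> nrm1 (v + w *: u) < p.
  move=> wr; apply: (le_lt_trans (nrm1D _ _)); rewrite nrm1Z.
  have : absC w * nrm1 u < 4 * r * nrm1 u by rewrite ltr_pM2r.
  have -> : 4 * r * nrm1 u = p / 2 by rewrite /r; field.
  lra.
have := @taylor2 R (fun w => h (z0 + v + w *: u)) (fun w => \sum_(i < n) D (z0 + v + w *: u) i * u ord0 i) r M r1.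
rewrite scale1r scale0r !addr0 => T; apply: (le_trans (T _ _)).
- move=> w wr; apply: cdiffn_line; apply: hD; rewrite -addrA; apply: H1.
  exact: lt_le_trans (line w wr) pp1.
- by move=> w wr; rewrite -addrA; exact: HM (line w wr).
- by rewrite le_eqVlt; apply/orP; left; apply/eqP; rewrite /r; field; rewrite u0 lt0r_neq0.
Qed.

(** Near z0 a partial derivative is within C s of its difference quotient of step s. With s fixed
    and small, that quotient depends continuously on the point because h is continuous at z0 and at
    z0 + u. *)
Lemma partial_cont h D z0 i : has_partials h D -> uball z0 -> forall eps, 0 < eps ->
  exists2 d : R, 0 < d & forall v, nrm1 v < d -> absC (D (z0 + v) i - D z0 i) <= eps.
Proof.
move=> hD z0b e e0; have [d [C [d0 C0 db dT]]] := taylor2n hD z0b.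
have [s [s0 sd sC]] : exists s : R, [/\ 0 < s, s < d & 4 * C * s <= e].
  exists (Num.min (d / 2) (e / (4 * C + 1))).
  have K0 : 0 < 4 * C + 1 by rewrite ltr_wpDl// mulr_ge0.
  split.
  - by rewrite lt_min !divr_gt0.
  - by rewrite gt_min; apply/orP; left; lra.
  - apply: (@le_trans _ _ (4 * C * (e / (4 * C + 1)))).
      by rewrite ler_wpM2l ?mulr_ge0// ge_min lexx orbT.
    rewrite mulrA ler_pdivrMr// mulrC ler_wpM2l ?(ltW e0)//; lra.
pose u : Cn R n := RC s *: delta_mx ord0 i.
have us : nrm1 u = s by rewrite nrm1Z nrm1_delta mulr1 absC_RC gtr0_norm.
have Du v : \sum_(j < n) D (z0 + v) j * u ord0 j = RC s * D (z0 + v) i.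
  by rewrite -[in RHS](sum_delta (D (z0 + v)) i) mulr_sumr; apply: eq_bigr => j _; rewrite mxE; ring.
have es : 0 < e * s / 4 by rewrite !mulr_gt0 ?invr_gt0.
have [d1 d10 H1] := cdiffn_cont (hD _ z0b) es.
have ub : uball (z0 + u) by apply: db; rewrite us.
have [d2 d20 H2] := cdiffn_cont (hD _ ub) es.
exists (Num.min d (Num.min d1 d2)); first by rewrite !lt_min d0 d10 d20.
move=> v; rewrite !lt_min => /and3P[vd v1 v2].
have T1 := dT v u vd ltac:(by rewrite us).
have T2 := dT 0 u ltac:(by rewrite nrm1_0) ltac:(by rewrite us).
rewrite -(@ler_pM2l _ s)//.
have -> : s * absC (D (z0 + v) i - D z0 i) = absC (RC s * D (z0 + v) i - RC s * D (z0 + 0) i).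
  by rewrite addr0 -mulrBr absCM absC_RC gtr0_norm.
rewrite -!Du; set A := \sum_(j < n) _ in T1 *; set B := \sum_(j < n) _ in T2 *.
rewrite addr0 in T2; rewrite us in T1 T2.
have -> : A - B = - (h (z0 + v + u) - h (z0 + v) - A) + (h (z0 + u) - h z0 - B)
   + ((h (z0 + u + v) - h (z0 + u)) - (h (z0 + v) - h z0)).
  by rewrite [z0 + u + v]addrAC; ring.
apply: (le_trans (absCD _ _)).
have a1 := absCD (- (h (z0 + v + u) - h (z0 + v) - A)) (h (z0 + u) - h z0 - B).
rewrite absCN in a1.
have a2 := absCB (h (z0 + u + v) - h (z0 + u)) (h (z0 + v) - h z0).
have a3 := H1 v v1; have a4 := H2 v v2.
have a5 : 4 * C * s * s <= e * s by rewrite ler_wpM2r// ltW.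
have a6 : C * s ^+ 2 = 4 * C * s * s / 4 by rewrite expr2; field.
lra.
Qed.

Definition holo h := forall z, uball z -> exists D, cdiffn h z D.

Lemma holo_partials h : holo h -> exists D, has_partials h D.
Proof.
move=> hh; have H z : exists D, uball z -> cdiffn h z D.
  by have [/hh[D hD]|nz] := pselect (uball z); [exists D|exists (fun=> 0)].
by have [D HD] := choice H; exists D.
Qed.

Lemma ccont_partial_circle h D z0 i (r : R) t c j : has_partials h D ->
  uball (z0 + (RC r * cis t) *: c) -> nrm1 c = 1 -> i = j -> 
  ccont (fun t => D (z0 + (RC r * cis t) *: c) i) t.
Proof.
move=> hD zb c1 _; apply: ccont_eps => e e0.
have [d d0 H] := partial_cont i hD zb e0.
have cc : ccont (fun t => RC r * cis t) t.
  by apply: ccontM; [exact: ccont_cst|exact: cderiv_ccont (cderiv_cis t)].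
have [d1 d10 H1] := eps_ccont cc (divr_gt0 d0 (ltr0Sn R 1)).
exists d1 => // t' /H1 h1.
have := H ((RC r * cis t' - RC r * cis t) *: c).
rewrite -addrA -scalerDl [_ + (_ - _)]addrC subrK; apply.
by rewrite nrm1Z c1 mulr1 (le_lt_trans h1)// ltr_pdivrMr// mulr_natr mulr2n ltrDl.
Qed.

(** Cauchy's formula expresses the partial derivative by values of h on a circle; the first-order
    expansion of h there, with the uniform quadratic error of [taylor2n], is integrated along the
    circle. *)
Lemma holo_partial h D i : has_partials h D -> holo (fun z => D z i).
Proof.
move=> hD z0 z0b; have [d [C [d0 C0 db dT]]] := taylor2n hD z0b.
pose e : Cn R n := delta_mx ord0 i.
have [r [r0 rr]] : exists r : R, 0 < r /\ r + r = d.
  by exists (d / 2); rewrite divr_gt0// -splitr.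
pose p t := z0 + (RC r * cis t) *: e.
have pv t : nrm1 ((RC r * cis t) *: e) = r by rewrite nrm1Z nrm1_delta mulr1 absC_circle.
have rd : r < d by lra.
have circ u : nrm1 u < r ->
   CI 0 pi2 (fun t => cis (- t) * h (p t + u)) = RC (pi2 * r) * D (z0 + u) i.
  move=> ur.
  have L w : absC w < d - nrm1 u -> cdiff (fun w => h (z0 + u + w *: e)) w (\sum_(j < n) D (z0 + u + w *: e) j * e ord0 j).
    move=> wd; apply: cdiffn_line; apply: hD; rewrite -addrA; apply: db.
    by apply: (le_lt_trans (nrm1D _ _)); rewrite nrm1Z nrm1_delta mulr1 addrC; lra.
  have := @circle_derivative R (fun w => h (z0 + u + w *: e)) (d - nrm1 u) r _ _ (L 0 _) _.
  rewrite scale0r addr0 sum_delta => <-.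
  - by apply: eq_CI => t _; rewrite /p addrAC.
  - by move=> w wd; eexists; exact: L.
  - by rewrite absC0; lra.
  - by rewrite r0 /=; lra.
have cch u : nrm1 u < r -> forall t, ccont (fun t => cis (- t) * h (p t + u)) t.
  move=> ur t; apply: ccontM; first exact: cderiv_ccont (cderiv_cisN t).
  rewrite (_ : (fun t => _) = (fun t => (fun w => h (z0 + u + w *: e)) (RC r * cis t))); last first.
    by apply/funext => t'; rewrite /p addrAC.
  apply: (@ccont_circle R (fun w => h (z0 + u + w *: e))) => //.
  apply: cdiffn_line; apply: hD; rewrite -addrA; apply: db.
  by apply: (le_lt_trans (nrm1D _ _)); rewrite pv; lra.
have ccD j t : ccont (fun t => D (p t) j) t.
  apply: (@ccont_partial_circle h D z0 j r t e j) => //; last exact: nrm1_delta.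
  by apply: db; rewrite pv.
have ccND j t : ccont (fun t => cis (- t) * D (p t) j) t.
  by apply: ccontM => //; exact: cderiv_ccont (cderiv_cisN t).
pose K := RC (pi2 * r) : Cx R.
have K0 : K != 0 by rewrite RC_eq0 mulf_neq0 ?lt0r_neq0 ?pi2_gt0.
(* These second derivatives come from differentiating Cauchy's formula under the integral sign. *)
exists (fun j => K^-1 * CI 0 pi2 (fun t => cis (- t) * D (p t) j)) => eps eps0.
exists (Num.min r (eps * r / (C + 1))).
  by rewrite lt_min r0 divr_gt0 ?mulr_gt0// ltr_wpDl.
move=> u; rewrite lt_min ltr_pdivlMr ?ltr_wpDl// => /andP[ur ue].
have pr0 : 0 < pi2 * r by rewrite mulr_gt0 ?pi2_gt0.
rewrite -(@ler_pM2l _ (pi2 * r))//.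
set X := _ - _ - _.
have -> : pi2 * r * absC X = absC (K * X) by rewrite absCM absC_RC gtr0_norm.
have -> : K * X = CI 0 pi2 (fun t => cis (- t) * (h (p t + u) - h (p t) - \sum_(j < n) D (p t) j * u ord0 j)).
  have -> : K * X = CI 0 pi2 (fun t => cis (- t) * h (p t + u)) - CI 0 pi2 (fun t => cis (- t) * h (p t + 0))
     - CI 0 pi2 (fun t => \sum_(j < n) u ord0 j * (cis (- t) * D (p t) j)).
    rewrite !circ ?nrm1_0// addr0 CI_sum; last first.
      by move=> j t _ _; apply: ccontM; [exact: ccont_cst|exact: ccND].
    rewrite /X !mulrBr; congr (_ - _); rewrite mulr_sumr; apply: eq_bigr => j _.
    rewrite CIZ; last by move=> t _; exact: ccND.
    by rewrite !mulrA divff// mul1r mulrC.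
  rewrite -CIB; try by move=> t _; apply: cch; rewrite ?nrm1_0.
  rewrite -CIB; first last.
  - move=> t _; apply: ccont_sum => j _; apply: ccontM; [exact: ccont_cst|exact: ccND].
  - by move=> t _; apply: ccontB; apply: cch; rewrite ?nrm1_0.
  apply: eq_CI => t _; rewrite addr0 !mulrBr; congr (_ - _); rewrite mulr_sumr.
  by apply: eq_bigr => j _; ring.
apply: (le_trans (@absC_CI_le _ _ _ _ (C * nrm1 u ^+ 2) _ _ _)).
- by rewrite ltW ?pi2_gt0.
- move=> t _; rewrite (_ : (fun t => _) = (fun t => cis (- t) * h (p t + u) - cis (- t) * h (p t + 0) - \sum_(j < n) u ord0 j * (cis (- t) * D (p t) j))); last first.
    apply/funext => t'; rewrite addr0 !mulrBr; congr (_ - _); rewrite mulr_sumr.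
    by apply: eq_bigr => j _; ring.
  apply: ccontB; first by apply: ccontB; apply: cch; rewrite ?nrm1_0.
  by apply: ccont_sum => j _; apply: ccontM; [exact: ccont_cst|exact: ccND].
- move=> t _; rewrite absCM absC_cis mul1r; apply: dT; first by rewrite pv.
  exact: lt_trans ur rd.
rewrite subr0 mulrC -mulrA ler_wpM2l ?(ltW pi2_gt0)//.
have N0 := nrm1_ge0 u.
have : nrm1 u * (C * nrm1 u) <= nrm1 u * (eps * r) by rewrite ler_wpM2l//; lra.
by rewrite expr2; lra.
Qed.

Lemma cdiffn_circle h z t D : cdiffn h (cis t *: z) D ->
  cderiv (fun t => h (cis t *: z)) t (\sum_(i < n) D i * (mkC 0 1 * cis t * z ord0 i)).
Proof.
move=> hD; apply: eps_cderiv => e e0.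
have N0 := nrm1_ge0 z; set N := nrm1 z in N0.
set S := (\sum_(i < n) absC (D i)) * N.
have S0 : 0 <= S by rewrite mulr_ge0// sumr_ge0// => i _; exact: absC_ge0.
have [e1 [e10 e11 e1S]] : exists e1 : R, [/\ 0 < e1, e1 <= 1 & e1 * S <= e / 2].
  have K : 0 < 2 * (S + 1) by rewrite mulr_gt0// ltr_wpDl.
  exists (Num.min 1 (e / (2 * (S + 1)))); split.
  - by rewrite lt_min ltr01 divr_gt0.
  - by rewrite ge_min lexx.
  - apply: (@le_trans _ _ (e / (2 * (S + 1)) * S)).
      by rewrite ler_wpM2r// ge_min lexx orbT.
    rewrite mulrAC ler_pdivrMr//; nra.
have [d1 d10 H1] := cderiv_eps (cderiv_cis t) e10.
have [d2 d20 H2] := hD (e / (4 * (N + 1))) ltac:(by rewrite divr_gt0// mulr_gt0// ltr_wpDl).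
exists (Num.min d1 (d2 / (2 * (N + 1)))).
  by rewrite lt_min d10 divr_gt0// mulr_gt0// ltr_wpDl.
move=> k; rewrite lt_min ltr_pdivlMr; last by rewrite mulr_gt0// ltr_wpDl.
move=> /andP[/H1 h1 h2].
set rho := cis (t + k) - cis t - RC k * (mkC 0 1 * cis t) in h1.
have k0 := normr_ge0 k.
have cd : absC (cis (t + k) - cis t) <= 2 * `|k|.
  have -> : cis (t + k) - cis t = rho + RC k * (mkC 0 1 * cis t) by rewrite /rho subrK.
  apply: (le_trans (absCD _ _)); rewrite !absCM absC_cis absC_RC.
  have -> : absC (mkC 0 1 : Cx R) = 1 by rewrite absCE /= expr0n expr1n add0r sqrtr1.
  have : e1 * `|k| <= 1 * `|k| by rewrite ler_wpM2r.
  lra.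
pose u : Cn R n := (cis (t + k) - cis t) *: z.
have uN : nrm1 u <= `|k| * (2 * (N + 1)).
  rewrite nrm1Z -/N; apply: (@le_trans _ _ (2 * `|k| * N)); first by rewrite ler_wpM2r.
  nra.
have := H2 u (le_lt_trans uN h2).
have -> : cis t *: z + u = cis (t + k) *: z by rewrite /u -scalerDl addrC subrK.
move=> H3.
have -> : h (cis (t + k) *: z) - h (cis t *: z) - RC k * \sum_(i < n) D i * (mkC 0 1 * cis t * z ord0 i)
 = (h (cis (t + k) *: z) - h (cis t *: z) - \sum_(i < n) D i * u ord0 i) + rho * \sum_(i < n) D i * z ord0 i.
  rewrite -[LHS]addrA -[RHS]addrA -addrA; congr (_ + (_ + _)).
  apply: oppr_inj; rewrite opprK opprD opprK.
  rewrite !mulr_sumr -sumrB; apply: eq_bigr => i _; rewrite mxE /rho; ring.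
apply: (le_trans (absCD _ _)).
have -> : e * `|k| = e / 2 * `|k| + e / 2 * `|k| by field.
apply: lerD.
  apply: (le_trans H3).
  apply: (@le_trans _ _ (e / (4 * (N + 1)) * (`|k| * (2 * (N + 1))))).
    by rewrite ler_wpM2l// divr_ge0 ?(ltW e0)// mulr_ge0// addr_ge0.
  by rewrite le_eqVlt; apply/orP; left; apply/eqP; field; rewrite lt0r_neq0// ltr_wpDl.
rewrite absCM; apply: (@le_trans _ _ (e1 * `|k| * S)).
  by apply: ler_pM => //; rewrite ?absC_ge0//; exact: absC_lin_le.
by rewrite mulrAC ler_wpM2r.
Qed.

Lemma homog_polyD k f g : homog_poly k f -> homog_poly k g -> homog_poly k (fun z : Cn R n => f z + g z).
Proof.
move=> [c fc] [d gd]; exists (fun a => c a + d a) => z.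
by rewrite fc gd -big_split /=; apply: eq_bigr => a _; rewrite mulrDl.
Qed.
Lemma homog_polyZ k a f : homog_poly k f -> homog_poly k (fun z : Cn R n => a * f z).
Proof.
move=> [c fc]; exists (fun b => a * c b) => z.
by rewrite fc mulr_sumr; apply: eq_bigr => b _; rewrite mulrA.
Qed.
Lemma homog_poly0 k : homog_poly k (fun z : Cn R n => 0).
Proof. by exists (fun=> 0) => z; rewrite big1// => a _; rewrite mul0r. Qed.
Lemma homog_poly_sum k I (s : seq I) (P : pred I) (F : I -> Cn R n -> Cx R) :
  (forall i, P i -> homog_poly k (F i)) ->
  homog_poly k (fun z : Cn R n => \sum_(i <- s | P i) F i z).
Proof.
move=> FP; elim: s => [|i s IH].
  rewrite (_ : (fun z => _) = (fun=> 0)); first exact: homog_poly0.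
  by apply/funext => z; rewrite big_nil.
rewrite (_ : (fun z => _) = (fun z => (if P i then F i z else 0) + \sum_(i <- s | P i) F i z)); last first.
  by apply/funext => z; rewrite big_cons; case: ifP => _; rewrite ?add0r.
apply: homog_polyD IH; case: (boolP (P i)) => Pi; [exact: FP|exact: homog_poly0].
Qed.

Lemma homog_poly_monom k (e : 'I_n -> nat) : (\sum_(i < n) e i = k)%N ->
  homog_poly k (fun z : Cn R n => \prod_(i < n) z ord0 i ^+ e i).
Proof.
move=> ek; pose a : {ffun 'I_n -> 'I_k.+1} := [ffun i => inord (e i)].
have ae i : a i = e i :> nat.
  by rewrite ffunE inordK// ltnS -ek (bigD1 i)//= leq_addr.
exists (fun b => (b == a)%:R) => z.
rewrite (bigD1 a) /=; last by rewrite (eq_bigr e)// ek.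
rewrite eqxx mul1r [X in _ + X]big1 ?addr0; last first.
  by move=> b /andP[_ ba]; rewrite (negbTE ba) mul0r.
by apply: eq_bigr => i _; rewrite ae.
Qed.

Lemma homog_poly_coordM k f j : homog_poly k f ->
  homog_poly k.+1 (fun z : Cn R n => z ord0 j * f z).
Proof.
move=> [c fc].
rewrite (_ : (fun z => _) = (fun z => \sum_(a : {ffun 'I_n -> 'I_k.+1} | (\sum_(i < n) a i == k)%N)
   c a * \prod_(i < n) z ord0 i ^+ (a i + (i == j)))); last first.
  apply/funext => z; rewrite fc mulr_sumr; apply: eq_bigr => a _.
  rewrite mulrCA; congr (_ * _); rewrite (bigD1 j)//= [RHS](bigD1 j)//= eqxx addn1 exprS mulrA.
  by congr (_ * _); apply: eq_bigr => i /negbTE ->; rewrite addn0.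
apply: homog_poly_sum => a /eqP ak; apply: homog_polyZ; apply: homog_poly_monom.
rewrite big_split /= ak (bigD1 j)//= eqxx big1 ?addn0 ?addn1//.
by move=> i /negbTE ->.
Qed.

Lemma uballZ (c : Cx R) z : absC c <= 1 -> uball z -> uball (c *: z).
Proof.
rewrite /uball /= sqnormZ => c1; apply: le_lt_trans.
by rewrite -[leRHS]mul1r ler_wpM2r ?sqnorm_ge0// exprn_ile1// absC_ge0.
Qed.

Lemma uball_cis t z : uball z -> uball (cis t *: z).
Proof. by apply: uballZ; rewrite absC_cis. Qed.

(* Induction on k through Euler's identity k h_k = sum_j z_j (d_j h)_{k-1} for
   the component h_k of degree k. *)
Lemma homog_component k h : holo h -> exists2 p, homog_poly k p &
  forall z, uball z -> CI 0 pi2 (fun t => cis (- t) ^+ k * h (cis t *: z)) = p z.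
Proof.
elim: k h => [|k IH] h hh; have [D hD] := holo_partials hh.
  (* The integral is not divided by [pi2], so the polynomial found is [pi2] times the component. *)
  exists (fun=> RC pi2 * h 0).
    have H : homog_poly 0 (fun z : Cn R n => \prod_(i < n) z ord0 i ^+ 0).
      by apply: homog_poly_monom; rewrite big1.
    have := homog_polyZ (RC pi2 * h 0) H.
    rewrite (_ : (fun z => _) = (fun=> RC pi2 * h 0))//; apply/funext => z.
    by rewrite big1 ?mulr1// => i _; rewrite expr0.
  move=> z zb.
  (* Since z is inside the open ball, w -> h (w z) is holomorphic beyond the unit circle, and the
     mean value property applies at radius 1. *)
  have [r r1 Hr] : exists2 r : R, 1 < r & forall w, absC w < r -> uball (w *: z).
    have s0 := sqnorm_ge0 z; have s1 : sqnorm z < 1 by [].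
    have q0 : 0 < (sqnorm z + 1) / 2 by lra.
    have q1 : Num.sqrt ((sqnorm z + 1) / 2) < 1.
      by rewrite -[ltRHS]sqrtr1 ltr_sqrt//; lra.
    exists (Num.sqrt ((sqnorm z + 1) / 2))^-1.
      by rewrite -[ltLHS]invr1 ltf_pV2 ?posrE ?ltr01// sqrtr_gt0.
    move=> w wr; rewrite /uball /= sqnormZ.
    have w2 : absC w ^+ 2 <= ((sqnorm z + 1) / 2)^-1.
      rewrite -[leRHS]sqr_sqrtr ?invr_ge0 ?(ltW q0)// sqrtrV ?(ltW q0)//.
      by rewrite ler_pXn2r ?nnegrE ?absC_ge0 ?invr_ge0 ?sqrtr_ge0// ltW.
    apply: (le_lt_trans (ler_wpM2r s0 w2)).
    by rewrite mulrC ltr_pdivrMr// mul1r; lra.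
  have dF w : absC w < r -> exists B, cdiff (fun w => h (0 + w *: z)) w B.
    move=> wr; eexists; apply: cdiffn_line; apply: hD; rewrite add0r; exact: Hr.
  have := @circle_mean_value R (fun w => h (0 + w *: z)) r 1 (h 0).
  move=> M; rewrite -M; first last.
  - by rewrite ltr01.
  - move=> e e0; have [|B FB] := dF 0; first by rewrite absC0; lra.
    have [d d0 Hd] := cdiff_cont FB e0; exists d => // w /andP[_ wd].
    by have := Hd w wd; rewrite [0 + w]add0r scale0r addr0.
  - by move=> w /andP[_ wr]; exact: dF.
  by apply: eq_CI => t _; rewrite expr0 mul1r RC1 mul1r add0r.
have HI i := IH (fun z => D z i) (holo_partial i hD).
pose p i := sval (cid2 (HI i)).
have pk i : homog_poly k (p i) by rewrite /p; case: cid2.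
have pE i z : uball z -> CI 0 pi2 (fun t => cis (- t) ^+ k * D (cis t *: z) i) = p i z.
  by rewrite /p; case: cid2 => q /= _ H; exact: H.
exists (fun z => (k.+1%:R)^-1 * \sum_(i < n) z ord0 i * p i z).
  by apply: homog_polyZ; apply: homog_poly_sum => i _; exact: homog_poly_coordM.
move=> z zb.
have dh t : cderiv (fun t => h (cis t *: z)) t (\sum_(i < n) D (cis t *: z) i * (mkC 0 1 * cis t * z ord0 i)).
  by apply: cdiffn_circle; apply: hD; exact: uball_cis.
have dc (t : R) := cderivX k (cderiv_cisN t).
have cD i t : ccont (fun t => D (cis t *: z) i) t.
  apply: ccont_eps => e e0; have [d d0 H] := partial_cont i hD (uball_cis t zb) e0.
  have N0 : 0 < nrm1 z + 1 by rewrite ltr_wpDl ?nrm1_ge0.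
  have [d1 d10 H1] := eps_ccont (cderiv_ccont (cderiv_cis t)) (divr_gt0 (divr_gt0 d0 N0) (ltr0Sn R 1)).
  exists d1 => // t' /H1 h1; have := H ((cis t' - cis t) *: z).
  rewrite -scalerDl [_ + (_ - _)]addrC subrK; apply.
  rewrite nrm1Z; apply: (@le_lt_trans _ _ (d / (nrm1 z + 1) / 2 * (nrm1 z + 1))).
    apply: ler_pM => //; rewrite ?absC_ge0 ?nrm1_ge0//; by rewrite lerDl.
  rewrite mulrAC divfK ?lt0r_neq0//; lra.
have cN j (t : R) : ccont (fun t => cis (- t) ^+ j) t.
  by apply: ccontX; exact: cderiv_ccont (cderiv_cisN t).
have ch t := cderiv_ccont (dh t).
have cND j t : ccont (fun t => cis (- t) ^+ k * D (cis t *: z) j) t by exact: ccontM.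
have cS t : ccont (fun t => \sum_(i < n) z ord0 i * (cis (- t) ^+ k * D (cis t *: z) i)) t.
  by apply: ccont_sum => j _; apply: ccontM; [exact: ccont_cst|exact: cND].
have cH t : ccont (fun t => cis (- t) ^+ k.+1 * h (cis t *: z)) t by exact: ccontM.
have E t : k.+1%:R * cis (- t) ^+ k * (- mkC 0 1 * cis (- t)) * h (cis t *: z)
   + cis (- t) ^+ k.+1 * \sum_(i < n) D (cis t *: z) i * (mkC 0 1 * cis t * z ord0 i)
  = mkC 0 1 * (\sum_(i < n) z ord0 i * (cis (- t) ^+ k * D (cis t *: z) i)
     - k.+1%:R * (cis (- t) ^+ k.+1 * h (cis t *: z))).
  have -> : cis (- t) ^+ k.+1 * (\sum_(i < n) D (cis t *: z) i * (mkC 0 1 * cis t * z ord0 i)) =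
     (cis (- t) * cis t) * (mkC 0 1 * \sum_(i < n) z ord0 i * (cis (- t) ^+ k * D (cis t *: z) i)).
    by rewrite !mulr_sumr; apply: eq_bigr => i _; rewrite exprS; ring.
  rewrite cisNM exprS; ring.
(* By [E] the integrand is the derivative of the periodic function
   [cis (- t) ^+ k.+1 * h (cis t *: z)]; this is Euler's identity for the components. *)
have : CI 0 pi2 (fun t => mkC 0 1 * (\sum_(i < n) z ord0 i * (cis (- t) ^+ k * D (cis t *: z) i)
     - k.+1%:R * (cis (- t) ^+ k.+1 * h (cis t *: z)))) = 0.
  rewrite (@CI_FTC R (fun t => cis (- t) ^+ k.+1 * h (cis t *: z))).
  - rewrite -[pi2]add0r cis_pi2 opprD -[cis (- 0 - pi2)](cis_pi2) subrK.
    by rewrite subrr.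
  - exact: pi2_gt0.
  - by move=> t _; exact: (cderiv_eq (E t) (cderivM (dc t) (dh t))).
  - move=> t _; apply: ccontM; first exact: ccont_cst.
    by apply: ccontB => //; apply: ccontM; [exact: ccont_cst|exact: cH].
have cSH t : ccont (fun t => k.+1%:R * (cis (- t) ^+ k.+1 * h (cis t *: z))) t.
  by apply: ccontM; [exact: ccont_cst|exact: cH].
rewrite CIZ; last by move=> t _; exact: ccontB.
move=> /eqP; rewrite mulf_eq0 => /orP[/eqP[] /eqP|]; first by rewrite oner_eq0.
rewrite CIB// CIZ// CI_sum; last first.
  by move=> j t _ _; apply: ccontM; [exact: ccont_cst|exact: cND].
rewrite subr_eq0 => /eqP H.
have -> : \sum_(i < n) z ord0 i * p i z = k.+1%:R * CI 0 pi2 (fun t => cis (- t) ^+ k.+1 * h (cis t *: z)).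
  rewrite -H; apply: eq_bigr => i _; rewrite CIZ ?pE// => t _; exact: cND.
by rewrite mulKf// pnatr_eq0.
Qed.

End several_complex_variables.

(** * Integrals against image measures *)

Section image_measure.
Local Open Scope ereal_scope.

Definition image_measure d1 d2 (X : measurableType d1) (Y : measurableType d2)
    (R : realType) (phi : X -> Y) (mphi : measurable_fun setT phi)
    (mu : {measure set X -> \bar R}) : {measure set Y -> \bar R} :=
  measure_function_pushforward__canonical__measure_function_Measure mu mphi.

Lemma ge0_integral_image d1 d2 (X : measurableType d1) (Y : measurableType d2)
    (R : realType) (phi : X -> Y) (mphi : measurable_fun setT phi)
    (mu : {measure set X -> \bar R}) (nu : {measure set Y -> \bar R}) (f : Y -> \bar R) :
  (forall A, measurable A -> nu A = mu (phi @^-1` A)) ->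
  measurable_fun setT f -> (forall y, 0 <= f y) ->
  \int[nu]_y f y = \int[mu]_x f (phi x).
Proof.
move=> nuE mf f0.
rewrite -[RHS](@ge0_integral_pushforward _ _ _ _ _ _ mphi mu setT f)//.
by apply: (@eq_measure_integral _ _ _ setT (image_measure mphi mu) nu) => A mA _; exact: nuE.
Qed.

End image_measure.

(** * Planar Lebesgue measure: rotations, dilations, and its image under the squared modulus *)

Section plane_measure.
Context {R : realType}.
Local Open Scope ereal_scope.
Notation leb := (@lebesgue_measure R).
Notation RR := (measurableTypeR R * measurableTypeR R)%type.

(** The image of Lebesgue measure, scaled by a, has the right value on half-open intervals and is
    therefore Lebesgue measure. *)
Lemma ge0_integral_affine (a b : R) (f : R -> \bar R) : (0 < a)%R ->
  measurable_fun setT f -> (forall x, 0 <= f x) ->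
  \int[leb]_x f x = a%:E * \int[leb]_x f (a * x + b)%R.
Proof.
move=> a0 mf f0.
have mphi : measurable_fun setT (fun x : measurableTypeR R => (a * x + b)%R : measurableTypeR R).
  by apply: measurable_funD => //; apply: measurable_funM.
pose k := NngNum (ltW a0).
rewrite -[a]/(k%:num)%R -(@ge0_integral_mscale _ _ _ leb setT _ k)//.
- apply: (@ge0_integral_image _ _ _ _ _ _ mphi (mscale k leb) leb) => // A mA.
  apply: (@lebesgue_measure_unique R (image_measure mphi (mscale k leb))) => //.
  move=> _ [[u v] _ <-] /=; rewrite /pushforward /mscale /=.
  have -> : (fun x : R => (a * x + b)%R) @^-1` `]u, v]%classic = `]((u - b) / a)%R, ((v - b) / a)%R]%classic.
    apply/seteqP; split => x /=; rewrite !in_itv /= ltr_pdivrMr// ler_pdivlMr// ltrBlDr lerBrDr [(x * a)%R]mulrC//.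
  rewrite !lebesgue_measure_itv /= !lte_fin ltr_pM2r ?invr_gt0// ltrD2r.
  case: ifPn => _; last by rewrite mule0.
  rewrite -!EFinD -EFinM; congr EFin; field; exact: lt0r_neq0.
- exact: (measurableT_comp mf mphi).
Qed.

Lemma ge0_integral_shift (b : R) (f : R -> \bar R) :
  measurable_fun setT f -> (forall x, 0 <= f x) ->
  \int[leb]_x f (x + b)%R = \int[leb]_x f x.
Proof.
move=> mf f0; rewrite [RHS](@ge0_integral_affine 1 b)// mul1e.
by apply: eq_integral => x _; rewrite mul1r.
Qed.

Lemma ge0_integral_lebesgueC1 (f : RR -> \bar R) :
  measurable_fun setT f -> (forall p, 0 <= f p) ->
  \int[lebesgueC]_p f p = \int[leb]_x \int[leb]_y f (x, y).
Proof. by move=> mf f0; rewrite (@fubini_tonelli1 _ _ _ _ _ leb leb). Qed.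

Lemma ge0_integral_lebesgueC2 (f : RR -> \bar R) :
  measurable_fun setT f -> (forall p, 0 <= f p) ->
  \int[lebesgueC]_p f p = \int[leb]_y \int[leb]_x f (x, y).
Proof. by move=> mf f0; rewrite (@fubini_tonelli2 _ _ _ _ _ leb leb). Qed.

Lemma measurable_lin_pair (a b c d : R) : measurable_fun setT
  (fun p : RR => ((a * p.1 + b * p.2)%R, (c * p.1 + d * p.2)%R) : RR).
Proof.
have m1 : measurable_fun setT (fun p : RR => p.1 : R) by exact: measurable_fst.
have m2 : measurable_fun setT (fun p : RR => p.2 : R) by exact: measurable_snd.
by apply: measurable_fun_pair; apply: measurable_funD; apply: measurable_funM.
Qed.

Lemma measurable_comp_lin (f : RR -> \bar R) (a b c d : R) : measurable_fun setT f ->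
  measurable_fun setT (fun p : RR => f ((a * p.1 + b * p.2)%R, (c * p.1 + d * p.2)%R)).
Proof. by move=> mf; apply: (measurableT_comp mf); exact: measurable_lin_pair. Qed.

(** Integrating first along the sheared coordinate, the shear is a translation. The coefficients 0
    and 1 are written out so that every shear is an instance of [measurable_comp_lin]. *)
Lemma ge0_integral_shear1 (s : R) (f : RR -> \bar R) :
  measurable_fun setT f -> (forall p, 0 <= f p) ->
  \int[lebesgueC]_p f ((1 * p.1 + s * p.2)%R, (0 * p.1 + 1 * p.2)%R) = \int[lebesgueC]_p f p.
Proof.
move=> mf f0; rewrite (ge0_integral_lebesgueC2 mf f0).
rewrite (ge0_integral_lebesgueC2 (measurable_comp_lin 1 s 0 1 mf) (fun p => f0 _)).
apply: eq_integral => y _; rewrite -[RHS](@ge0_integral_shift (s * y))//.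
  by apply: eq_integral => x _; rewrite mul0r add0r !mul1r.
exact: measurableT_comp.
Qed.

Lemma ge0_integral_shear2 (s : R) (f : RR -> \bar R) :
  measurable_fun setT f -> (forall p, 0 <= f p) ->
  \int[lebesgueC]_p f ((1 * p.1 + 0 * p.2)%R, (s * p.1 + 1 * p.2)%R) = \int[lebesgueC]_p f p.
Proof.
move=> mf f0; rewrite (ge0_integral_lebesgueC1 mf f0).
rewrite (ge0_integral_lebesgueC1 (measurable_comp_lin 1 0 s 1 mf) (fun p => f0 _)).
apply: eq_integral => x _; rewrite -[RHS](@ge0_integral_shift (s * x))//.
  by apply: eq_integral => y _; rewrite mul0r addr0 !mul1r addrC.
exact: measurableT_comp.
Qed.

Definition rotRR (t : R) (p : RR) : RR :=
  ((cos t * p.1 + - sin t * p.2)%R, (sin t * p.1 + cos t * p.2)%R).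

Lemma rotRRD s t p : rotRR (s + t) p = rotRR s (rotRR t p).
Proof. by rewrite /rotRR cosD sinD /=; congr (_, _); ring. Qed.

Lemma measurable_rotRR t : measurable_fun setT (rotRR t).
Proof. exact: measurable_lin_pair. Qed.

(* A rotation is a product of three shears, except the half turn, which is the
   square of a quarter turn. *)
Lemma ge0_integral_rotRR (t : R) (f : RR -> \bar R) :
  measurable_fun setT f -> (forall p, 0 <= f p) ->
  \int[lebesgueC]_p f (rotRR t p) = \int[lebesgueC]_p f p.
Proof.
have main (s : R) (g : RR -> \bar R) : cos s != 0%R -> measurable_fun setT g -> (forall p, 0 <= g p) ->
    \int[lebesgueC]_p g (rotRR (s + s) p) = \int[lebesgueC]_p g p.
  (* The rotation by 2 s is the product of shears with coefficients -tan s, sin 2s, -tan s. *)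
  move=> c0 mg g0; pose u := (- (sin s / cos s))%R; pose v := sin (s + s).
  pose g1 (p : RR) := g ((1 * p.1 + u * p.2)%R, (0 * p.1 + 1 * p.2)%R).
  pose g2 (p : RR) := g1 ((1 * p.1 + 0 * p.2)%R, (v * p.1 + 1 * p.2)%R).
  have mg1 : measurable_fun setT g1 by exact: measurable_comp_lin.
  have mg2 : measurable_fun setT g2 by exact: measurable_comp_lin.
  have g10 p : 0 <= g1 p by exact: g0.
  have g20 p : 0 <= g2 p by exact: g0.
  rewrite -[RHS](ge0_integral_shear1 u)// -[RHS](@ge0_integral_shear2 v g1)//.
  rewrite -[RHS](@ge0_integral_shear1 u g2)//.
  apply: eq_integral => p _; congr (g _).
  have E : (cos s ^+ 2 = 1 - sin s ^+ 2)%R by rewrite -(cos2Dsin2 s); ring.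
  have E2 : (cos s * cos s - sin s * sin s = 1 - 2 * sin s ^+ 2)%R by rewrite -!expr2 E; ring.
  rewrite /rotRR /= /v sinD cosD E2 /u; congr (_, _).
    apply: (@mulIf _ (cos s ^+ 2)); first by rewrite expf_neq0.
    transitivity ((1 - 2 * sin s ^+ 2) * cos s ^+ 2 * p.1 - 2 * sin s * cos s * cos s ^+ 2 * p.2)%R; first by ring.
    transitivity ((1 - 2 * sin s ^+ 2) * cos s ^+ 2 * p.1 - (2 * sin s * cos s - 2 * sin s ^+ 3 * cos s) * p.2)%R.
      by rewrite E; ring.
    by field.
  by field.
move=> mf f0.
have mR := measurable_rotRR; have mfR s : measurable_fun setT (fun p => f (rotRR s p)).
  by apply: measurableT_comp.
(* If cos (t/2) = 0, then cos (t/4) is nonzero, and [main] is applied twice to the rotation by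
   t/2. *)
have [c0|c0] := eqVneq (cos (t / 2)) 0%R; last by rewrite {1}(splitr t); exact: main.
have c1 : cos (t / 2 / 2) != 0%R.
  apply/eqP => c1; move: c0; rewrite (splitr (t / 2)) cosD c1 mul0r sub0r => /eqP.
  rewrite oppr_eq0 => /eqP s0; have := cos2Dsin2 (t / 2 / 2).
  by rewrite c1 expr0n add0r expr2 s0 => /esym/eqP; exact/negP/oner_neq0.
rewrite {1}(splitr t); under eq_integral do rewrite rotRRD.
rewrite {1 2}(splitr (t / 2)).
rewrite (main _ (fun p => f (rotRR (t / 2 / 2 + t / 2 / 2) p)))//.
exact: main.
Qed.

Definition sqRR (p : RR) : measurableTypeR R := (p.1 ^+ 2 + p.2 ^+ 2)%R.

Lemma measurable_sqRR : measurable_fun setT sqRR.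
Proof.
have m1 : measurable_fun setT (fun p : RR => p.1 : R) by exact: measurable_fst.
have m2 : measurable_fun setT (fun p : RR => p.2 : R) by exact: measurable_snd.
by apply: measurable_funD; apply: measurable_funX.
Qed.

Lemma measurable_sqRR_le r : measurable [set p : RR | (sqRR p <= r)%R].
Proof.
have -> : [set p : RR | (sqRR p <= r)%R] = sqRR @^-1` `]-oo, r].
  by apply/seteqP; split => p /=; rewrite in_itv.
by rewrite -[X in measurable X]setTI; exact: measurable_sqRR.
Qed.

Lemma lebesgueC_dilation (a : R) (A : set RR) : (0 < a)%R -> measurable A ->
  lebesgueC [set p : RR | A ((a * p.1)%R, (a * p.2)%R)] = (a ^- 2)%:E * lebesgueC A.
Proof.
move=> a0 mA; have mlin := @measurable_lin_pair a 0 0 a.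
set B := [set p | _].
have BE : B = (fun p : RR => ((a * p.1 + 0 * p.2)%R, (0 * p.1 + a * p.2)%R) : RR) @^-1` A.
  by apply/seteqP; split => p; rewrite /B /= !mul0r addr0 add0r.
have mB : measurable B by rewrite BE -[X in measurable X]setTI; exact: mlin.
have E (C : set RR) : measurable C -> lebesgueC C = \int[leb]_x \int[leb]_y (\1_C (x, y))%:E.
  move=> mC; rewrite -[C in LHS]setIT -integral_indic// ge0_integral_lebesgueC1//.
  exact/measurable_EFinP.
rewrite (E A)// (@ge0_integral_affine a 0)//; first last.
- move=> x; exact: integral_ge0.
- apply: (@measurable_fun_fubini_tonelli_F _ _ _ _ _ leb (fun p => (\1_A p)%:E)) => //.
  exact/measurable_EFinP.
rewrite muleA -EFinM.
have -> : \int[leb]_x \int[leb]_y (\1_A ((a * x + 0)%R, y))%:E =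
    a%:E * lebesgueC B.
  rewrite (E B)// -ge0_integralZl//.
  - apply: eq_integral => x _; rewrite [LHS](@ge0_integral_affine a 0)//.
      by congr (_ * _); apply: eq_integral => y _; rewrite !addr0 /B !indicE; congr (_%:R%:E); rewrite !in_setE.
    have m1 : measurable_fun setT (fun y : measurableTypeR R => ((a * x + 0)%R, y) : RR).
      by apply: measurable_fun_pair => //; exact: measurable_cst.
    by apply/measurable_EFinP; apply: (measurableT_comp _ m1).
  - apply: (@measurable_fun_fubini_tonelli_F _ _ _ _ _ leb (fun p => (\1_B p)%:E)) => //.
    exact/measurable_EFinP.
  - by move=> x _; exact: integral_ge0.
  - by rewrite lee_fin ltW.
rewrite muleA -EFinM (_ : (_ * _ * a = 1)%R) ?mul1e//.
by field; rewrite lt0r_neq0.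
Qed.

Lemma lebesgueC_box (A B : set (measurableTypeR R)) : measurable A -> measurable B ->
  lebesgueC (A `*` B : set RR) = leb A * leb B.
Proof. by move=> mA mB; exact: (@product_measure1E _ _ _ _ _ leb leb). Qed.

(** The area of the unit disc, kept as an unevaluated positive constant: it is absorbed into
    [ball_cst], which cancels in the normalised moments. *)
Definition disc1 : \bar R := lebesgueC [set p : RR | (sqRR p <= 1)%R].

Lemma disc1_gt0 : 0 < disc1.
Proof.
apply: (@lt_le_trans _ _ (lebesgueC (`[0%R, (1/2)%R]%classic `*` `[0%R, (1/2)%R]%classic : set RR))).
  rewrite lebesgueC_box// !lebesgue_measure_itv /= lte_fin divr_gt0//.
  by rewrite -!EFinD -EFinM lte_fin subr0 mulr_gt0// divr_gt0.
apply: le_measure; rewrite ?inE; [exact: measurableX|exact: measurable_sqRR_le|].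
move=> [x y] [/=]; rewrite !in_itv /sqRR /= => /andP[x0 x1] /andP[y0 y1].
nra.
Qed.

Lemma disc1_lty : disc1 < +oo.
Proof.
apply: (@le_lt_trans _ _ (lebesgueC (`[(-1)%R, 1%R]%classic `*` `[(-1)%R, 1%R]%classic : set RR))).
  apply: le_measure; rewrite ?inE; [exact: measurable_sqRR_le|exact: measurableX|].
  by move=> [x y] /=; rewrite !in_itv /sqRR /= => xy; split; nra.
rewrite lebesgueC_box// !lebesgue_measure_itv /= lte_fin.
by case: ifP => _; rewrite ?mule0// -!EFinD -EFinM ltry.
Qed.

Lemma lebesgueC_disc (r : R) : (0 < r)%R ->
  lebesgueC [set p : RR | (sqRR p <= r)%R] = r%:E * disc1.
Proof.
move=> r0; have s0 : (0 < (Num.sqrt r)^-1)%R by rewrite invr_gt0 sqrtr_gt0.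
have -> : [set p : RR | (sqRR p <= r)%R] = [set p : RR | [set p : RR | (sqRR p <= 1)%R] (((Num.sqrt r)^-1 * p.1)%R, ((Num.sqrt r)^-1 * p.2)%R)].
  apply/seteqP; split => p /=; rewrite /sqRR /= !exprMn -mulrDr exprVn sqr_sqrtr ?(ltW r0)//;
  by rewrite mulrC ler_pdivrMr// mul1r.
rewrite lebesgueC_dilation//; last exact: measurable_sqRR_le.
by rewrite exprVn invrK sqr_sqrtr// ltW.
Qed.

Lemma lebesgueC_disc0 (r : R) : (r <= 0)%R -> lebesgueC [set p : RR | (sqRR p <= r)%R] = 0.
Proof.
move=> r0; apply/eqP; rewrite eq_le measure_ge0 andbT.
rewrite (@le_trans _ _ (lebesgueC ([set 0%R] `*` [set 0%R] : set RR)))//; last first.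
  by rewrite lebesgueC_box// lebesgue_measure_set1 mul0e.
apply: le_measure; rewrite ?inE; [exact: measurable_sqRR_le|exact: measurableX|].
move=> [x y] /=; rewrite /sqRR /= => xy.
have x0 : (x ^+ 2 = 0)%R by have := sqr_ge0 x; have := sqr_ge0 y; lra.
have y0 : (y ^+ 2 = 0)%R by have := sqr_ge0 x; have := sqr_ge0 y; lra.
by split; apply/eqP; rewrite -sqrf_eq0; apply/eqP.
Qed.

(* The image of planar Lebesgue measure under |.|^2 is, off 0, a multiple of
   Lebesgue measure on the half line. *)
Lemma ge0_integral_sqRR : exists2 c : R, (0 < c)%R & forall f : R -> \bar R,
  measurable_fun setT f -> (forall x, 0 <= f x) ->
  \int[lebesgueC]_p f (sqRR p) = c%:E * \int[leb]_(t in `]0%R, +oo[) f t.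
Proof.
have dfin : disc1 \is a fin_num by rewrite ge0_fin_numE ?measure_ge0 ?disc1_lty.
pose c := fine disc1; have c0 : (0 < c)%R by rewrite fine_gt0// disc1_gt0 disc1_lty.
have cE : disc1 = c%:E by rewrite fineK.
exists c => // f mf f0.
have ic0 : (0 <= c^-1)%R by rewrite invr_ge0 ltW.
(* The normalised image measure gives mass to the positive half line only; adding [m2], Lebesgue
   measure on the negative half line, makes a measure that can be identified on all half-open
   intervals. *)
pose m1 := mscale (NngNum ic0) (image_measure measurable_sqRR lebesgueC).
have mNy : measurable (`]-oo, 0%R]%classic : set (measurableTypeR R)) by [].
pose m2 := mrestr leb mNy.
have E A : measurable A -> leb A = measure_add m1 m2 A.
  apply: lebesgue_measure_unique => _ [[a b] _ <-].
  transitivity (m1 `]a, b]%classic + m2 `]a, b]%classic); last by rewrite -measure_addE.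
  rewrite /m1 /m2 /mscale /mrestr /= /pushforward.
  have [ab|ba] := ltP a b; last first.
    by rewrite set_itv_ge ?bnd_simp -?leNgt// set0I preimage_set0 !measure0 mule0 adde0.
  have -> : `]a, b]%classic `&` `]-oo, 0%R]%classic = `]a, Num.min b 0%R]%classic.
    apply/seteqP; split => x /=; rewrite !in_itv /= le_min.
      by move=> [/andP[-> ->] ->].
    by move=> /and3P[-> -> ->].
  have -> : sqRR @^-1` `]a, b] = [set p | (sqRR p <= b)%R] `\` [set p | (sqRR p <= a)%R].
    apply/seteqP; split => p /=; rewrite in_itv /=; first by move=> /andP[h ->]; split => //; apply/negP; rewrite -ltNge.
    by move=> [-> /negP]; rewrite -ltNge => ->.
  have F r : lebesgueC [set p : RR | (sqRR p <= r)%R] = (Num.max r 0 * c)%:E.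
    have [r0|r0] := leP r 0%R; first by rewrite lebesgueC_disc0// mul0r.
    by rewrite lebesgueC_disc// cE.
  have Fb : lebesgueC [set p : RR | (sqRR p <= b)%R] < +oo by rewrite F ltry.
  have -> : lebesgueC ([set p : RR | (sqRR p <= b)%R] `\` [set p | (sqRR p <= a)%R]) =
      lebesgueC [set p : RR | (sqRR p <= b)%R] -
      lebesgueC ([set p : RR | (sqRR p <= b)%R] `&` [set p | (sqRR p <= a)%R]).
    by apply: measureD => //; exact: measurable_sqRR_le.
  rewrite (_ : _ `&` _ = [set p : RR | (sqRR p <= a)%R]); last first.
    apply/seteqP; split => p /=; first by case.
    by move=> pa; split => //; exact: (le_trans pa (ltW ab)).
  rewrite !F !lebesgue_measure_itv /= !lte_fin ab -!EFinD.
  rewrite -EFinM -mulrBl [((_ - _) * c)%R]mulrC mulKf ?lt0r_neq0//.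
  case: (leP b 0%R) => hb; case: (leP a 0%R) => haa; case: ifPn => ha; rewrite -EFinD; congr EFin;
    rewrite -?leNgt in ha; lra.
have mS : measurable [set p : RR | (sqRR p <= 0)%R] by exact: measurable_sqRR_le.
have S0 := lebesgueC_disc0 (lexx 0%R).
have mfs : measurable_fun setT (fun p : RR => f (sqRR p)).
  by apply: (measurableT_comp mf); exact: measurable_sqRR.
rewrite (@ge0_negligible_integral _ _ _ lebesgueC setT [set p : RR | (sqRR p <= 0)%R])//.
have -> : \int[leb]_(t in `]0%R, +oo[) f t = \int[m1]_(t in `]0%R, +oo[) f t.
  apply: eq_measure_integral.
  move=> A mA AS; have A0 : A `&` `]-oo, 0%R]%classic = set0.
    by apply/seteqP; split => // x [/AS] /=; rewrite !in_itv /= andbT => x0 x1; lra.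
  have m20 : m2 A = 0 by rewrite /m2 /mrestr A0 measure0.
  transitivity (m1 A + m2 A); first by rewrite -measure_addE; exact: E.
  by rewrite m20 adde0.
rewrite ge0_integral_mscale//; last exact: measurable_funTS.
rewrite muleA -EFinM divff ?lt0r_neq0// mul1e.
rewrite (@ge0_integral_pushforward _ _ _ _ _ _ measurable_sqRR)//; last exact: measurable_funTS.
congr (integral _ _ _); apply/seteqP; split => p /=; rewrite in_itv /= andbT.
  by move=> [_ /negP]; rewrite -ltNge.
by move=> p0; split => //; apply/negP; rewrite -ltNge.
Qed.

End plane_measure.

(** * Splitting off one coordinate of C^(n+1) *)

Section measure_on_Cn_step.
Context {R : realType}.
Local Open Scope ereal_scope.
Notation RR := (measurableTypeR R * measurableTypeR R)%type.

Lemma measurable_comp_Ccons n (f : Cn R n.+1 -> \bar R) : measurable_fun setT f ->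
  measurable_fun setT (fun p : RR * Cn R n => f (Ccons p)).
Proof. by move=> mf; apply: (measurableT_comp mf); exact: measurable_Ccons. Qed.

Lemma ge0_integral_CnS n (f : Cn R n.+1 -> \bar R) :
  measurable_fun setT f -> (forall z, 0 <= f z) ->
  \int[lebesgueCn n.+1]_z f z =
  \int[lebesgueC]_p \int[lebesgueCn n]_w f (Ccons (p, w)).
Proof.
move=> mf f0; rewrite /=.
rewrite (@ge0_integral_image _ _ _ _ _ _ (@measurable_Ccons R n) (lebesgueC \x lebesgueCn n) (lebesgue_step (lebesgueCn n)))//.
rewrite (@fubini_tonelli1 _ _ _ _ _ lebesgueC (lebesgueCn n))//.
exact: measurable_comp_Ccons.
Qed.

End measure_on_Cn_step.

(** * Measurability of complex-valued functions *)

Section complex_measurability.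
Context {R : realType} d {T : measurableType d}.
Implicit Types (D : set T) (f g : T -> Cx R).

Definition cmeas D f := measurable_fun D (fun x => ReC (f x)) /\ measurable_fun D (fun x => ImC (f x)).

Lemma cmeas_cst D c : cmeas D (fun=> c).
Proof. by split; exact: measurable_cst. Qed.

Lemma cmeasD D f g : cmeas D f -> cmeas D g -> cmeas D (fun x => f x + g x).
Proof.
move=> [f1 f2] [g1 g2]; split.
  by under eq_fun do rewrite ReCD; exact: measurable_funD.
by under eq_fun do rewrite ImCD; exact: measurable_funD.
Qed.

Lemma cmeasM D f g : cmeas D f -> cmeas D g -> cmeas D (fun x => f x * g x).
Proof.
move=> [f1 f2] [g1 g2]; split.
  by under eq_fun do rewrite ReCM; apply: measurable_funB; exact: measurable_funM.
by under eq_fun do rewrite ImCM; apply: measurable_funD; exact: measurable_funM.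
Qed.

Lemma cmeasN D f : cmeas D f -> cmeas D (fun x => - f x).
Proof.
move=> fm; have := cmeasM (cmeas_cst D (-1)) fm.
by under eq_fun do rewrite mulN1r.
Qed.

Lemma cmeasB D f g : cmeas D f -> cmeas D g -> cmeas D (fun x => f x - g x).
Proof. by move=> fm gm; apply: cmeasD => //; exact: cmeasN. Qed.

Lemma cmeas_conj D f : cmeas D f -> cmeas D (fun x => (f x)^*).
Proof.
move=> [f1 f2]; split; first by under eq_fun do rewrite ReC_conj.
by under eq_fun do rewrite ImC_conj; exact: measurableT_comp.
Qed.

Lemma cmeasX D f k : cmeas D f -> cmeas D (fun x => f x ^+ k).
Proof.
move=> fm; elim: k => [|k IH]; first exact: cmeas_cst.
by under eq_fun do rewrite exprS; exact: cmeasM.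
Qed.

Lemma cmeas_sum D I (r : seq I) (P : pred I) (F : I -> T -> Cx R) :
  (forall i, P i -> cmeas D (F i)) -> cmeas D (fun x => \sum_(i <- r | P i) F i x).
Proof.
move=> Fm; elim: r => [|i r IH].
  by under eq_fun do rewrite big_nil; exact: cmeas_cst.
under eq_fun do rewrite big_cons; case: (boolP (P i)) => Pi //.
by apply: cmeasD IH; exact: Fm.
Qed.

Lemma cmeas_prod D I (r : seq I) (P : pred I) (F : I -> T -> Cx R) :
  (forall i, P i -> cmeas D (F i)) -> cmeas D (fun x => \prod_(i <- r | P i) F i x).
Proof.
move=> Fm; elim: r => [|i r IH].
  by under eq_fun do rewrite big_nil; exact: cmeas_cst.
under eq_fun do rewrite big_cons; case: (boolP (P i)) => Pi //.
by apply: cmeasM IH; exact: Fm.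
Qed.

Lemma cmeas_RC D (f : T -> R) : measurable_fun D f -> cmeas D (fun x => RC (f x)).
Proof. by move=> fm; split => //; exact: measurable_cst. Qed.

Lemma cmeas_absC D f : measurable D -> cmeas D f -> measurable_fun D (fun x => absC (f x)).
Proof. by move=> mD [f1 f2]; exact: measurable_absC. Qed.

Lemma cmeasS D D' f : measurable D -> D' `<=` D -> cmeas D f -> cmeas D' f.
Proof. by move=> mD sD [f1 f2]; split; exact: measurable_funS sD _. Qed.

End complex_measurability.

(** * Integrals of |z^a|^2 f(|z|^2) over C^n, and boxes of positive measure *)

Section measure_of_Cn.
Context {R : realType}.
Local Open Scope ereal_scope.
Notation leb := (@lebesgue_measure R).
Notation RR := (measurableTypeR R * measurableTypeR R)%type.

Lemma cmeas_coord n (i : 'I_n) : cmeas setT (fun z : Cn R n => z ord0 i).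
Proof.
split.
  exact: (measurableT_comp (@measurable_fst _ _ (measurableTypeR R) (measurableTypeR R)) (measurable_coordRR i)).
exact: (measurableT_comp (@measurable_snd _ _ (measurableTypeR R) (measurableTypeR R)) (measurable_coordRR i)).
Qed.

Lemma measurable_sqnorm n : measurable_fun setT (@sqnorm R n).
Proof.
apply: measurable_sum => i; apply: measurable_funX.
by apply: cmeas_absC => //; exact: cmeas_coord.
Qed.

Lemma measurable_uball n : measurable (@uball R n).
Proof.
have -> : @uball R n = (@sqnorm R n) @^-1` `]-oo, 1%R[.
  by apply/seteqP; split => z; rewrite /uball /= in_itv.
by rewrite -[X in measurable X]setTI; apply: measurable_sqnorm.
Qed.

Lemma Ccons_coord0 n (p : RR) (w : Cn R n) : (Ccons (p, w)) ord0 ord0 = mkC p.1 p.2.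
Proof.
rewrite /Ccons /=; have -> : ord0 = lshift n (ord0 : 'I_1) :> 'I_(1 + n) by apply: val_inj.
by rewrite (@row_mxEl _ 1 1 n) mxE eqxx mulr1n.
Qed.

Lemma Ccons_coordS n (p : RR) (w : Cn R n) (i : 'I_n) : (Ccons (p, w)) ord0 (lift ord0 i) = w ord0 i.
Proof.
rewrite /Ccons /=; have -> : lift ord0 i = rshift 1 i :> 'I_(1 + n) by apply: val_inj.
by rewrite (@row_mxEr _ 1 1 n).
Qed.

Lemma sqnorm_Ccons n (p : RR) (w : Cn R n) : sqnorm (Ccons (p, w)) = (sqRR p + sqnorm w)%R.
Proof.
rewrite /sqnorm big_ord_recl Ccons_coord0 sqr_absC; congr (_ + _)%R.
by apply: eq_bigr => i _; rewrite Ccons_coordS.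
Qed.

(** A factor in the integrand instead of a domain of integration, so that Fubini's theorem and
    translations are applied on the whole line. *)
Definition halfline (t : R) : \bar R := (\1_(`[0%R, +oo[ : set R) t)%:E.

Lemma halfline_ge0 t : 0 <= halfline t.
Proof. by rewrite /halfline lee_fin. Qed.

Lemma halflineE t : halfline t = (if (0 <= t)%R then 1 else 0).
Proof. by rewrite /halfline indicE mem_setE in_itv /= andbT; case: ifP. Qed.

Lemma measurable_halfline : measurable_fun setT halfline.
Proof. exact/measurable_EFinP. Qed.

(** The integral of f over [x, +oo[, written from 0 so that iterates compose by translation. *)
Definition tail_integral (f : R -> \bar R) (x : R) : \bar R :=
  \int[leb]_t (f (x + t)%R * halfline t).

Lemma tail_integral_ge0 f x : (forall t, 0 <= f t) -> 0 <= tail_integral f x.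
Proof. by move=> f0; apply: integral_ge0 => t _; rewrite mule_ge0 ?halfline_ge0. Qed.

Lemma measurable_shiftE (f : R -> \bar R) (x : R) : measurable_fun setT f ->
  measurable_fun setT (fun t : R => f (x + t)%R).
Proof. by move=> mf; apply: (measurableT_comp mf); exact: measurable_funD. Qed.

Lemma measurable_addE2 (f : R -> \bar R) : measurable_fun setT f ->
  measurable_fun setT (fun p : RR => f (p.1 + p.2)%R).
Proof.
move=> mf; apply: (measurableT_comp mf).
by apply: measurable_funD; [exact: measurable_fst|exact: measurable_snd].
Qed.

Lemma measurable_tail_integral f : measurable_fun setT f -> (forall t, 0 <= f t) ->
  measurable_fun setT (tail_integral f).
Proof.
move=> mf f0; apply: (@measurable_fun_fubini_tonelli_F _ _ _ _ _ leb
  (fun p : RR => f (p.1 + p.2)%R * halfline p.2)) => //.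
  apply: emeasurable_funM; first exact: measurable_addE2.
  by apply: (measurableT_comp measurable_halfline); exact: measurable_snd.
by move=> p; rewrite mule_ge0 ?halfline_ge0.
Qed.

Lemma is_derive_exprS (a : nat) (x : R) :
  is_derive x (1 : R)%R (fun s : R => s ^+ a.+1)%R (a.+1%:R * x ^+ a)%R.
Proof.
have [h _] := cderivX a (cderiv_RC x).
rewrite (_ : (fun s : R => _) = (fun s : R => ReC (RC s ^+ a.+1))); last by apply/funext => s; rewrite -RCX.
by apply: is_derive_eq h _; rewrite mulr1 -RC_nat -RCX -RCM.
Qed.

Lemma integral_pow_segment (a : nat) (t : R) : (0 <= t)%R ->
  \int[leb]_s ((s ^+ a)%:E * halfline s * halfline (t - s)%R) = (t ^+ a.+1 / a.+1%:R)%:E.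
Proof.
move=> t0.
have -> : \int[leb]_s ((s ^+ a)%:E * halfline s * halfline (t - s)%R) =
   \int[leb]_(s in `[0%R, t]) (s ^+ a)%:E.
  rewrite [RHS]integral_mkcond; apply: eq_integral => s _.
  rewrite patchE mem_setE in_itv /= !halflineE subr_ge0.
  by case: ifP => _ /=; case: ifP => _; rewrite ?mule1 ?mule0.
move: t0; rewrite le_eqVlt => /predU1P[<-|t0].
  by rewrite set_itv1 integral_set1 exprS mul0r mul0r.
rewrite (@continuous_FTC2 R _ (fun s => s ^+ a.+1 / a.+1%:R)%R)//.
- by rewrite expr0n /= mul0r sube0.
- by apply: continuous_subspaceT => x; exact: exprn_continuous.
- have dF x : is_derive x (1:R)%R (fun s : R => s ^+ a.+1 / a.+1%:R)%R (x ^+ a)%R.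
    rewrite (_ : (fun s : R => _) = (fun s : R => a.+1%:R^-1 *: s ^+ a.+1)%R); last by apply/funext => s; rewrite mulrC.
    apply: (@is_derive_eq _ _ _ _ _ _ _ _ (is_deriveZ (a.+1%:R^-1)%R (is_derive_exprS a x))).
    by rewrite /GRing.scale /= mulKf// pnatr_eq0.
  have cF x : {for x, continuous (fun s : R => s ^+ a.+1 / a.+1%:R)%R}.
    by apply/differentiable_continuous/derivable1_diffP; case: (dF x).
  split.
  + by move=> x _; case: (dF x).
  + by apply: cvg_at_right_filter; exact: cF.
  + by apply: cvg_at_left_filter; exact: cF.
- move=> x _; rewrite derive1E.
  have dF : is_derive x (1:R)%R (fun s : R => s ^+ a.+1 / a.+1%:R)%R (x ^+ a)%R.
    rewrite (_ : (fun s : R => _) = (fun s : R => a.+1%:R^-1 *: s ^+ a.+1)%R); last by apply/funext => s; rewrite mulrC.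
    apply: (@is_derive_eq _ _ _ _ _ _ _ _ (is_deriveZ (a.+1%:R^-1)%R (is_derive_exprS a x))).
    by rewrite /GRing.scale /= mulKf// pnatr_eq0.
  by case: dF.
Qed.

Lemma measurable_powE (a : nat) : measurable_fun setT (fun t : R => (t ^+ a)%:E : \bar R).
Proof. by apply/measurable_EFinP; apply: measurable_funX. Qed.

Lemma iter_tail_integral_ge0 k f : (forall t, 0 <= f t) -> forall t, 0 <= iter k tail_integral f t.
Proof. by move=> f0; elim: k => // k IH t; exact: tail_integral_ge0. Qed.

Lemma measurable_iter_tail_integral k f : measurable_fun setT f -> (forall t, 0 <= f t) ->
  measurable_fun setT (iter k tail_integral f).
Proof.
move=> mf f0; elim: k => // k IH; apply: measurable_tail_integral => //.
exact: iter_tail_integral_ge0.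
Qed.

(** Cauchy's formula for repeated integration. In the inductive step t^(a+1) becomes a+1 times the
    integral of s^a over [0, t], and the two integrals are exchanged. *)
Lemma integral_pow_tail (a : nat) (f : R -> \bar R) (y : R) :
  measurable_fun setT f -> (forall t, 0 <= f t) ->
  \int[leb]_t ((t ^+ a)%:E * f (y + t)%R * halfline t) = (a`!%:R)%:E * iter a.+1 tail_integral f y.
Proof.
elim: a f => [|a IH] f mf f0.
  by rewrite mul1e; apply: eq_integral => t _; rewrite expr0 mul1e.
have E t : (t ^+ a.+1)%:E * f (y + t)%R * halfline t =
    \int[leb]_s (a.+1%:R%:E * ((s ^+ a)%:E * halfline s * halfline (t - s)%R) * f (y + t)%R).
  have m1 : measurable_fun setT (fun s : R => (s ^+ a)%:E * halfline s * halfline (t - s)%R).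
    apply: emeasurable_funM.
      by apply: emeasurable_funM; [exact: measurable_powE|exact: measurable_halfline].
    by apply: (measurableT_comp measurable_halfline); exact: measurable_funB.
  have p1 s : 0 <= (s ^+ a)%:E * halfline s * halfline (t - s)%R.
    rewrite mule_ge0 ?halfline_ge0// halflineE; case: ifP => s0; last by rewrite mule0.
    by rewrite mule1 lee_fin exprn_ge0.
  rewrite ge0_integralZr//; first last.
  - by move=> s _; rewrite mule_ge0.
  - exact: measurable_funeM.
  rewrite ge0_integralZl//.
  have [t0|t0] := leP 0%R t.
    rewrite integral_pow_segment// halflineE t0 mule1 -EFinM; congr (_%:E * _).
    by rewrite mulrC divfK// pnatr_eq0.
  rewrite halflineE (leNgt _ t) t0 /= mule0.
  rewrite (_ : \int[leb]_s _ = 0) ?mule0 ?mul0e//.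
  apply: integral0_eq => s _; rewrite !halflineE subr_ge0.
  case: ifP => s0; last by rewrite mule0 mul0e.
  by case: ifP => st; rewrite ?mule0//; have := le_trans s0 st; rewrite leNgt t0.
transitivity (\int[leb]_t \int[leb]_s (a.+1%:R%:E * ((s ^+ a)%:E * halfline s * halfline (t - s)%R) * f (y + t)%R)).
  by apply: eq_integral => t _; exact: E.
rewrite (@sfinite_Fubini _ _ _ _ _ leb leb (fun p : RR => a.+1%:R%:E * ((p.2 ^+ a)%:E * halfline p.2 * halfline (p.1 - p.2)%R) * f (y + p.1)%R)); first last.
- have m2 := @measurable_snd _ _ (measurableTypeR R) (measurableTypeR R).
  have m1 := @measurable_fst _ _ (measurableTypeR R) (measurableTypeR R).
  apply: emeasurable_funM; last exact: (measurableT_comp (measurable_shiftE y mf) m1).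
  apply: measurable_funeM; apply: emeasurable_funM.
    apply: emeasurable_funM; first exact: (measurableT_comp (measurable_powE a) m2).
    exact: (measurableT_comp measurable_halfline m2).
  by apply: (measurableT_comp measurable_halfline); exact: measurable_funB.
- move=> p; rewrite mule_ge0// mule_ge0// mule_ge0 ?halfline_ge0// halflineE; case: ifP => s0; last by rewrite mule0.
  by rewrite mule1 lee_fin exprn_ge0.
transitivity (\int[leb]_s (a.+1%:R%:E * ((s ^+ a)%:E * tail_integral f (y + s)%R * halfline s))).
  apply: eq_integral => s _ /=.
  have [s0|s0] := leP 0%R s; last first.
    rewrite (halflineE s) (leNgt _ s) s0 /= !mule0; apply: integral0_eq => t _.
    by rewrite mul0e mule0 mul0e.
  rewrite halflineE s0 !mule1 /tail_integral muleA.
  have ms : measurable_fun setT (fun t => f (y + s + t)%R * halfline t).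
    by apply: emeasurable_funM; [exact: measurable_shiftE|exact: measurable_halfline].
  rewrite -ge0_integralZl//; first last.
  - by rewrite mule_ge0// lee_fin exprn_ge0.
  - by move=> t _; rewrite mule_ge0 ?halfline_ge0.
  (* Shifting t by s turns the constraint t >= s into t >= 0, hence the inner integral into a tail
     integral at y + s. *)
  rewrite -[LHS](@ge0_integral_shift R s); last 2 first.
  - apply: emeasurable_funM; last exact: measurable_shiftE.
    apply: measurable_funeM; apply: measurable_funeM.
    by apply: (measurableT_comp measurable_halfline); exact: measurable_funB.
  - by move=> t; rewrite mule_ge0// mule_ge0// mule_ge0 ?halfline_ge0// lee_fin exprn_ge0.
  apply: eq_integral => t _; rewrite addrK [(t + s)%R]addrC [(y + (s + t))%R]addrA.
  by rewrite -!muleA; congr (_ * (_ * _)); rewrite muleC.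
have mJ := measurable_tail_integral mf f0.
have J0 t := tail_integral_ge0 t f0.
rewrite ge0_integralZl//; first last.
- move=> s _; rewrite -muleA; case: (leP 0%R s) => s0; last by rewrite halflineE (leNgt _ s) s0 !mule0.
  by rewrite mule_ge0 ?lee_fin ?exprn_ge0// mule_ge0 ?halfline_ge0.
- apply: emeasurable_funM; last exact: measurable_halfline.
  by apply: emeasurable_funM; [exact: measurable_powE|exact: measurable_shiftE].
by rewrite IH// muleA -EFinM -natrM -factS -iterSr.
Qed.

Lemma measurable_prod_sqnorm n (a : 'I_n -> nat) :
  measurable_fun setT (fun z : Cn R n => \prod_(i < n) absC (z ord0 i) ^+ (2 * a i))%R.
Proof.
apply: measurable_prod => i _; apply: measurable_funX.
by apply: cmeas_absC => //; exact: cmeas_coord.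
Qed.

Lemma prod_absC_ge0 n (a : 'I_n -> nat) (z : Cn R n) :
  (0 <= \prod_(i < n) absC (z ord0 i) ^+ (2 * a i))%R.
Proof. by apply: prodr_ge0 => i _; rewrite exprn_ge0// absC_ge0. Qed.

(** In each coordinate |z_i|^2 is distributed as c dt on the half line, so the factor |z_i|^(2 a_i)
    amounts to c a_i! and a_i + 1 further tail integrations. The offset y carries the squared moduli
    of the coordinates already split off. *)
Lemma integral_monomial_tail : exists2 c : R, (0 < c)%R &
  forall n (a : 'I_n -> nat) (f : R -> \bar R) (y : R),
  measurable_fun setT f -> (forall t, 0 <= f t) ->
  \int[lebesgueCn n]_z ((\prod_(i < n) absC (z ord0 i) ^+ (2 * a i))%:E * f (y + sqnorm z)%R) =
  (c ^+ n * (\prod_(i < n) (a i)`!)%:R)%:E * iter (\sum_(i < n) a i + n)%N tail_integral f y.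
Proof.
have [c c0 Hc] := @ge0_integral_sqRR R; exists c => // n.
elim: n => [|n IH] a f y mf f0.
  rewrite integral_dirac//; last first.
    apply: emeasurable_funM; first by apply/measurable_EFinP; exact: measurable_prod_sqnorm.
    by apply: (measurableT_comp (measurable_shiftE y mf)); exact: measurable_sqnorm.
  by rewrite diracT mul1e !big_ord0 /sqnorm big_ord0 addr0 expr0 mulr1.
have mF : measurable_fun setT (fun z : Cn R n.+1 => (\prod_(i < n.+1) absC (z ord0 i) ^+ (2 * a i))%:E * f (y + sqnorm z)%R).
  apply: emeasurable_funM; first by apply/measurable_EFinP; exact: measurable_prod_sqnorm.
  by apply: (measurableT_comp (measurable_shiftE y mf)); exact: measurable_sqnorm.
rewrite ge0_integral_CnS//; last first.
  by move=> z; rewrite mule_ge0// lee_fin prod_absC_ge0.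
pose a' i := a (lift ord0 i).
pose K := (c ^+ n * (\prod_(i < n) (a' i)`!)%:R)%R.
have K0 : (0 <= K)%R by rewrite mulr_ge0// exprn_ge0// ltW.
pose g := iter (\sum_(i < n) a' i + n)%N tail_integral f.
have mg : measurable_fun setT g by exact: measurable_iter_tail_integral.
have g0 t : 0 <= g t by exact: iter_tail_integral_ge0.
pose h t : \bar R := ((t ^+ a ord0)%:E * g (y + t)%R * halfline t) * K%:E.
have mh : measurable_fun setT h.
  apply: emeasurable_funM => //; apply: emeasurable_funM; last exact: measurable_halfline.
  by apply: emeasurable_funM; [exact: measurable_powE|exact: measurable_shiftE].
have h0 t : 0 <= h t.
  rewrite /h mule_ge0 ?lee_fin//; case: (leP 0%R t) => t0; last by rewrite halflineE (leNgt _ t) t0 !mule0.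
  by rewrite mule_ge0 ?halfline_ge0// mule_ge0// lee_fin exprn_ge0.
transitivity (\int[lebesgueC]_p h (sqRR p)).
  apply: eq_integral => p _.
  have sp0 : (0 <= sqRR p)%R by rewrite addr_ge0 ?sqr_ge0.
  rewrite /h halflineE sp0 mule1.
  transitivity (\int[lebesgueCn n]_w ((sqRR p ^+ a ord0)%:E * ((\prod_(i < n) absC (w ord0 i) ^+ (2 * a' i))%:E * f ((y + sqRR p) + sqnorm w)%R))).
    apply: eq_integral => w _; rewrite sqnorm_Ccons addrA muleA -EFinM; congr (_%:E * _).
    rewrite big_ord_recl Ccons_coord0 exprM sqr_absC; congr (_ * _)%R.
    by apply: eq_bigr => i _; rewrite Ccons_coordS.
  rewrite ge0_integralZl//; first last.
  - by rewrite lee_fin exprn_ge0.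
  - by move=> w _; rewrite mule_ge0// lee_fin prod_absC_ge0.
  - apply: emeasurable_funM; first by apply/measurable_EFinP; exact: measurable_prod_sqnorm.
    by apply: (measurableT_comp (measurable_shiftE _ mf)); exact: measurable_sqnorm.
  by rewrite (IH a')// -/K -/g -!muleA; congr (_ * _); rewrite muleC.
rewrite Hc//.
have mhl : measurable_fun setT (fun t : R => (t ^+ a ord0)%:E * g (y + t)%R * halfline t).
  apply: emeasurable_funM; last exact: measurable_halfline.
  by apply: emeasurable_funM; [exact: measurable_powE|exact: measurable_shiftE].
transitivity (c%:E * \int[leb]_t h t).
  congr (_ * _); rewrite integral_itv_obnd_cbnd; last exact: measurable_funS mh.
  rewrite integral_mkcond; apply: eq_integral => t _.
  rewrite patchE mem_setE in_itv /= andbT; case: ifPn => // t0.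
  by rewrite /h halflineE (negbTE t0) mule0 mul0e.
rewrite /h ge0_integralZr//; last first.
  move=> t _; case: (leP 0%R t) => t0; last by rewrite halflineE (leNgt _ t) t0 !mule0.
  by rewrite mule_ge0 ?halfline_ge0// mule_ge0// lee_fin exprn_ge0.
rewrite integral_pow_tail// /g -iterD !big_ord_recl.
have -> : (a ord0 + \sum_(i < n) a (lift ord0 i) + n.+1 = (a ord0).+1 + (\sum_(i < n) a' i + n))%N.
  by rewrite addnS addSn addnA.
rewrite -muleA [_ * K%:E]muleC !muleA -!EFinM; congr (_%:E * _).
by rewrite /K natrM exprS; ring.
Qed.

(** All tail integrations together, |a| + m + 1 of them, are turned back into one integral against
    t^(|a| + m) by Cauchy's formula, read backwards. *)
Lemma integral_monomial : exists2 c : R, (0 < c)%R &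
  forall m (a : 'I_m.+1 -> nat) (f : R -> \bar R),
  measurable_fun setT f -> (forall t, 0 <= f t) ->
  \int[lebesgueCn m.+1]_z ((\prod_(i < m.+1) absC (z ord0 i) ^+ (2 * a i))%:E * f (sqnorm z)) =
  (c ^+ m.+1 * (\prod_(i < m.+1) (a i)`!)%:R / ((\sum_(i < m.+1) a i + m)`!)%:R)%:E *
  \int[leb]_(t in `[0%R, +oo[) ((t ^+ (\sum_(i < m.+1) a i + m))%:E * f t).
Proof.
have [c c0 Hc] := integral_monomial_tail; exists c => // m a f mf f0.
have := Hc m.+1 a f 0%R mf f0; under eq_integral do rewrite add0r.
move=> ->; rewrite addnS [X in _ = X * _]EFinM -muleA; congr (_ * _).
set N := (_ + m)%N.
have := @integral_pow_tail N f 0%R mf f0.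
under eq_integral do rewrite add0r.
have -> : \int[leb]_t ((t ^+ N)%:E * f t * halfline t) = \int[leb]_(t in `[0%R, +oo[) ((t ^+ N)%:E * f t).
  rewrite [RHS]integral_mkcond; apply: eq_integral => t _.
  rewrite patchE mem_setE in_itv /= andbT halflineE.
  by case: ifP => _; rewrite ?mule1 ?mule0.
move=> ->; rewrite muleA -EFinM mulVf ?mul1e// pnatr_eq0 -lt0n; exact: fact_gt0.
Qed.

Definition Cbox n (z0 : Cn R n) (e : R) : set (Cn R n) :=
  [set z | forall i, (`|ReC (z ord0 i) - ReC (z0 ord0 i)| < e)%R /\ (`|ImC (z ord0 i) - ImC (z0 ord0 i)| < e)%R].

Lemma measurable_Cbox n (z0 : Cn R n) e : measurable (Cbox z0 e).
Proof.
pose B i : set (Cn R n) := coordRR i @^-1` (`](ReC (z0 ord0 i) - e)%R, (ReC (z0 ord0 i) + e)%R[%classic `*`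
   `](ImC (z0 ord0 i) - e)%R, (ImC (z0 ord0 i) + e)%R[%classic).
have -> : Cbox z0 e = \big[setI/setT]_(i < n) B i.
  rewrite -bigcap_seq; apply/seteqP; split => z.
    move=> H i _; have [h1 h2] := H i; rewrite /B /coordRR /=.
    by rewrite !in_itv /= -!ltr_distl.
  move=> H i; have := H i (mem_index_enum i); rewrite /B /coordRR /=.
  by rewrite !in_itv /= -!ltr_distl.
apply: bigsetI_measurable => i _; rewrite -[X in measurable X]setTI.
by apply: measurable_coordRR => //; exact: measurableX.
Qed.

(** Gives positive mass to neighbourhoods, which makes the Bergman inner product definite. *)
Lemma Cbox_gt0 n (z0 : Cn R n) e : (0 < e)%R -> 0 < lebesgueCn n (Cbox z0 e).
Proof.
move=> e0; elim: n z0 => [|n IH] z0.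
  by rewrite /= /dirac indicE mem_set// => -[].
rewrite /= /lebesgue_step /pushforward.
pose w0 : Cn R n := \row_i z0 ord0 (lift ord0 i).
pose I x := `](x - e)%R, (x + e)%R[%classic : set (measurableTypeR R).
have -> : @Ccons R n @^-1` Cbox z0 e = (I (ReC (z0 ord0 ord0)) `*` I (ImC (z0 ord0 ord0))) `*` Cbox w0 e.
  apply/seteqP; split => -[p w] /=.
    move=> H; split.
      by have := H ord0; rewrite Ccons_coord0 /= /I /= !in_itv /= -!ltr_distl.
    by move=> i; have := H (lift ord0 i); rewrite Ccons_coordS mxE.
  move=> [H1 H2] i; case: (unliftP ord0 i) => [j ->|->].
    by rewrite Ccons_coordS; have := H2 j; rewrite mxE.
  by rewrite Ccons_coord0; move: H1; rewrite /I /= !in_itv /= -!ltr_distl.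
rewrite (@product_measure1E _ _ _ _ _ lebesgueC (lebesgueCn n))//; first last.
- exact: measurable_Cbox.
- by apply: measurableX; exact: measurable_itv.
apply: mule_gt0; last exact: IH.
have EB : lebesgueC (I (ReC (z0 ord0 ord0)) `*` I (ImC (z0 ord0 ord0))) =
    leb (I (ReC (z0 ord0 ord0))) * leb (I (ImC (z0 ord0 ord0))).
  by apply: lebesgueC_box; rewrite /I; exact: measurable_itv.
have h (x : R) : (x - e < x + e)%R by lra.
have : 0 < leb (I (ReC (z0 ord0 ord0))) * leb (I (ImC (z0 ord0 ord0))).
  rewrite /I !lebesgue_measure_itv /= !lte_fin !h -!EFinD -EFinM lte_fin.
  by rewrite mulr_gt0// opprD opprK addrACA subrr add0r addr_gt0.
by rewrite -EB.
Qed.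

End measure_of_Cn.

(** * Beta integrals and the weight (1 - x)^(q - 1) on [0, 1[ *)

Section beta_integrals.
Context {R : realType}.
Notation leb := (@lebesgue_measure R).
Implicit Types (q x : R) (f g : R -> R) (M : nat).

(** The range of [sqnorm] on the ball; the weight is unbounded near the excluded endpoint when q <
    1. *)
Definition I01 : set R := `[0, 1[%classic.

Lemma I01P x : I01 x <-> 0 <= x < 1.
Proof. by rewrite /I01 /= in_itv /=. Qed.

(** For primitives whose derivative may blow up at 1: [0, 1[ is exhausted by the intervals
    [0, 1 - 1/(n+2)] and monotone convergence applies, f being nonnegative. *)
Lemma ge0_FTC_left (F f : R -> R) (l : R) :
  (forall x, 0 <= x < 1 -> is_derive x (1 : R) F (f x)) ->
  (forall x, 0 <= x < 1 -> {for x, continuous f}) ->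
  (forall x, 0 <= x < 1 -> 0 <= f x) -> F x @[x --> 1^'-] --> l ->
  (\int[leb]_(x in I01) (f x)%:E = (l - F 0)%:E)%E.
Proof.
move=> dF cf f0 Fl.
pose b n : R := 1 - n.+2%:R^-1.
have b1 n : 0 < b n < 1.
  by rewrite /b subr_gt0 gtrBl invr_gt0 ltr0n andbT invf_lt1// ltr1n.
have fm n : measurable_fun (`[0, b n]%classic : set R) (EFin \o f).
  apply/measurable_EFinP; apply: subspace_continuous_measurable_fun => //.
  apply: continuous_in_subspaceT => x; rewrite inE /= in_itv /= => /andP[x0 xb]; apply: cf.
  by rewrite x0 (le_lt_trans xb)//; case/andP: (b1 n).
have bcvg : b n @[n --> \oo] --> (1 : R).
  have c0 : (n.+2%:R^-1 : R) @[n --> \oo] --> (0 : R).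
    by have := @cvg_harmonic R; rewrite -(cvg_shiftS (@harmonic R)).
  have h : (1 - n.+2%:R^-1 : R) @[n --> \oo] --> (1 - 0 : R) by apply: cvgB; [exact: cvg_cst|exact: c0].
  by rewrite subr0 in h.
have H1 : (\int[leb]_(x in `[0%R, b n]) (f x)%:E)%E @[n --> \oo] --> (\int[leb]_(x in \bigcup_n `[0%R, b n]%classic) (f x)%:E)%E.
  apply: ge0_nondecreasing_set_cvg_integral => //.
  - move=> m n mn; rewrite subsetEset; apply: subset_itvl; rewrite bnd_simp /b lerB//.
    by rewrite lef_pV2 ?posrE// ler_nat.
  - move=> n x /=; rewrite in_itv /= => /andP[x0 xb]; rewrite lee_fin f0// x0 (le_lt_trans xb)//.
    by case/andP: (b1 n).
have U : \bigcup_n `[0%R, b n]%classic = I01.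
  apply/seteqP; split => x.
    move=> [n _] /=; rewrite in_itv /= => /andP[x0 xb]; apply/I01P; rewrite x0 (le_lt_trans xb)//.
    by case/andP: (b1 n).
  move=> /I01P/andP[x0 x1]; exists (Num.truncn (1 - x)^-1) => //=; rewrite in_itv /= x0 /=.
  rewrite /b lerBrDr addrC -lerBrDr.
  rewrite -[leRHS]invrK lef_pV2 ?posrE ?invr_gt0 ?subr_gt0//.
  by apply: ltW; apply: lt_trans (truncnS_gt _) _; rewrite ltr_nat.
rewrite U in H1.
have H2 n : (\int[leb]_(x in `[0%R, b n]) (f x)%:E = (F (b n) - F 0)%:E)%E.
  have /andP[bn0 bn1] := b1 n.
  have dx x : 0 <= x <= b n -> 0 <= x < 1 by move=> /andP[-> xb]; rewrite (le_lt_trans xb).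
  have cF x : 0 <= x <= b n -> {for x, continuous F}.
    by move=> /dx/dF ?; apply/differentiable_continuous/derivable1_diffP.
  rewrite (@continuous_FTC2 R f F)//.
  - apply: continuous_in_subspaceT => x; rewrite inE /= in_itv /= => xb; apply: cf; exact: dx.
  - split.
    + move=> x; rewrite in_itv /= => /andP[x0 xb].
      by have [] : is_derive x (1:R) F (f x) by apply: dF; apply: dx; rewrite !ltW.
    + by apply: cvg_at_right_filter; apply: cF; rewrite lexx ltW.
    + by apply: cvg_at_left_filter; apply: cF; rewrite lexx ltW.
  - move=> x; rewrite in_itv /= => /andP[x0 xb]; rewrite derive1E.
    by have [] : is_derive x (1:R) F (f x) by apply: dF; apply: dx; rewrite !ltW.
have H3 : (F (b n) - F 0)%:E @[n --> \oo] --> (l - F 0)%:E.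
  apply: cvg_EFin; first by near=> n.
  apply: cvgB; last exact: cvg_cst.
  move/cvg_at_leftP : Fl; apply; split => // n.
  by case/andP: (b1 n).
rewrite (funext H2) in H1.
exact: (cvg_unique _ H1 H3).
Unshelve. all: by end_near. Qed.

Definition wt q x : R := (1 - x) `^ (q - 1).

Lemma wt_ge0 q x : 0 <= wt q x.
Proof. exact: powR_ge0. Qed.
Lemma wtS q x : x < 1 -> wt (q + 1) x = (1 - x) * wt q x.
Proof.
move=> x1; rewrite /wt addrK -[X in _ = X * _]powRr1 ?subr_ge0 ?ltW//.
by rewrite -powRD; [congr (_ `^ _); ring|rewrite subr_eq0 (gt_eqF x1) implybT].
Qed.
Lemma measurable_wt q : measurable_fun setT (wt q).
Proof. by apply: (measurableT_comp (measurable_powR _)); exact: measurable_funB. Qed.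

Definition bm f := measurable_fun setT f /\ exists K, forall x, I01 x -> `|f x| <= K.

Lemma bm_cst c : bm (fun=> c).
Proof. by split; [exact: measurable_cst|exists `|c|]. Qed.
Lemma bmD f g : bm f -> bm g -> bm (fun x => f x + g x).
Proof.
move=> [mf [K fK]] [mg [L gL]]; split; first exact: measurable_funD.
by exists (K + L) => x x01; rewrite (le_trans (ler_normD _ _))// lerD ?fK ?gL.
Qed.
Lemma bmM f g : bm f -> bm g -> bm (fun x => f x * g x).
Proof.
move=> [mf [K fK]] [mg [L gL]]; split; first exact: measurable_funM.
by exists (K * L) => x x01; rewrite normrM ler_pM ?fK ?gL.
Qed.
Lemma bmZ c f : bm f -> bm (fun x => c * f x).
Proof. by move=> fb; apply: bmM => //; exact: bm_cst. Qed.
Lemma bmN f : bm f -> bm (fun x => - f x).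
Proof. by move=> fb; have := bmZ (-1) fb; under eq_fun do rewrite mulN1r. Qed.
Lemma bmB f g : bm f -> bm g -> bm (fun x => f x - g x).
Proof. by move=> fb gb; apply: bmD => //; exact: bmN. Qed.
Lemma bm_id : bm id.
Proof.
split; first exact: measurable_id.
by exists 1 => x /I01P/andP[x0 x1]; rewrite ger0_norm// ltW.
Qed.
Lemma bmX f k : bm f -> bm (fun x => f x ^+ k).
Proof.
move=> fb; elim: k => [|k IH]; first exact: bm_cst.
by under eq_fun do rewrite exprS; exact: bmM.
Qed.
Lemma bm_onem : bm (fun x => 1 - x).
Proof. by apply: bmB; [exact: bm_cst|exact: bm_id]. Qed.
Lemma bm_pow M : bm (fun x => x ^+ M).
Proof. by apply: bmX; exact: bm_id. Qed.
Lemma bm_norm f : bm f -> bm (fun x => `|f x|).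
Proof.
move=> [mf [K fK]]; split; first exact: measurableT_comp.
by exists K => x x01; rewrite normr_id fK.
Qed.

Let measurable_I01 : measurable (I01 : set (measurableTypeR R)).
Proof. exact: measurable_itv. Qed.

Let dpow q x : x < 1 -> is_derive x (1 : R) (fun x => (1 - x) `^ q) (- (q * wt q x)).
Proof.
move=> x1.
have d1 : is_derive x (1 : R) (fun x => 1 - x) (-1).
  apply: (@is_derive_eq _ _ _ _ _ _ _ _ (is_deriveB (is_derive_cst (1:R) x (1:R)) (is_derive_id x (1:R)))).
  by rewrite sub0r.
have d2 : is_derive (1 - x) (1 : R) (@powR R ^~ q) (q * (1 - x) `^ (q - 1)).
  by apply: is_derive1_powR; rewrite subr_gt0.
apply: (@is_derive_eq _ _ _ _ _ _ _ _ (@is_derive1_comp _ (@powR R ^~ q) (fun x => 1 - x) x _ _ d2 d1)).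
by rewrite mulrN1.
Qed.

Let cwt q x : x < 1 -> {for x, continuous (wt q)}.
Proof.
by move=> x1; have d := dpow (q - 1) x1; apply/differentiable_continuous/derivable1_diffP; case: d.
Qed.

Let lim_pow q : 0 < q -> (1 - x) `^ q @[x --> 1^'-] --> (0 : R).
Proof.
move=> q0; apply/cvg_at_leftP => u [u1 ul].
have /cvg_at_rightP H := powR_cvg0 q0.
apply: (H (fun n => 1 - u n)); split; first by move=> n; rewrite subr_gt0.
have h : (1 - u n : R) @[n --> \oo] --> (1 - 1 : R) by apply: cvgB; [exact: cvg_cst|exact: ul].
by rewrite subrr in h.
Qed.

Let wt_base q : 0 < q -> (\int[leb]_(x in I01) (wt q x)%:E = (q^-1)%:E)%E.
Proof.
move=> q0.
transitivity ((- q^-1 * 0 - (- q^-1 * (1 - 0) `^ q))%:E).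
  apply: (@ge0_FTC_left (fun x => - q^-1 * (1 - x) `^ q) (wt q) (- q^-1 * 0)).
  - move=> x /andP[_ x1]; apply: (@is_derive_eq _ _ _ _ _ _ _ _ (is_deriveZ (- q^-1) (dpow q x1))).
    by rewrite /GRing.scale /= mulrNN mulrA mulVf ?lt0r_neq0// mul1r.
  - by move=> x /andP[_ x1]; exact: cwt.
  - by move=> x _; exact: wt_ge0.
  - by apply: cvgM; [exact: cvg_cst|exact: lim_pow].
by rewrite subr0 powR1 mulr1 mulr0 sub0r opprK.
Qed.

Let integrable_wt q : 0 < q -> leb.-integrable I01 (EFin \o wt q).
Proof.
move=> q0; apply/integrableP; split.
  by apply/measurable_EFinP; apply: measurable_funTS; exact: measurable_wt.
have -> : (\int[leb]_(x in I01) `|(EFin \o wt q) x| = \int[leb]_(x in I01) (wt q x)%:E)%E.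
  by apply: eq_integral => x _ /=; rewrite ger0_norm// wt_ge0.
by rewrite wt_base// ltry.
Qed.

Definition wint q f : R := Rintegral leb I01 (fun x => f x * wt q x).

Lemma integrable_wint q f : 0 < q -> bm f ->
  leb.-integrable I01 (EFin \o (fun x => f x * wt q x)).
Proof.
move=> q0 [mf [K fK]].
apply: (le_integrable measurable_I01 _ _ (integrableZl measurable_I01 K (integrable_wt q0))).
  by apply/measurable_EFinP; apply: measurable_funTS; apply: measurable_funM => //; exact: measurable_wt.
move=> x x01 /=; rewrite lee_fin !normrM ler_wpM2r//.
by rewrite (le_trans (fK x x01))// ler_norm.
Qed.

Lemma wintE q f : 0 < q -> bm f ->
  (\int[leb]_(x in I01) (f x * wt q x)%:E)%E = (wint q f)%:E.
Proof.
move=> q0 bf; rewrite /wint /Rintegral fineK//.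
exact: (integrable_fin_num measurable_I01 (integrable_wint q0 bf)).
Qed.

Lemma eq_wint q f g : (forall x, I01 x -> f x = g x) -> wint q f = wint q g.
Proof. by move=> fg; apply: eq_Rintegral => x; rewrite inE => x01; rewrite fg. Qed.
Lemma wintD q f g : 0 < q -> bm f -> bm g -> wint q (fun x => f x + g x) = wint q f + wint q g.
Proof.
move=> q0 bf bg; rewrite /wint -RintegralD//; [|exact: integrable_wint|exact: integrable_wint].
by apply: eq_Rintegral => x _; rewrite mulrDl.
Qed.
Lemma wintZ q c f : 0 < q -> bm f -> wint q (fun x => c * f x) = c * wint q f.
Proof.
move=> q0 bf; rewrite /wint -RintegralZl//; last exact: integrable_wint.
by apply: eq_Rintegral => x _; rewrite mulrA.
Qed.
Lemma wintB q f g : 0 < q -> bm f -> bm g -> wint q (fun x => f x - g x) = wint q f - wint q g.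
Proof.
move=> q0 bf bg; rewrite /wint -RintegralB//; [|exact: integrable_wint|exact: integrable_wint].
by apply: eq_Rintegral => x _; rewrite mulrBl.
Qed.
Lemma le_wint q f g : 0 < q -> bm f -> bm g -> (forall x, I01 x -> f x <= g x) -> wint q f <= wint q g.
Proof.
move=> q0 bf bg fg; apply: le_Rintegral => //; [exact: integrable_wint|exact: integrable_wint|].
by move=> x x01; rewrite ler_wpM2r ?wt_ge0 ?fg.
Qed.
Lemma norm_wint_le q f : 0 < q -> bm f -> `|wint q f| <= wint q (fun x => `|f x|).
Proof.
move=> q0 bf; apply: (le_trans (le_normr_Rintegral measurable_I01 (integrable_wint q0 bf))).
rewrite le_eqVlt; apply/orP; left; apply/eqP; apply: eq_Rintegral => x _.
by rewrite normrM (ger0_norm (wt_ge0 _ _)).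
Qed.
Lemma norm_wint_bound q f g : 0 < q -> bm f -> bm g -> (forall x, I01 x -> `|f x| <= g x) -> `|wint q f| <= wint q g.
Proof.
move=> q0 bf bg fg; apply: (le_trans (norm_wint_le q0 bf)).
by apply: le_wint => //; exact: bm_norm.
Qed.
Lemma wint_shift q f : wint (q + 1) f = wint q (fun x => f x * (1 - x)).
Proof. by apply: eq_Rintegral => x; rewrite inE => /I01P/andP[_ x1]; rewrite wtS// mulrA. Qed.

(** The beta function B(M + 1, q). *)
Definition bfun q M := wint q (fun x => x ^+ M).

Lemma bfun0 q : 0 < q -> bfun q 0 = q^-1.
Proof.
move=> q0; rewrite /bfun /wint /Rintegral.
have -> : (\int[leb]_(x in I01) (x ^+ 0 * wt q x)%:E = \int[leb]_(x in I01) (wt q x)%:E)%E.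
  by apply: eq_integral => x _; rewrite expr0 mul1r.
by rewrite wt_base.
Qed.

Let bfun_parts q M : 0 < q -> M.+1%:R * bfun (q + 1) M = q * bfun q M.+1.
Proof.
move=> q0; have q10 : 0 < q + 1 by rewrite ltr_wpDl ?ltW// ltr01.
(* The derivative of (x^(M+1) - 1) (1 - x)^q. Subtracting 1 keeps it nonnegative, as [ge0_FTC_left]
   requires. *)
pose f x := M.+1%:R * x ^+ M * wt (q + 1) x + q * (1 - x ^+ M.+1) * wt q x.
have bf1 : bm (fun x => M.+1%:R * x ^+ M) by apply: bmZ; exact: bm_pow.
have bf2 : bm (fun x => q * (1 - x ^+ M.+1)).
  by apply: bmZ; apply: bmB; [exact: bm_cst|exact: bm_pow].
have E1 : (\int[leb]_(x in I01) (f x)%:E = 1%:E)%E.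
  transitivity ((1 * 0 - 0 - (0 ^+ M.+1 * (1 - 0) `^ q - (1 - 0) `^ q))%:E); last first.
    have -> : (1 - 0 : R) `^ q = 1 by rewrite subr0 powR1.
    by rewrite expr0n /=; congr EFin; ring.
  apply: (@ge0_FTC_left (fun x => x ^+ M.+1 * (1 - x) `^ q - (1 - x) `^ q)).
  - move=> x /andP[_ x1].
    apply: (@is_derive_eq _ _ _ _ _ _ _ _ (is_deriveB (is_deriveM (is_derive_exprS M x) (dpow q x1)) (dpow q x1))).
    by rewrite /f wtS// /wt /GRing.scale /= -(mulr_powRB1 _ q0) ?subr_ge0 ?ltW//; ring.
  - move=> x /andP[_ x1]; apply: continuousD; apply: continuousM; try exact: cwt.
    + by apply: continuousM; [exact: cvg_cst|exact: exprn_continuous].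
    + by apply: continuousM; [exact: cvg_cst|apply: continuousB; [exact: cvg_cst|exact: exprn_continuous]].
  - move=> x /andP[x0 x1]; rewrite addr_ge0// !mulr_ge0 ?wt_ge0 ?exprn_ge0// ?ltW//.
    by rewrite subr_gt0 exprn_ilt1.
  - have cp : x ^+ M.+1 @[x --> 1^'-] --> (1 : R).
      apply: cvg_at_left_filter; have := @exprn_continuous R M.+1 1.
      by rewrite /continuous_at expr1n.
    by apply: cvgB; [apply: cvgM => //|]; exact: lim_pow.
have E2 : (\int[leb]_(x in I01) (f x)%:E = (wint (q + 1) (fun x => M.+1%:R * x ^+ M) + wint q (fun x => q * (1 - x ^+ M.+1)))%:E)%E.
  rewrite EFinD -(wintE q10 bf1) -(wintE q0 bf2) -(integralD measurable_I01 (integrable_wint q10 bf1) (integrable_wint q0 bf2)).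
  by apply: eq_integral => x _; rewrite -EFinD.
have bp := bm_pow M.+1; have bc := bm_cst 1.
move: E1; rewrite E2 => -[]; clear E2 f bf1 bf2.
rewrite (wintZ _ q10 (bm_pow M)) (wintZ _ q0 (bmB bc bp)) (wintB q0 bc bp).
rewrite -/(bfun q M.+1) -/(bfun (q + 1) M).
have -> : wint q (fun=> 1) = q^-1 by rewrite -bfun0//; apply: eq_wint => x _; rewrite expr0.
rewrite mulrBr (divff (lt0r_neq0 q0)).
move: (M.+1%:R * bfun (q + 1) M) (q * bfun q M.+1) => a b E.
have -> : a = (a + (1 - b)) - 1 + b by ring.
by rewrite E subrr add0r.
Qed.

(** The mean of 1 - x under the beta density; with [wint_onem2] it gives the variance for
    Chebyshev's inequality and the orders of magnitude in [appr_step]. *)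
Lemma wint_onem q M : 0 < q -> wint q (fun x => x ^+ M * (1 - x)) = q / (M.+1%:R + q) * bfun q M.
Proof.
move=> q0; have E := bfun_parts M q0; have bp := bm_pow M; have bp' := bm_pow M.+1.
rewrite {1}/bfun wint_shift in E.
have D : wint q (fun x => x ^+ M * (1 - x)) = bfun q M - bfun q M.+1.
  by rewrite -wintB//; apply: eq_wint => x _; rewrite exprS; ring.
have K0 : 0 < M.+1%:R + q by rewrite addr_gt0.
apply: (@mulfI _ (M.+1%:R + q)); first by rewrite lt0r_neq0.
rewrite mulrDl E D mulrA mulrCA divff ?lt0r_neq0// mulr1; ring.
Qed.

Lemma bfunS q M : 0 < q -> bfun q M.+1 = M.+1%:R / (M.+1%:R + q) * bfun q M.
Proof.
move=> q0; have K0 : 0 < M.+1%:R + q by rewrite addr_gt0.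
have -> : bfun q M.+1 = bfun q M - wint q (fun x => x ^+ M * (1 - x)).
  have bp := bm_pow M; have bo : bm (fun x => x ^+ M * (1 - x)) by apply: bmM => //; exact: bm_onem.
  by rewrite -wintB//; apply: eq_wint => x _; rewrite exprS; ring.
rewrite wint_onem//; move: (M.+1%:R) K0 => a K0; field; exact: lt0r_neq0.
Qed.

Lemma bfun_gt0 q M : 0 < q -> 0 < bfun q M.
Proof.
move=> q0; elim: M => [|M IH]; first by rewrite bfun0// invr_gt0.
by rewrite bfunS// mulr_gt0// divr_gt0// addr_gt0.
Qed.

Lemma bfun_succ q M : 0 < q -> bfun (q + 1) M = q / (M.+1%:R + q) * bfun q M.
Proof. by move=> q0; rewrite -(wint_onem _ q0) /bfun wint_shift. Qed.

Lemma wint_onem2 q M : 0 < q -> wint q (fun x => x ^+ M * (1 - x) ^+ 2) =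
  q * (q + 1) / ((M.+1%:R + q) * (M.+2%:R + q)) * bfun q M.
Proof.
move=> q0; have q10 : 0 < q + 1 by rewrite ltr_wpDl ?ltW// ltr01.
have -> : wint q (fun x => x ^+ M * (1 - x) ^+ 2) = wint (q + 1) (fun x => x ^+ M * (1 - x)).
  by rewrite wint_shift; apply: eq_wint => x _; rewrite expr2 mulrA.
rewrite (wint_onem _ q10) (bfun_succ _ q0).
have -> : M.+1%:R + (q + 1) = M.+2%:R + q by rewrite -[in RHS]natr1; ring.
have K0 : 0 < M.+1%:R + q by rewrite addr_gt0.
have K1 : 0 < M.+2%:R + q by rewrite addr_gt0.
by move: (M.+1%:R) (M.+2%:R) K0 K1 => a b K0 K1; field; rewrite !lt0r_neq0.
Qed.

End beta_integrals.

(** * Density of moment sequences among slowly oscillating sequences *)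

Section moment_sequences.
Context {R : realType}.
Notation leb := (@lebesgue_measure R).
Implicit Types (q x h : R) (f g : R -> R) (M p k : nat) (sigma : nat -> R).

Lemma Rintegral_affine (a b : R) f : 0 < a -> leb.-integrable setT (EFin \o f) ->
  Rintegral leb setT f = a * Rintegral leb setT (fun x => f (a * x + b)).
Proof.
move=> a0 fi.
have fin (Z : \bar R) : (a%:E * Z)%E \is a fin_num -> Z \is a fin_num.
  case: Z => [r| |]; first by [].
    by rewrite gt0_muley ?lte_fin.
  by rewrite gt0_muleNy ?lte_fin.
have mf := measurable_int _ fi.
have fp := integrable_pos_fin_num measurableT fi; have fn := integrable_neg_fin_num measurableT fi.
rewrite /Rintegral.
have Ep : (\int[leb]_x (EFin \o f)^\+ x = a%:E * \int[leb]_x ((EFin \o (fun x => f (a * x + b)%R))^\+ x))%E.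
  have m1 : measurable_fun [set: R] ((EFin \o f)^\+)%E by exact: measurable_funepos.
  rewrite (ge0_integral_affine b a0 m1 (fun x => funepos_ge0 _ x)).
  have -> : ((EFin \o (fun x => f (a * x + b)%R))^\+ = (fun x => (EFin \o f)^\+ (a * x + b)%R))%E.
    by apply/funext => x; rewrite !funeposE.
  by [].
have En : (\int[leb]_x (EFin \o f)^\- x = a%:E * \int[leb]_x ((EFin \o (fun x => f (a * x + b)%R))^\- x))%E.
  have m1 : measurable_fun [set: R] ((EFin \o f)^\-)%E by exact: measurable_funeneg.
  rewrite (ge0_integral_affine b a0 m1 (fun x => funeneg_ge0 _ x)).
  have -> : ((EFin \o (fun x => f (a * x + b)%R))^\- = (fun x => (EFin \o f)^\- (a * x + b)%R))%E.
    by apply/funext => x; rewrite !funenegE.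
  by [].
have a0' : a%:E != 0%E by rewrite eqe lt0r_neq0.
rewrite integralE [in RHS]integralE Ep En.
move: fp fn; rewrite Ep En.
set X := (\int[leb]_x _)%E; set Y := (\int[leb]_x _)%E.
move=> /fin/fineK <- /fin/fineK <-.
by rewrite -!EFinM -!EFinB /= mulrBr.
Qed.

Lemma wint_setT q f : wint q f = Rintegral leb setT ((fun x => f x * wt q x) \_ I01).
Proof. exact: Rintegral_mkcond. Qed.

Lemma bm_comp_affine g (t : R) : 0 < t -> t <= 1 -> bm g -> bm (fun x => g (t * x + (1 - t))).
Proof.
move=> t0 t1 [mg [K gK]]; split.
  by apply: (measurableT_comp mg); apply: measurable_funD => //; exact: measurable_funM.
exists K => x /I01P/andP[x0 x1]; apply: gK; apply/I01P.
by apply/andP; split; nra.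
Qed.

Lemma bm_max0 f : bm f -> bm (fun x => Num.max 0 (f x)).
Proof.
move=> [mf [K fK]]; split; first exact: measurable_maxr.
exists K => x /fK; rewrite /Num.max; case: ifP => //.
by rewrite normr0 => _ /(le_trans (normr_ge0 _)).
Qed.

(** The substitution x -> 1 - t (1 - x) scales 1 - x by t, so weight and differential together give
    t^q. The image is [1 - t, 1[, and the positive part vanishes on the rest of [0, 1[; the power
    [M.+1] is positive because 0^0 = 1. *)
Lemma wint_affine q g (t : R) M : 0 < q -> 0 < t -> t <= 1 -> bm g ->
  wint q (fun x => t `^ q * g (t * x + (1 - t)) * x ^+ M.+1) =
  wint q (fun x => g x * Num.max 0 (1 - (1 - x) / t) ^+ M.+1).
Proof.
move=> q0 t0 t1 bg; rewrite !wint_setT.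
have bP : bm (fun x => g x * Num.max 0 (1 - (1 - x) / t) ^+ M.+1).
  apply: bmM => //; apply: bmX; apply: bm_max0; apply: bmB; first exact: bm_cst.
  by apply: bmM; [exact: bm_onem|exact: bm_cst].
rewrite [RHS](Rintegral_affine (1 - t) t0); last first.
  have := integrable_wint q0 bP.
  rewrite (integrable_mkcond _ (measurable_itv _ : measurable (I01 : set (measurableTypeR R)))).
  by rewrite restrict_EFin.
have b1 : bm (fun x => t `^ q * g (t * x + (1 - t)) * x ^+ M.+1).
  by apply: bmM; [apply: bmZ; exact: bm_comp_affine|exact: bm_pow].
have i1 : leb.-integrable setT (EFin \o ((fun x => t `^ q * g (t * x + (1 - t)) * x ^+ M.+1 * wt q x) \_ I01)).
  have := integrable_wint q0 b1.
  rewrite (integrable_mkcond _ (measurable_itv _ : measurable (I01 : set (measurableTypeR R)))).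
  by rewrite restrict_EFin.
have E r : ((fun x => g x * Num.max 0 (1 - (1 - x) / t) ^+ M.+1 * wt q x) \_ I01) (t * r + (1 - t)) =
    t^-1 * ((fun x => t `^ q * g (t * x + (1 - t)) * x ^+ M.+1 * wt q x) \_ I01) r.
  have tn := lt0r_neq0 t0.
  have xr : 1 - (1 - (t * r + (1 - t))) / t = r by field.
  rewrite !patchE !mem_setE !in_itv /= xr.
  have [r0|r0] := leP 0 r; last first.
    by rewrite mulr0; case: ifP => // _; rewrite expr0n /= mulr0 mul0r.
  have -> : t * r + (1 - t) < 1 = (r < 1).
    by rewrite -subr_gt0 (_ : 1 - _ = t * (1 - r)); [rewrite pmulr_rgt0// subr_gt0|ring].
  have -> : 0 <= t * r + (1 - t) by nra.
  rewrite /=; case: ltP => r1; last by rewrite mulr0.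
  have -> : wt q (t * r + (1 - t)) = t `^ (q - 1) * wt q r.
    rewrite /wt (_ : 1 - (t * r + (1 - t)) = t * (1 - r)); last by ring.
    by rewrite powRM ?(ltW t0)// subr_ge0 ltW.
  by rewrite -(mulr_powRB1 (ltW t0) q0); field.
set F := (fun x => t `^ q * _ * _ * _) \_ I01 in i1 E *.
transitivity (t * Rintegral leb setT (fun r => t^-1 * F r)).
  by rewrite (RintegralZl _ measurableT i1) mulVKf ?lt0r_neq0.
by congr (t * _); apply: eq_Rintegral => r _; rewrite E.
Qed.

(** The remainder at the next degree is x times the previous one plus (x - y) (x^(M+2) - y^(M+2)),
    and the last difference is at most (M+2) x^(M+1) (x - y) by the left inequality already
    known. *)
Lemma pow_taylor_le M (x y : R) : 0 <= y -> y <= x ->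
  0 <= M.+2%:R * x ^+ M.+1 * (x - y) - x ^+ M.+2 + y ^+ M.+2 <= M.+2%:R ^+ 2 * x ^+ M * (x - y) ^+ 2.
Proof.
move=> y0 yx; have x0 : 0 <= x by exact: le_trans yx.
have d0 : 0 <= x - y by rewrite subr_ge0.
elim: M => [|M /andP[IH1 IH2]].
  have -> : 2 * x ^+ 1 * (x - y) - x ^+ 2 + y ^+ 2 = (x - y) ^+ 2 by ring.
  by rewrite sqr_ge0 /= expr0 mulr1; have := sqr_ge0 (x - y); lra.
have E : M.+3%:R * x ^+ M.+2 * (x - y) - x ^+ M.+3 + y ^+ M.+3 =
  x * (M.+2%:R * x ^+ M.+1 * (x - y) - x ^+ M.+2 + y ^+ M.+2) + (x - y) * (x ^+ M.+2 - y ^+ M.+2).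
  rewrite -[M.+3%:R]natr1 !exprS; ring.
rewrite E; have xy : 0 <= x ^+ M.+2 - y ^+ M.+2.
  by rewrite subr_ge0 lerXn2r ?nnegrE.
rewrite addr_ge0 ?mulr_ge0//=.
apply: (@le_trans _ _ (x * (M.+2%:R ^+ 2 * x ^+ M * (x - y) ^+ 2) + (x - y) * (M.+2%:R * x ^+ M.+1 * (x - y)))).
  by apply: lerD; apply: ler_wpM2l => //; lra.
have -> : x * (M.+2%:R ^+ 2 * x ^+ M * (x - y) ^+ 2) + (x - y) * (M.+2%:R * x ^+ M.+1 * (x - y)) =
   (M.+2%:R ^+ 2 + M.+2%:R) * (x ^+ M.+1 * (x - y) ^+ 2) by rewrite !exprS; ring.
rewrite -mulrA ler_wpM2r ?mulr_ge0 ?exprn_ge0//.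
rewrite -[M.+3%:R]natr1; have : 0 <= M.+2%:R :> R by []. 
move: (M.+2%:R) => a a0; nra.
Qed.

(** Where the positive part is cut off, x <= d and the two remaining terms are themselves bounded by
    multiples of x^M d^2. *)
Lemma pow_max_taylor M (x d : R) : 0 <= x -> 0 <= d ->
  `|x ^+ M.+2 - Num.max 0 (x - d) ^+ M.+2 - M.+2%:R * x ^+ M.+1 * d| <= M.+2%:R ^+ 2 * x ^+ M * d ^+ 2.
Proof.
move=> x0 d0; have [xd|dx] := leP 0 (x - d).
  have := @pow_taylor_le M x (x - d) xd ltac:(lra).
  rewrite opprB addrCA subrr addr0 => /andP[h1 h2].
  rewrite distrC ger0_norm; first by apply: le_trans h2; lra.
  by lra.
have dx' : x <= d by lra.
rewrite expr0n /= subr0.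
have h1 : x ^+ M.+2 <= x ^+ M * d ^+ 2.
  by rewrite -addn2 exprD ler_wpM2l ?exprn_ge0// lerXn2r ?nnegrE.
have h2 : x ^+ M.+1 * d <= x ^+ M * d ^+ 2.
  rewrite expr2 exprSr -mulrA ler_wpM2l ?exprn_ge0// ler_wpM2r//.
have a1 : 1 <= M.+2%:R :> R by rewrite ler1n.
have p0 : 0 <= x ^+ M.+2 by rewrite exprn_ge0.
have p1 : 0 <= x ^+ M.+1 * d by rewrite mulr_ge0// exprn_ge0.
have p2 : 0 <= x ^+ M * d ^+ 2 by rewrite mulr_ge0// exprn_ge0.
rewrite -!mulrA; move: (M.+2%:R) a1 => a a1.
have a2 : a <= a ^+ 2 by nra.
rewrite ler_norml; apply/andP; split; nra.
Qed.

(* The moments of [g] against the probability density proportional to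
   [x ^+ (k + p) * (1 - x) `^ (q - 1)] on [0, 1]. *)
Definition gam q p g k : R := wint q (fun x => g x * x ^+ (k + p)) / bfun q (k + p).

Lemma gamD q p g1 g2 k : 0 < q -> bm g1 -> bm g2 ->
  gam q p (fun x => g1 x + g2 x) k = gam q p g1 k + gam q p g2 k.
Proof.
move=> q0 b1 b2; have bp : bm (fun x : R => x ^+ (k + p)) := bm_pow _.
rewrite /gam -mulrDl -(wintD q0 (bmM b1 bp) (bmM b2 bp)); congr (_ / _).
by apply: eq_wint => x _; rewrite mulrDl.
Qed.

Lemma gamZ q p c g k : 0 < q -> bm g -> gam q p (fun x => c * g x) k = c * gam q p g k.
Proof.
move=> q0 b1; have bp : bm (fun x : R => x ^+ (k + p)) := bm_pow _.
rewrite /gam mulrA -(wintZ c q0 (bmM b1 bp)); congr (_ / _).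
by apply: eq_wint => x _; rewrite mulrA.
Qed.

Lemma gam_cst q p c k : 0 < q -> gam q p (fun=> c) k = c.
Proof.
move=> q0; rewrite /gam (wintZ c q0 (bm_pow _)) -/(bfun q (k + p)) mulfK//.
by rewrite lt0r_neq0 ?bfun_gt0.
Qed.

Lemma le_gam q p g1 g2 k : 0 < q -> bm g1 -> bm g2 -> (forall x, I01 x -> g1 x <= g2 x) ->
  gam q p g1 k <= gam q p g2 k.
Proof.
move=> q0 b1 b2 g12; have bp : bm (fun x : R => x ^+ (k + p)) := bm_pow _.
rewrite /gam ler_wpM2r ?invr_ge0 ?(ltW (bfun_gt0 _ q0))//.
apply: (le_wint q0 (bmM b1 bp) (bmM b2 bp)) => x x01.
by rewrite ler_wpM2r ?g12//; move/I01P : x01 => /andP[x0 _]; rewrite exprn_ge0.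
Qed.

Lemma norm_gam_le q p g1 g2 k : 0 < q -> bm g1 -> bm g2 -> (forall x, I01 x -> `|g1 x| <= g2 x) ->
  `|gam q p g1 k| <= gam q p g2 k.
Proof.
move=> q0 b1 b2 g12; rewrite ler_norml; apply/andP; split.
  rewrite -mulN1r -gamZ//; apply: le_gam => //; first exact: bmZ.
  by move=> x /g12; rewrite mulN1r ler_norml => /andP[].
by apply: le_gam => // x /g12; rewrite ler_norml => /andP[].
Qed.

(** Only large k are controlled: the rounding and shifts in [appr_chebyshev] and the 1/k error in
    [appr_step] are small only there. *)
Definition appr q p sigma (eps : R) := exists g, bm g /\
  exists N, forall k, (N <= k)%N -> `|gam q p g k - sigma k| <= eps.

Definition real_SO sigma := (exists K, forall k, `|sigma k| <= K) /\
  forall eps, 0 < eps -> exists2 delta : R, 0 < delta & forall r s : nat,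
    `|r.+1%:R / s.+1%:R - 1| < delta -> `|sigma r - sigma s| < eps.

Lemma measurable_truncn (s : nat -> R) : measurable_fun setT (fun x : R => s (Num.truncn x)).
Proof.
move=> _ Y mY; rewrite setTI.
have -> : (fun x : R => s (Num.truncn x)) @^-1` Y = \bigcup_(j in [set j | Y (s j)]) [set x : R | Num.truncn x = j].
  by apply/seteqP; split => [x Yx|x [j /= Yj xj]]; [exists (Num.truncn x)|rewrite xj].
apply: bigcup_measurable => -[|j] _.
  have -> : [set x : R | Num.truncn x = 0%N] = `]-oo, 1[%classic.
    apply/seteqP; split => x /=; rewrite in_itv /=.
      by move=> x0; have := truncnS_gt x; rewrite x0.
    by move=> x1; apply/eqP; rewrite -leqn0 truncn_le_nat.
  exact: measurable_itv.
have -> : [set x : R | Num.truncn x = j.+1] = `[j.+1%:R, j.+2%:R[%classic.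
  apply/seteqP; split => x /=; rewrite in_itv /=.
    by move=> xj; rewrite -truncn_gt_nat -truncn_le_nat xj !leqnn.
  by move=> H; apply: truncn_def.
exact: measurable_itv.
Qed.

(* For large [Q] the density concentrates where [Q / (1 - x)] is close to [k]:
   read [sigma] off there and bound the error by Chebyshev's inequality. *)
Lemma appr_chebyshev sigma eps : real_SO sigma -> 0 < eps ->
  exists2 Q0, 0 < Q0 & forall Q p, Q0 <= Q -> appr Q p sigma eps.
Proof.
move=> [[K sK] sSO] e0.
have K0 : 0 <= K by apply: le_trans (sK 0%N).
have [d0' d0'0 Hd'] := sSO (eps / 2) ltac:(by rewrite divr_gt0).
have [d0 [d00 d01 Hd]] : exists d0 : R, [/\ 0 < d0, d0 <= 1 & forall r s : nat,
    `|r.+1%:R / s.+1%:R - 1| < d0 -> `|sigma r - sigma s| < eps / 2].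
  exists (Num.min d0' 1); split; [by rewrite lt_min d0'0 ltr01|by rewrite ge_min lexx orbT|].
  by move=> r s; rewrite lt_min => /andP[/Hd'].
pose d := d0 / 4.
have dp : 0 < d by rewrite divr_gt0.
(* From here on Chebyshev's bound 2 K / (d^2 Q) is at most eps / 2. *)
exists (4 * (K + 1) / (d ^+ 2 * eps)).
  by rewrite divr_gt0 ?mulr_gt0 ?exprn_gt0// ltr_wpDl.
move=> Q p QQ; have Q0 : 0 < Q.
  by apply: lt_le_trans QQ; rewrite divr_gt0 ?mulr_gt0 ?exprn_gt0// ltr_wpDl.
(* [wt 0 x] is 1 / (1 - x). *)
pose g x := sigma (Num.truncn (Q * wt 0 x)).
have bg : bm g.
  split; last by exists K => x _; exact: sK.
  have -> : g = (fun y => sigma (Num.truncn y)) \o (fun x => Q * wt 0 x) by [].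
  apply: measurableT_comp; first exact: measurable_truncn.
  by apply: measurable_funM => //; exact: measurable_wt.
exists g; split => //.
(* For larger k the shift p + Q, enlarged by 3/2, and the rounding error 1 together stay below half
   of the tolerance [d0 * k.+1]. *)
exists (Num.truncn (2 / d0 * (3 / 2 * (p%:R + Q) + 1))) => k kN.
have kb : 2 / d0 * (3 / 2 * (p%:R + Q) + 1) < k.+1%:R.
  by apply: lt_le_trans (truncnS_gt _) _; rewrite ler_nat ltnS.
set N : R := (k + p).+1%:R; have N0 : 0 < N by [].
have NQ : 0 < N + Q by rewrite addr_gt0.
(* The relative deviation of 1 - x from its mean Q / (N + Q). *)
pose Y x := (1 - x) * ((N + Q) / Q) - 1.
have bY : bm Y by apply: bmB; [apply: bmM; [exact: bm_onem|exact: bm_cst]|exact: bm_cst].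
pose c := 2 * K / d ^+ 2.
have c0 : 0 <= c by rewrite divr_ge0 ?mulr_ge0 ?exprn_ge0// ltW.
have pt x : I01 x -> `|g x - sigma k| <= eps / 2 + c * Y x ^+ 2.
  move=> /I01P/andP[x0 x1].
  have [Yd|dY] := ltP (`|Y x|) d; last first.
    apply: (@le_trans _ _ (2 * K)).
      apply: (le_trans (ler_normB _ _)); rewrite mulr_natl mulr2n.
      by apply: lerD; exact: sK.
    apply: (@le_trans _ _ (c * Y x ^+ 2)); last by rewrite lerDr divr_ge0// ltW.
    rewrite /c mulrAC ler_pdivlMr ?exprn_gt0// ler_wpM2l ?mulr_ge0//.
    by rewrite -[leRHS]real_normK ?num_real// lerXn2r ?nnegrE// ltW.
  apply: (@le_trans _ _ (eps / 2)); last by rewrite lerDl mulr_ge0// sqr_ge0.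
  apply/ltW; apply: Hd; rewrite /g /wt sub0r powR_inv1 ?subr_ge0 ?(ltW x1)//.
  set z := Q / (1 - x); set j := Num.truncn z.
  have z0 : 0 < z by rewrite divr_gt0// subr_gt0.
  have /andP[jz zj] : j%:R <= z < j.+1%:R by apply: truncn_itv; exact: ltW.
  set s : R := k.+1%:R in kb *; have s0 : 0 < s by [].
  have Ns : N = s + p%:R by rewrite /N /s -natrD addSn.
  pose y := Y x + 1.
  have zy : z * y = N + Q by rewrite /z /y /Y; field; rewrite lt0r_neq0//= subr_eq0 gt_eqF.
  have yd : 1 - d < y < 1 + d by move: Yd; rewrite ltr_norml /y => /andP[]; lra.
  have d4 : d * 4 = d0 by rewrite /d divfK.
  have kb' : 3 / 2 * (p%:R + Q) + 1 < d0 * s / 2.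
    by rewrite mulrAC ltr_pdivrMr// mulrC in kb; lra.
  have js : j.+1%:R = j%:R + 1 :> R by rewrite natr1.
  have pq : 0 < p%:R + Q by rewrite ltr_wpDl.
  have y0 : 0 < y by case/andP: yd; lra.
  have zlo : s * (1 - d0) < z.
    rewrite -(ltr_pM2r y0) zy Ns; case/andP: yd => _ y1.
    have h1 : (1 - d0) * y <= 1.
      apply: (@le_trans _ _ ((1 - d0) * (1 + d))); first by rewrite ler_wpM2l// ?subr_ge0// ltW.
      nra.
    have : s * ((1 - d0) * y) <= s * 1 by rewrite ler_wpM2l// ltW.
    lra.
  have zhi : z < s * (1 + d0) - 1.
    rewrite -(ltr_pM2r y0) zy Ns; case/andP: yd => y1 _.
    have h2 : 1 + d0 / 2 <= (1 + d0) * (1 - d) by nra.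
    have h3 : s * (1 + d0 / 2) <= s * ((1 + d0) * (1 - d)) by rewrite ler_wpM2l// ltW.
    have h4 : 0 < s * (1 + d0) - 1 by nra.
    have : (s * (1 + d0) - 1) * (1 - d) < (s * (1 + d0) - 1) * y by rewrite ltr_pM2l.
    lra.
  rewrite ltr_norml; apply/andP; split.
    rewrite ltrBDr ltr_pdivlMr// mulrC; lra.
  rewrite ltrBlDr ltr_pdivrMr// mulrC; lra.
have bY2 : bm (fun x => Y x ^+ 2) by exact: bmX.
(* The variance is N / ((N + 1 + Q) Q), which tends to 1 / Q and not to 0 as k grows. *)
have EY : gam Q p (fun x => Y x ^+ 2) k <= Q^-1.
  pose a := (N + Q) / Q.
  have b1 : bm (fun x : R => 1 - x) := bm_onem.
  have b2 : bm (fun x : R => (1 - x) ^+ 2) := bmX 2 b1.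
  have -> : gam Q p (fun x => Y x ^+ 2) k = gam Q p (fun x => a ^+ 2 * (1 - x) ^+ 2 + ((- (2 * a)) * (1 - x) + 1)) k.
    by congr (_ / _); apply: eq_wint => x _; rewrite /Y -/a; ring.
  rewrite (gamD _ _ Q0 (bmZ _ b2) (bmD (bmZ _ b1) (bm_cst _))) (gamD _ _ Q0 (bmZ _ b1) (bm_cst _)).
  rewrite !(gamZ _ _ _ Q0)// gam_cst//.
  have bN0 : bfun Q (k + p) != 0 by rewrite lt0r_neq0 ?bfun_gt0.
  have -> : gam Q p (fun x => 1 - x) k = Q / (N + Q).
    rewrite /gam (@eq_wint _ _ _ (fun x => x ^+ (k + p) * (1 - x))); last by move=> x _; rewrite mulrC.
    by rewrite (wint_onem _ Q0) mulfK.
  have -> : gam Q p (fun x => (1 - x) ^+ 2) k = Q * (Q + 1) / ((N + Q) * (N + 1 + Q)).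
    rewrite /gam (@eq_wint _ _ _ (fun x => x ^+ (k + p) * (1 - x) ^+ 2)); last by move=> x _; rewrite mulrC.
    by rewrite (wint_onem2 _ Q0) mulfK// /N natr1.
  have N10 : 0 < N + 1 + Q by rewrite addr_gt0// addr_gt0.
  have -> : a ^+ 2 * (Q * (Q + 1) / ((N + Q) * (N + 1 + Q))) + (- (2 * a) * (Q / (N + Q)) + 1) = N / (N + 1 + Q) * Q^-1.
    by rewrite /a; move: (N) N0 NQ N10 => n0 ? ? ?; field; rewrite !lt0r_neq0.
  rewrite ler_piMl ?invr_ge0 ?(ltW Q0)// ler_pdivrMr// mul1r; lra.
have -> : gam Q p g k - sigma k = gam Q p (fun x => g x + - sigma k) k.
  by rewrite (gamD _ _ Q0 bg (bm_cst _)) gam_cst.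
have b1 : bm (fun x => g x - sigma k) := bmD bg (bm_cst (- sigma k)).
have b2 : bm (fun x => eps / 2 + c * Y x ^+ 2) := bmD (bm_cst (eps / 2)) (bmZ c bY2).
apply: (le_trans (norm_gam_le p k Q0 b1 b2 pt)).
rewrite (gamD _ _ Q0 (bm_cst _) (bmZ c bY2)) gam_cst// (gamZ _ _ _ Q0 bY2).
rewrite [leRHS](splitr eps) lerD2l.
apply: (@le_trans _ _ (c * Q^-1)); first by rewrite ler_wpM2l.
rewrite ler_pdivrMr// -ler_pdivrMl; last by rewrite divr_gt0.
apply: le_trans QQ; rewrite /c.
have -> : (eps / 2)^-1 * (2 * K / d ^+ 2) = 4 * K / (d ^+ 2 * eps) by field; rewrite !lt0r_neq0.
apply: ler_wpM2r; last by apply: ler_wpM2l => //; rewrite lerDl.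
by rewrite invr_ge0; apply: mulr_ge0; [exact: sqr_ge0|exact: ltW].
Qed.

(** The Taylor error in [appr_step]: the factor n^2 h^2 meets a second moment of order n^(-2), so
    division by q h leaves O(h), uniformly in n. *)
Let appr_step_tail1 q h n K B w eta : 0 < q -> 0 < h -> 2 <= n -> 0 < K -> 0 < B ->
  h * (2 * (2 * K * (q + 1))) = eta ->
  w <= K * (n ^+ 2 * h ^+ 2) * (q * (q + 1) / ((n - 1) * n) * B) ->
  (q * h)^-1 * w <= eta / 2 * B.
Proof.
move=> q0 h0 n2 K0 B0 hE c1.
have n0 : 0 < n by lra.
have n1 : 0 < n - 1 by lra.
apply: (@le_trans _ _ ((q * h)^-1 * (K * (n ^+ 2 * h ^+ 2) * (q * (q + 1) / ((n - 1) * n) * B)))).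
  by apply: ler_wpM2l c1; rewrite invr_ge0 mulr_ge0// ltW.
have -> : (q * h)^-1 * (K * (n ^+ 2 * h ^+ 2) * (q * (q + 1) / ((n - 1) * n) * B)) = (K * (q + 1) * h) * (n / (n - 1)) * B.
  by field; rewrite !lt0r_neq0.
apply: (ler_wpM2r (ltW B0)).
apply: (@le_trans _ _ (K * (q + 1) * h * 2)); last by rewrite -hE; lra.
apply: ler_wpM2l; first by rewrite !mulr_ge0 ?addr_ge0// ltW.
by rewrite ler_pdivrMr//; lra.
Qed.

(** The normalisation error in [appr_step]: of order 1/n, hence small for large indices. *)
Let appr_step_tail2 q n K B w eta : 0 < q -> 0 < n -> 0 < eta -> 0 < K -> 0 < B ->
  2 * (2 * K * (q + 1)) / eta < n + 1 + q ->
  w <= K * (2 * q * (q + 1) / (n + 1 + q) * B) -> q^-1 * w <= eta / 2 * B.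
Proof.
move=> q0 n0 eta0 K0 B0 kn c2.
have nq0 : 0 < n + 1 + q by lra.
apply: (@le_trans _ _ (q^-1 * (K * (2 * q * (q + 1) / (n + 1 + q) * B)))).
  by apply: ler_wpM2l c2; rewrite invr_ge0 ltW.
have -> : q^-1 * (K * (2 * q * (q + 1) / (n + 1 + q) * B)) = 2 * K * (q + 1) / (n + 1 + q) * B.
  by field; rewrite !lt0r_neq0.
apply: (ler_wpM2r (ltW B0)); rewrite ler_pdivrMr//.
by move: kn; rewrite ltr_pdivrMr//; lra.
Qed.

(* The symbol [b] below is a difference quotient of [g] under dilations of
   [1 - x]; its moments for [q] are, up to [eta], those of [g] for [q + 1]. *)
Lemma appr_step q p sigma eps eta : 0 < q -> 0 < eta -> appr (q + 1) p sigma eps -> appr q p sigma (eps + eta).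
Proof.
move=> q0 eta0 [g [bg [N0 HN0]]]; have [mg [K' gK']] := bg.
have [K [K0 gK]] : exists K : R, 0 < K /\ forall x, I01 x -> `|g x| <= K.
  exists (`|K'| + 1); split; first by rewrite ltr_wpDl.
  by move=> x /gK' /le_trans; apply; rewrite (le_trans (ler_norm _))// lerDl.
have q10 : 0 < q + 1 by rewrite addr_gt0.
pose L := 2 * K * (q + 1); have L0 : 0 < L by rewrite !mulr_gt0.
(* This h makes the Taylor error bound [K * (q + 1) * h * 2] equal to eta / 2. *)
have [h [h0 hE]] : exists h : R, 0 < h /\ h * (2 * L) = eta.
  by exists (eta / (2 * L)); rewrite divr_gt0 ?divfK ?lt0r_neq0// mulr_gt0.
(* With this t the inverse dilation 1 - (1 - x) / t is x - h (1 - x), a displacement linear in h. *)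
pose t := (1 + h)^-1.
have h10 : 0 < 1 + h by rewrite addr_gt0.
have t0 : 0 < t by rewrite invr_gt0.
have t1 : t <= 1 by rewrite invf_le1// lerDl ltW.
pose b x := (q * h)^-1 * (g x - t `^ q * g (t * x + (1 - t))).
have bgt : bm (fun x => t `^ q * g (t * x + (1 - t))) by apply: bmZ; exact: bm_comp_affine.
have bb : bm b by apply: bmZ; exact: bmB.
(* The [.+2] makes the power k + p at least 2, as [pow_max_taylor] needs. *)
exists b; split => //; exists (maxn N0 (Num.truncn (2 * L / eta)).+2) => k; rewrite geq_max => /andP[kN0 kN].
have [M kM] : exists M, (k + p = M.+2)%N.
  by exists (k + p).-2; move: kN; case: (k) => [|[|k']].
have split3 (x1 x2 x3 : R) : x1 - x3 = (x2 - x3) + (x1 - x2) by ring.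
rewrite (split3 _ (gam (q + 1) p g k)).
apply: (le_trans (ler_normD _ _)); apply: lerD; first exact: HN0.
set n : R := M.+2%:R; have n0 : 0 < n by [].
have nq0 : 0 < n + 1 + q by rewrite !addr_gt0.
pose B := bfun q M.+2; have B0 : 0 < B by exact: bfun_gt0.
have BE : bfun (q + 1) M.+2 = q / (n + 1 + q) * B by rewrite bfun_succ// natr1.
pose y x := Num.max 0 (1 - (1 - x) / t).
have yE x : y x = Num.max 0 (x - h * (1 - x)).
  by rewrite /y /t invrK; congr Num.max; ring.
have bid : bm (fun x : R => x) := bm_id.
have bom : bm (fun x : R => 1 - x) := bm_onem.
have by_ : bm y.
  by apply: bm_max0; apply: bmB; [exact: bm_cst|apply: bmM => //; exact: bm_cst].
have bX m : bm (fun x : R => x ^+ m) := bm_pow m.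
have bY m : bm (fun x => y x ^+ m) := bmX m by_.
pose e x := x ^+ M.+2 - y x ^+ M.+2 - n * x ^+ M.+1 * (h * (1 - x)).
have be : bm e.
  apply: bmB; first by apply: bmB.
  by apply: bmM; [exact: bmZ|exact: bmZ].
(* The first term comes from the difference quotient, the second is what the normalisation by
   [bfun (q + 1) M.+2] asks for; both are to be multiplied by 1 - x. *)
pose u x := n * x ^+ M.+1 - (n + 1 + q) * x ^+ M.+2.
have bu : bm u by apply: bmB; exact: bmZ.
have Eb : wint q (fun x => b x * x ^+ M.+2) =
    (q * h)^-1 * wint q (fun x => g x * e x) + q^-1 * wint q (fun x => g x * (n * x ^+ M.+1 * (1 - x))).
  have b1 : bm (fun x => g x * x ^+ M.+2) by exact: bmM.
  have b2 : bm (fun x => g x * y x ^+ M.+2) by exact: bmM.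
  have b3 : bm (fun x => t `^ q * g (t * x + (1 - t)) * x ^+ M.+2) by exact: bmM.
  have b4 : bm (fun x => g x * e x) by exact: bmM.
  have b5 : bm (fun x => g x * (n * x ^+ M.+1 * (1 - x))).
    exact: (bmM bg (bmM (bmZ n (bX M.+1)) bom)).
  transitivity ((q * h)^-1 * (wint q (fun x => g x * x ^+ M.+2) - wint q (fun x => g x * y x ^+ M.+2))).
    rewrite -(wint_affine M.+1 q0 t0 t1 bg) -(wintB q0 b1 b3) -(wintZ _ q0 (bmB b1 b3)).
    by apply: eq_wint => x _; rewrite /b; ring.
  rewrite -(wintB q0 b1 b2).
  have -> : wint q (fun x => g x * x ^+ M.+2 - g x * y x ^+ M.+2) = wint q (fun x => g x * e x + h * (g x * (n * x ^+ M.+1 * (1 - x)))).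
    by apply: eq_wint => x _; rewrite /e; ring.
  rewrite (wintD q0 b4 (bmZ h b5)) (wintZ h q0 b5).
  by field; rewrite !lt0r_neq0.
have Eg : wint (q + 1) (fun x => g x * x ^+ M.+2) = wint q (fun x => g x * (x ^+ M.+2 * (1 - x))).
  by rewrite wint_shift; apply: eq_wint => x _; rewrite mulrA.
have Ediff : gam q p b k - gam (q + 1) p g k = B^-1 * ((q * h)^-1 * wint q (fun x => g x * e x) + q^-1 * wint q (fun x => g x * (u x * (1 - x)))).
  have b5 : bm (fun x => g x * (n * x ^+ M.+1 * (1 - x))).
    exact: (bmM bg (bmM (bmZ n (bX M.+1)) bom)).
  have b6 : bm (fun x => g x * (x ^+ M.+2 * (1 - x))).
    exact: (bmM bg (bmM (bX M.+2) bom)).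
  have -> : wint q (fun x => g x * (u x * (1 - x))) = wint q (fun x => g x * (n * x ^+ M.+1 * (1 - x))) - (n + 1 + q) * wint q (fun x => g x * (x ^+ M.+2 * (1 - x))).
    rewrite -(wintZ _ q0 b6) -(wintB q0 b5 (bmZ _ b6)).
    by apply: eq_wint => x _; rewrite /u; ring.
  rewrite /gam kM Eb Eg BE -/B; move: (wint _ _) (wint _ _) (wint _ _) => w1 w2 w3.
  move: (n + 1 + q) nq0 => a a0; by field; rewrite !lt0r_neq0.
have c1 : `|wint q (fun x => g x * e x)| <= K * (n ^+ 2 * h ^+ 2) * (q * (q + 1) / ((n - 1) * n) * B).
  have b1 : bm (fun x : R => x ^+ M * (1 - x) ^+ 2) := bmM (bX M) (bmX 2 bom).
  apply: (@le_trans _ _ (wint q (fun x => K * (n ^+ 2 * h ^+ 2) * (x ^+ M * (1 - x) ^+ 2)))).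
    apply: (norm_wint_bound q0 (bmM bg be) (bmZ _ b1)) => x x01; move/I01P : (x01) => /andP[x0 x1].
    rewrite normrM -mulrA; apply: (ler_pM (normr_ge0 _) (normr_ge0 _) (gK _ x01)).
    rewrite /e yE; apply: (le_trans (pow_max_taylor _ x0 _)); first by rewrite mulr_ge0 ?(ltW h0)// subr_ge0 ltW.
    by rewrite le_eqVlt; apply/orP; left; apply/eqP; rewrite -/n; ring.
  rewrite (wintZ _ q0 b1) (wint_onem2 _ q0); apply: ler_wpM2l.
    by apply: mulr_ge0; [exact: ltW|by apply: mulr_ge0; exact: sqr_ge0].
  rewrite /B (bfunS M.+1 q0) (bfunS M q0) -/n.
  have -> : M.+1%:R = n - 1 :> R by rewrite /n -[M.+2%:R]natr1 addrK.
  have n1 : 0 < n - 1 by rewrite subr_gt0 /n ltr1n.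
  rewrite le_eqVlt; apply/orP; left; apply/eqP.
  move: (bfun q M) (n) n0 n1 => b' a a0 a1; have aq := addr_gt0 a0 q0; have a1q := addr_gt0 a1 q0.
  by field; rewrite !lt0r_neq0.
have c2 : `|wint q (fun x => g x * (u x * (1 - x)))| <= K * (2 * q * (q + 1) / (n + 1 + q) * B).
  have b1 : bm (fun x : R => x ^+ M.+1 * (1 - x) ^+ 2) := bmM (bX M.+1) (bmX 2 bom).
  have b2 : bm (fun x : R => x ^+ M.+2 * (1 - x)) := bmM (bX M.+2) bom.
  apply: (@le_trans _ _ (wint q (fun x => K * (n * (x ^+ M.+1 * (1 - x) ^+ 2) + (1 + q) * (x ^+ M.+2 * (1 - x)))))).
    apply: (norm_wint_bound q0 (bmM bg (bmM bu bom)) (bmZ K (bmD (bmZ n b1) (bmZ (1 + q) b2)))).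
    move=> x x01; move/I01P : (x01) => /andP[x0 x1].
    rewrite normrM; apply: (ler_pM (normr_ge0 _) (normr_ge0 _) (gK _ x01)).
    (* The leading terms cancel: relative to [B], both integrals that remain are of order 1/n. *)
    have -> : u x * (1 - x) = n * (x ^+ M.+1 * (1 - x) ^+ 2) - (1 + q) * (x ^+ M.+2 * (1 - x)).
      by rewrite /u !exprS; ring.
    have x1' : 0 <= 1 - x by rewrite subr_ge0 ltW.
    have e1 : 0 <= n * (x ^+ M.+1 * (1 - x) ^+ 2).
      by apply: mulr_ge0; [exact: ltW|apply: mulr_ge0; [exact: exprn_ge0|exact: sqr_ge0]].
    have e2 : 0 <= (1 + q) * (x ^+ M.+2 * (1 - x)).
      apply: mulr_ge0; first by rewrite addr_ge0// ltW.
      by apply: mulr_ge0 => //; exact: exprn_ge0.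
    by apply: (le_trans (ler_normB _ _)); rewrite (ger0_norm e1) (ger0_norm e2).
  have b3 := bmZ n b1; have b4 := bmZ (1 + q) b2.
  rewrite (wintZ _ q0 (bmD b3 b4)) (wintD q0 b3 b4) (wintZ _ q0 b1) (wintZ _ q0 b2).
  rewrite (wint_onem2 _ q0) (wint_onem _ q0); apply: (ler_wpM2l (ltW K0)).
  have n1q : 0 < n + q by rewrite addr_gt0.
  have -> : bfun q M.+1 = (n + q) / n * B.
    rewrite /B (bfunS M.+1 q0) -/n; move: (bfun q M.+1) (n) n0 n1q => b1' a a0 aq.
    by field; rewrite !lt0r_neq0.
  rewrite -/B -[M.+3%:R]natr1 -/n.
  rewrite le_eqVlt; apply/orP; left; apply/eqP.
  move: (B) (n) n0 n1q nq0 => b1' a a0 aq a1q.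
  by field; rewrite !lt0r_neq0.
have kn : 2 * L / eta < n + 1 + q.
  apply: (lt_trans (truncnS_gt _)); apply: (@le_lt_trans _ _ n); last by rewrite -addrA ltrDl addr_gt0.
  rewrite /n ler_nat -kM; apply: (leq_trans (ltnW kN)); exact: leq_addr.
have n2 : 2 <= n by rewrite /n ler_nat.
have B'0 : 0 < B^-1 by rewrite invr_gt0.
rewrite Ediff normrM (gtr0_norm B'0) mulrC (ler_pdivrMr _ _ B0).
have q'0 : 0 < q^-1 by rewrite invr_gt0.
have qh'0 : 0 < (q * h)^-1 by rewrite invr_gt0 mulr_gt0.
apply: (le_trans (ler_normD _ _)); rewrite !normrM (gtr0_norm q'0) (gtr0_norm qh'0).
have f1 := appr_step_tail1 q0 h0 n2 K0 B0 hE c1.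
have f2 := appr_step_tail2 q0 n0 eta0 K0 B0 kn c2.
rewrite (splitr eta) mulrDl; exact: lerD f1 f2.
Qed.

Lemma appr_down m q p sigma eps eta : 0 < q -> 0 < eta -> appr (q + m%:R) p sigma eps -> appr q p sigma (eps + eta).
Proof.
elim: m eps eta => [|m IH] eps eta q0 eta0.
  rewrite addr0 => -[g [bg [N HN]]]; exists g; split => //; exists N => k /HN h.
  by rewrite (le_trans h)// lerDl ltW.
rewrite -[m.+1%:R]natr1 addrA => /(@appr_step _ _ _ _ (eta / 2)) H.
rewrite (splitr eta) addrA; apply: IH => //; first by rewrite divr_gt0.
by apply: H; [rewrite ltr_wpDr|rewrite divr_gt0].
Qed.

Lemma appr_real_SO q p sigma eps : 0 < q -> 0 < eps -> real_SO sigma -> appr q p sigma eps.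
Proof.
move=> q0 e0 sSO; have e2 : 0 < eps / 2 by rewrite divr_gt0.
have [Q0 Q00 H] := appr_chebyshev sSO e2.
(* Half of eps pays for Chebyshev's inequality at an exponent above [Q0], the other half for the
   finitely many descents to q. *)
rewrite (splitr eps); apply: (@appr_down (Num.truncn Q0).+1) => //; apply: H.
by apply: (le_trans (ltW (truncnS_gt _))); rewrite lerDr ltW.
Qed.

Definition gam_closure q p sigma := forall eps, 0 < eps ->
  exists2 g, bm g & forall k, `|gam q p g k - sigma k| <= eps.

Lemma gam_closureD q p s1 s2 : 0 < q -> gam_closure q p s1 -> gam_closure q p s2 ->
  gam_closure q p (fun k => s1 k + s2 k).
Proof.
move=> q0 H1 H2 e e0; have e2 : 0 < e / 2 by rewrite divr_gt0.
have [g1 b1 h1] := H1 _ e2; have [g2 b2 h2] := H2 _ e2.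
exists (fun x => g1 x + g2 x) => [|k]; first exact: bmD.
rewrite gamD// opprD addrACA (splitr e) (le_trans (ler_normD _ _))//; exact: lerD.
Qed.

Lemma gam_closureZ q p c s : 0 < q -> gam_closure q p s -> gam_closure q p (fun k => c * s k).
Proof.
move=> q0 H e e0; have c0 : 0 < `|c| + 1 by rewrite ltr_wpDl.
have [g bg hg] := H (e / (`|c| + 1)) ltac:(by rewrite divr_gt0).
exists (fun x => c * g x) => [|k]; first exact: bmZ.
rewrite gamZ// -mulrBr normrM.
apply: (@le_trans _ _ ((`|c| + 1) * (e / (`|c| + 1)))).
  by apply: ler_pM => //; rewrite lerDl.
by rewrite mulrC divfK// lt0r_neq0.
Qed.

Lemma gam_closure_sum q p (s : nat -> nat -> R) n : 0 < q ->
  (forall j, (j < n)%N -> gam_closure q p (s j)) -> gam_closure q p (fun k => \sum_(j < n) s j k).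
Proof.
move=> q0; elim: n => [|n IH] H.
  move=> e e0; exists (fun=> 0) => [|k]; first exact: bm_cst.
  by rewrite gam_cst// big_ord0 subrr normr0 ltW.
have := gam_closureD q0 (IH (fun j jn => H j (ltnW jn))) (H n (ltnSn n)).
by under [in X in X -> _]eq_fun do rewrite -[_ + _](big_ord_recr n (fun j => s j _)).
Qed.

Lemma gam_closure_closed q p s : 0 < q ->
  (forall eps, 0 < eps -> exists2 s', gam_closure q p s' & forall k, `|s' k - s k| <= eps) ->
  gam_closure q p s.
Proof.
move=> q0 H e e0; have e2 : 0 < e / 2 by rewrite divr_gt0.
have [s' H' h'] := H _ e2; have [g bg hg] := H' _ e2; exists g => // k.
rewrite -[gam q p g k](subrK (s' k)) -addrA (splitr e) (le_trans (ler_normD _ _))//.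
exact: lerD.
Qed.

Lemma wint_shiftn q n f : wint (q + n%:R) f = wint q (fun x => f x * (1 - x) ^+ n).
Proof.
elim: n q => [|n IH] q; first by rewrite addr0; apply: eq_wint => x _; rewrite mulr1.
rewrite -natr1 [n%:R + 1]addrC addrA IH wint_shift.
by apply: eq_wint => x _; rewrite exprSr mulrA.
Qed.

Let ratio_mul (a q l b c : R) : 0 < a + q -> 0 < a + (q + l) -> 0 < b -> 0 < a ->
  a / (a + (q + l)) * c / (a / (a + q) * b) = (a + q) / (a + (q + l)) * (c / b).
Proof. by move=> aq aql b0 a0; field; rewrite !lt0r_neq0. Qed.

(* The moments of [(1 - x) ^+ L], normalised at [k], are small beyond [k] for
   large [L]; the finitely many terms before [k] are removed by induction. *)
Lemma gam_closure_delta q p k : 0 < q -> gam_closure q p (fun i => (i == k)%:R).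
Proof.
move=> q0; elim/ltn_ind: k => k IH.
apply: gam_closure_closed => // eps eps0.
(* The ratio of consecutive moments at i is (a + q) / (a + q + L) with a = i + p + 1; this L makes
   it at most eps at i = k. *)
pose L := (Num.truncn (((k + p).+1%:R + q) / eps)).+1.
have bL : bm (fun x : R => (1 - x) ^+ L) by apply: bmX; exact: bm_onem.
have [s sg] : exists s : nat -> R, forall i, gam q p (fun x => (1 - x) ^+ L) i = s i by eexists.
have sE i : s i = bfun (q + L%:R) (i + p) / bfun q (i + p).
  rewrite -sg /gam /bfun wint_shiftn; congr (_ / _).
  by apply: eq_wint => x _; rewrite mulrC.
have qL0 : 0 < q + L%:R by rewrite ltr_wpDr.
have s0 i : 0 < s i by rewrite sE divr_gt0// bfun_gt0.
have sS i : s i.+1 = ((i + p).+1%:R + q) / ((i + p).+1%:R + (q + L%:R)) * s i.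
  rewrite !sE addSn (bfunS _ qL0) (bfunS _ q0).
  have B0 := bfun_gt0 (i + p) q0.
  have a0 : 0 < (i + p).+1%:R :> R by [].
  move: ((i + p).+1%:R) a0 => a a0.
  have aq : 0 < a + q by rewrite addr_gt0.
  have aL : 0 < a + (q + L%:R) by rewrite addr_gt0.
  exact: ratio_mul.
have smono i j : (i <= j)%N -> s j <= s i.
  move=> /subnK <-; elim: (j - i)%N => // m IHm; rewrite addSn (le_trans _ IHm)// sS.
  rewrite ler_piMl ?(ltW (s0 _))// ler_pdivrMr ?mul1r; last by rewrite addr_gt0.
  by rewrite lerD2l lerDl.
have seps i : (k < i)%N -> s i <= eps * s k.
  move=> ki; apply: (le_trans (smono k.+1 i ki)); rewrite sS ler_wpM2r ?(ltW (s0 _))//.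
  rewrite ler_pdivrMr; last by rewrite addr_gt0.
  have : ((k + p).+1%:R + q) / eps < L%:R by exact: truncnS_gt.
  rewrite ltr_pdivrMr// => h.
  have : 0 <= eps * ((k + p).+1%:R + q) by rewrite mulr_ge0 ?(ltW eps0)// addr_ge0// ltW.
  lra.
(* Equal to 0 before k and to 1 at k; beyond k it is at most eps. *)
exists (fun i => (s k)^-1 * s i + \sum_(j < k) (- ((s k)^-1 * s j)) * (i == j)%:R).
  apply: gam_closureD => //.
    apply: gam_closureZ => // e e0; exists (fun x => (1 - x) ^+ L) => // i.
    by rewrite sg subrr normr0 ltW.
  apply: (@gam_closure_sum q p (fun j i => - ((s k)^-1 * s j) * (i == j)%:R)) => // j jk.
  by apply: gam_closureZ => //; exact: IH.
move=> i; have [ik|ki|->] := ltngtP i k.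
- rewrite subr0 (bigD1 (Ordinal ik))//= eqxx mulr1 big1 ?addr0 ?subrr ?normr0 ?ltW//.
  by move=> j ji; rewrite (_ : (i == j) = false) ?mulr0//; apply/negbTE; apply: contra ji => /eqP ij; apply/eqP/val_inj.
- rewrite subr0 big1 ?addr0; last first.
    move=> j _; rewrite (_ : (i == j) = false) ?mulr0//; apply/negbTE; rewrite neq_ltn.
    by rewrite (ltn_trans (ltn_ord j) ki) orbT.
  rewrite ger0_norm ?mulr_ge0 ?invr_ge0 ?(ltW (s0 _))//.
  by rewrite mulrC ler_pdivrMr ?seps.
- rewrite mulVf ?lt0r_neq0 ?s0// big1 ?addr0 ?subrr ?normr0 ?ltW//.
  by move=> j _; rewrite (_ : (k == j) = false) ?mulr0//; apply/negbTE; rewrite neq_ltn ltn_ord orbT.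
Qed.

Theorem gam_closure_SO q p sigma : 0 < q -> real_SO sigma -> gam_closure q p sigma.
Proof.
move=> q0 sSO; apply: gam_closure_closed => // eps eps0.
have [g [bg [N HN]]] := appr_real_SO p q0 eps0 sSO.
exists (fun i => gam q p g i + \sum_(j < N) (sigma j - gam q p g j) * (i == j)%:R).
  apply: gam_closureD => //.
    by move=> e e0; exists g => // k; rewrite subrr normr0 ltW.
  apply: (@gam_closure_sum q p (fun j i => (sigma j - gam q p g j) * (i == j)%:R)) => // j jk.
  by apply: gam_closureZ => //; exact: gam_closure_delta.
move=> i; have [iN|Ni] := ltnP i N.
  rewrite (bigD1 (Ordinal iN))//= eqxx mulr1 big1 ?addr0; last first.
    by move=> j ji; rewrite (_ : (i == j) = false) ?mulr0//; apply/negbTE; apply: contra ji => /eqP ij; apply/eqP/val_inj.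
  by rewrite [gam _ _ _ _ + _]addrC subrK subrr normr0 ltW.
rewrite big1 ?addr0; first exact: HN.
move=> j _; rewrite (_ : (i == j) = false) ?mulr0//; apply/negbTE; rewrite neq_ltn.
by rewrite (leq_trans (ltn_ord j) Ni) orbT.
Qed.

End moment_sequences.

(** * Strict positivity of integrals *)

Section positive_integrals.
Local Open Scope ereal_scope.

Lemma integral_gt0 d (T : measurableType d) (R : realType) (mu : {measure set T -> \bar R})
    (D A : set T) (f : T -> \bar R) :
  measurable D -> measurable_fun D f -> (forall x, D x -> 0 <= f x) ->
  measurable A -> A `<=` D -> 0 < mu A -> (forall x, A x -> 0 < f x) ->
  0 < \int[mu]_(x in D) f x.
Proof.
move=> mD mf f0 mA AD muA fA; rewrite lt0e integral_ge0// andbT; apply/eqP => I0.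
have : \int[mu]_(x in D) `|f x| = 0.
  by rewrite -I0; apply: eq_integral => x /[!inE] /f0 /gee0_abs.
move/(ae_eq_integral_abs _ mD mf) => ae0.
move: muA; rewrite (measure_negligible mA) ?ltxx//.
apply: negligibleS ae0 => x Ax /(_ (AD _ Ax)) /= fx0.
by have := fA _ Ax; rewrite fx0 ltxx.
Qed.

End positive_integrals.

(** * Positivity of the gamma function *)

Section gamma_function.
Context {R : realType}.
Notation leb := (@lebesgue_measure R).

Lemma ge0_integral_reflect (c : R) (f : R -> \bar R) :
  measurable_fun setT f -> (forall x, 0 <= f x)%E ->
  (\int[leb]_x f (c - x)%R = \int[leb]_x f x)%E.
Proof.
move=> mf f0.
rewrite -(ge0_integral_shift c mf f0).
have mN : measurable_fun setT (-%R : measurableTypeR R -> measurableTypeR R) by apply: oppr_measurable.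
have mfc : measurable_fun [set: R] (fun x : R => f (x + c)%R).
  by apply: (measurableT_comp mf); apply: measurable_funD.
have H (A : set (measurableTypeR R)) : measurable A -> leb A = leb (-%R @^-1` A).
  by move=> mA; rewrite -[LHS](lebesgue_measureN mA).
rewrite (ge0_integral_image mN H mfc (fun x => f0 _)).
by apply: eq_integral => x _; rewrite addrC.
Qed.

(** From ln t <= ln c + t / c: with c > 2 |s - 1| the power costs at most a constant and a factor
    exp (t / 2). *)
Let gamma_bound (s : R) : exists2 C : R, 0 <= C & forall t, 1 <= t -> t `^ (s - 1) * expR (- t) <= C * expR (- (1 / 2) * t).
Proof.
pose c := 2 * `|s - 1| + 1; have c0 : 0 < c by rewrite ltr_wpDl// mulr_ge0.
exists (expR (`|s - 1| * ln c)); first exact: expR_ge0.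
move=> t t1; have t0 : 0 < t by exact: lt_le_trans t1.
have tc0 : 0 < t / c by rewrite divr_gt0.
rewrite /powR gt_eqF// -!expRD ler_expR.
have h1 : ln t <= ln c + t / c.
  by rewrite -[X in ln X <= _](divfK (lt0r_neq0 c0)) lnM ?posrE// addrC lerD2l ltW// ln_sublinear.
have h2 : `|s - 1| * (t / c) <= t / 2.
  rewrite mulrCA ler_wpM2l ?(ltW t0)// ler_pdivrMr// /c; have := normr_ge0 (s - 1); lra.
have h3 : (s - 1) * ln t <= `|s - 1| * ln t.
  by apply: ler_wpM2r; [rewrite ln_ge0|exact: ler_norm].
have h4 : `|s - 1| * ln t <= `|s - 1| * (ln c + t / c) by exact: ler_wpM2l.
lra.
Qed.

(** [Gamma] is the real part of an extended real integral and would be 0 if this were infinite, so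
    finiteness is the main point. The majorant is t^(s-1) on ]0, 1], a reflected [wt s], and a
    multiple of an exponential density beyond. *)
Lemma Gamma_gt0 (s : R) : 0 < s -> 0 < Gamma s.
Proof.
move=> s0; pose D : set (measurableTypeR R) := `]0, +oo[%classic.
have mD : measurable D by exact: measurable_itv.
pose f := fun t : R => t `^ (s - 1) * expR (- t).
have mf : measurable_fun D f.
  apply: measurable_funM; first exact: measurable_funTS (measurable_powR _).
  have h := measurableT_comp (@measurable_expR R) (@oppr_measurable R setT).
  exact: measurable_funTS h.
have f0 t : 0 <= f t by rewrite mulr_ge0 ?powR_ge0 ?expR_ge0.
have [C C0 fC] := gamma_bound s.
have m1 : measurable_fun [set: R] (EFin \o (wt s \_ I01)).
  apply/measurable_EFinP/(measurable_restrictT _ (measurable_itv _)).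
  exact: measurable_funTS (measurable_wt s).
have h10 (t : R) : (0 <= (EFin \o (wt s \_ I01)) t)%E.
  by rewrite lee_fin patchE; case: ifP => // _; exact: wt_ge0.
have i1 : (\int[leb]_t (EFin \o (wt s \_ I01)) (1 - t)%R < +oo)%E.
  rewrite (ge0_integral_reflect 1 m1 h10) -restrict_EFin -integral_mkcond.
  have := wintE s0 (bm_cst 1); under eq_fun do rewrite mul1r.
  by rewrite /comp => ->; rewrite ltry.
have m2 : measurable_fun [set: R] (fun t : R => (2 * C * exponential_pdf (1 / 2) t)%:E).
  by apply/measurable_EFinP; apply: measurable_funM => //; exact: measurable_exponential_pdf.
have h20 (t : R) : (0 <= (2 * C * exponential_pdf (1 / 2) t)%:E)%E.
  by rewrite lee_fin !mulr_ge0// exponential_pdf_ge0.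
have i2 : (\int[leb]_t (2 * C * exponential_pdf (1 / 2) t)%:E < +oo)%E.
  under eq_integral do rewrite EFinM.
  rewrite ge0_integralZl_EFin//.
  - by rewrite integral_exponential_pdf// mule1 ltry.
  - by move=> t _; rewrite lee_fin exponential_pdf_ge0.
  - by apply/measurable_EFinP; exact: measurable_exponential_pdf.
  - by rewrite mulr_ge0.
have fin : (\int[leb]_(t in D) (f t)%:E < +oo)%E.
  have m1' : measurable_fun [set: R] (fun t : R => (EFin \o (wt s \_ I01)) (1 - t)%R).
    by apply: (measurableT_comp m1); exact: measurable_funB.
  apply: le_lt_trans (_ : (\int[leb]_t ((EFin \o (wt s \_ I01)) (1 - t)%R + (2 * C * exponential_pdf (1 / 2) t)%:E) < +oo)%E); last first.
    by rewrite ge0_integralD// lte_add_pinfty.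
  rewrite integral_mkcond; apply: ge0_le_integral => //.
  - by move=> t _; rewrite patchE; case: ifP => // _; rewrite lee_fin.
  - by apply/(measurable_restrictT _ mD)/measurable_EFinP.
  - exact: emeasurable_funD.
  move=> t _; rewrite patchE /=; case: ifPn => [|_]; last exact: (adde_ge0 (h10 _) (h20 _)).
  rewrite inE /D /= in_itv /= andbT => t0.
  rewrite -EFinD lee_fin; have [t1|t1] := leP t 1.
    apply: (@le_trans _ _ ((wt s \_ I01) (1 - t))); last by rewrite lerDl; exact: h20.
    rewrite patchE ifT; last by rewrite inE; apply/I01P; rewrite subr_ge0 t1 /=; lra.
    by rewrite /wt subKr /f ler_piMr ?powR_ge0// expR_le1 oppr_le0 ltW.
  apply: (le_trans (fC _ (ltW t1))).
  have -> : exponential_pdf (1 / 2) t = 1 / 2 * expR (- (1 / 2) * t) by apply: exponential_pdfE; exact: ltW.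
  apply: ler_wpDl; first exact: h10.
  by rewrite le_eqVlt; apply/orP; left; apply/eqP; field.
have pos : (0 < \int[leb]_(t in D) (f t)%:E)%E.
  apply: (@integral_gt0 _ _ _ _ D `]0, 1[%classic) => //.
  - exact/measurable_EFinP.
  - by move=> t _; rewrite lee_fin.
  - by move=> t; rewrite /D /= !in_itv /= => /andP[->].
  - have l1 : (0 < lebesgue_measure (`]0%R, 1%R[%classic : set R))%E.
      by rewrite lebesgue_measure_itv /= lte_fin ltr01 oppr0 adde0 lte_fin ltr01.
    exact: l1.
  - by move=> t /=; rewrite in_itv /= => /andP[t0 _]; rewrite lte_fin mulr_gt0 ?expR_gt0 ?powR_gt0.
rewrite /Gamma /Rintegral; move: fin pos; rewrite -/f -/D.
by case: (\int[leb]_(t in D) _)%E => //= r _; rewrite lte_fin.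
Qed.

End gamma_function.

(** * The torus action on C^n *)

Section torus_action.
Context {R : realType}.
Local Open Scope ereal_scope.
Notation leb := (@lebesgue_measure R).
Notation RR := (measurableTypeR R * measurableTypeR R)%type.

(** Independent angles: orthogonality of monomials turns a single coordinate, while constant angles
    give the scalar rotations. *)
Definition tact n (th : 'I_n -> R) (z : Cn R n) : Cn R n := \row_i (cis (th i) * z ord0 i)%R.

Lemma tact_cst n t (z : Cn R n) : tact (fun=> t) z = cis t *: z.
Proof. by apply/rowP => i; rewrite !mxE. Qed.

Lemma sqnorm_tact n th (z : Cn R n) : sqnorm (tact th z) = sqnorm z.
Proof. by apply: eq_bigr => i _; rewrite mxE absCM absC_cis mul1r. Qed.

Lemma measurable_tact n (th : 'I_n -> R) : measurable_fun setT (tact th).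
Proof.
apply: measurable_fun_coordRRP => i.
rewrite (_ : _ \o _ = rotRR (th i) \o coordRR i).
  by apply: measurableT_comp; [exact: measurable_rotRR|exact: measurable_coordRR].
apply/funext => z; rewrite /coordRR /rotRR /= mxE ReCM ImCM /= mulNr; congr (_, _).
by rewrite addrC.
Qed.

Lemma tact_Ccons n (th : 'I_n.+1 -> R) (p : RR) (w : Cn R n) :
  tact th (Ccons (p, w)) = Ccons (rotRR (th ord0) p, tact (fun i => th (lift ord0 i)) w).
Proof.
apply/rowP => i; rewrite mxE; case: (unliftP ord0 i) => [j ->|->].
  by rewrite !Ccons_coordS mxE.
by rewrite !Ccons_coord0; apply: Cx_eq; rewrite ?ReCM ?ImCM /=; ring.
Qed.

Lemma ge0_integral_tact n (th : 'I_n -> R) (f : Cn R n -> \bar R) :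
  measurable_fun setT f -> (forall z, 0 <= f z) ->
  \int[lebesgueCn n]_z f (tact th z) = \int[lebesgueCn n]_z f z.
Proof.
elim: n th f => [|n IH] th f mf f0.
  by apply: eq_integral => z _; congr f; apply/matrixP => a [].
have mfc : measurable_fun setT (fun z : Cn R n.+1 => f (tact th z)).
  by apply: (measurableT_comp mf); exact: measurable_tact.
rewrite (ge0_integral_CnS mf f0) (ge0_integral_CnS mfc (fun z => f0 _)).
have mC := measurable_comp_Ccons mf.
pose G p := \int[lebesgueCn n]_w f (Ccons (p, w)).
have mG : measurable_fun setT G.
  exact: (@measurable_fun_fubini_tonelli_F _ _ _ _ _ (lebesgueCn n) (fun q => f (Ccons q))).
have G0 p : 0 <= G p by exact: integral_ge0.
rewrite -[RHS](ge0_integral_rotRR (th ord0) mG G0).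
apply: eq_integral => p _; under eq_integral do rewrite tact_Ccons.
apply: (IH _ (fun w => f (Ccons (rotRR (th ord0) p, w)))) => //.
exact: (measurableT_comp mC).
Qed.

End torus_action.

(** * Invariance of integrals over the ball under the torus *)

Section integrals_on_the_ball.
Context {R : realType} {n : nat}.
Implicit Types (th : 'I_n -> R) (f g : Cn R n -> Cx R).
Notation mu := (@lebesgueCn R n).
Notation ball := (@uball R n).

Lemma mem_uball_tact th z : (tact th z \in ball) = (z \in ball).
Proof. by apply/idP/idP; rewrite !inE /uball /= sqnorm_tact. Qed.

Lemma measurable_tact_comp th (f : Cn R n -> R) : measurable_fun ball f ->
  measurable_fun ball (fun z => f (tact th z)).
Proof.
move=> mf; have mb := @measurable_uball R n.
apply/(measurable_restrictT _ mb).
rewrite (_ : _ \_ _ = (f \_ ball) \o tact th); last first.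
  by apply/funext => z; rewrite patchE /= patchE mem_uball_tact.
apply: measurableT_comp; last exact: measurable_tact.
exact/(measurable_restrictT _ mb).
Qed.

Lemma ge0_integral_ball_tact th (f : Cn R n -> \bar R) :
  measurable_fun ball f -> (forall z, 0 <= f z)%E ->
  (\int[mu]_(z in ball) f (tact th z) = \int[mu]_(z in ball) f z)%E.
Proof.
move=> mf f0; have mb := @measurable_uball R n.
have mfb : measurable_fun setT (f \_ ball) by exact/(measurable_restrictT _ mb).
have fb0 z : (0 <= (f \_ ball) z)%E by rewrite patchE; case: ifP.
rewrite integral_mkcond [RHS]integral_mkcond -[RHS](ge0_integral_tact th mfb fb0).
by apply: eq_integral => z _; rewrite !patchE mem_uball_tact.
Qed.

Let Rintegral_tact th (f : Cn R n -> R) : measurable_fun ball f ->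
  Rintegral mu ball (fun z => f (tact th z)) = Rintegral mu ball f.
Proof.
move=> mf.
(* Positive and negative parts are compared separately, so the equality holds without
   integrability. *)
have E (h : Cn R n -> R) : Rintegral mu ball h =
  fine (\int[mu]_(z in ball) (EFin \o h)^\+ z - \int[mu]_(z in ball) (EFin \o h)^\- z)%E.
  by rewrite /Rintegral [X in fine X]integralE.
rewrite (E f) (E (fun z => f (tact th z))).
have me : measurable_fun ball (EFin \o f) by exact/measurable_EFinP.
rewrite -(ge0_integral_ball_tact th (measurable_funepos me) (fun z => funepos_ge0 _ z)).
rewrite -(ge0_integral_ball_tact th (measurable_funeneg me) (fun z => funeneg_ge0 _ z)).
congr (fine (_ - _)%E); apply: eq_integral => z _.
- by rewrite !funeposE.
- by rewrite !funenegE.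
Qed.

Lemma Cint_tact th f : cmeas ball f -> Cint mu ball (fun z => f (tact th z)) = Cint mu ball f.
Proof.
move=> [m1 m2]; apply: Cx_eq; rewrite /Cint /=.
- exact: (Rintegral_tact th m1).
- exact: (Rintegral_tact th m2).
Qed.

End integrals_on_the_ball.

(** * The multinomial theorem *)

Section truncated_exponentials.
Context {R : realType}.
Implicit Types (s t : R).

Let pexp k s : {poly R} := \poly_(j < k.+1) (s ^+ j / j`!%:R).

(** Truncation does not affect coefficients up to degree k, so these multiply like the series exp
    (x_i X). *)
Let coef_pexp_prod n k (x : 'I_n -> R) j : (j <= k)%N ->
  (\prod_(i < n) pexp k (x i))`_j = (\sum_(i < n) x i) ^+ j / j`!%:R.
Proof.
elim: n x j => [|n IH] x j jk.
  rewrite !big_ord0 coef1; case: j jk => [|j] _; first by rewrite expr0 divr1.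
  by rewrite expr0n /= mul0r.
rewrite !big_ord_recr /= coefM addrC exprDn mulr_suml; apply: eq_bigr => i _.
have ij : (i <= j)%N by rewrite -ltnS.
rewrite coef_poly ltnS (leq_trans (leq_subr i j) jk) (IH _ _ (leq_trans ij jk)).
have f0 (a : nat) : (a`!%:R : R) != 0 by rewrite pnatr_eq0 -lt0n fact_gt0.
rewrite -(bin_fact ij) !natrM -mulr_natl.
have C0 : ('C(j, i)%:R : R) != 0 by rewrite pnatr_eq0 -lt0n bin_gt0.
by field; rewrite !f0 C0.
Qed.

(** Both sides are the coefficient of X^k in the product of the exponentials exp (x_i X). Truncating
    them at k matches the index type of exponents in [homog_poly]. *)
Lemma multinomial_exp n k (x : 'I_n -> R) :
  \sum_(a : {ffun 'I_n -> 'I_k.+1} | (\sum_(i < n) a i == k)%N)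
     (\prod_(i < n) x i ^+ a i) / (\prod_(i < n) (a i)`!)%:R = (\sum_(i < n) x i) ^+ k / k`!%:R.
Proof.
rewrite -(coef_pexp_prod x (leqnn k)).
under [in RHS]eq_bigr do rewrite /pexp poly_def.
rewrite bigA_distr_bigA coef_sum /= [LHS]big_mkcond /=; apply: eq_bigr => a _.
have -> : \prod_(i < n) (x i ^+ a i / (a i)`!%:R *: 'X^(a i)) =
    (\prod_(i < n) (x i ^+ a i / (a i)`!%:R)) *: 'X^(\sum_(i < n) a i) :> {poly R}.
  by rewrite scaler_prod; congr (_ *: _); rewrite prodrXr.
rewrite coefZ coefXn eq_sym; case: eqP => _; last by rewrite mulr0.
by rewrite mulr1 natr_prod -prodf_div.
Qed.

End truncated_exponentials.

(** * Differentials in normed spaces compared with explicit estimates *)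

Section library_differentials.
Context {R : realType} {n : nat}.
Implicit Types (z u : Cn R n) (h f : Cn R n -> Cx R).

Lemma RC_gt0 (x : R) : (0 < RC x) = (0 < x).
Proof. by rewrite ltcE /= eqxx. Qed.

Lemma RC_ge0 (x : R) : (0 <= RC x) = (0 <= x).
Proof. by rewrite lecE /= eqxx. Qed.

Lemma RC_le (x y : R) : (RC x <= RC y) = (x <= y).
Proof. by rewrite -subr_ge0 -RCB RC_ge0 subr_ge0. Qed.

Lemma RC_lt (x y : R) : (RC x < RC y) = (x < y).
Proof. by rewrite -subr_gt0 -RCB RC_gt0 subr_gt0. Qed.

Lemma gt0_RC (e : Cx R) : 0 < e -> e = RC (ReC e).
Proof. by case: e => x y; rewrite ltcE /= => /andP[/eqP -> _]. Qed.

Lemma mx_norm_le_nrm1 u : `|u| <= RC (nrm1 u).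
Proof.
rewrite [`|u|]/Num.norm /=; have [->|/mx_norm_neq0[i ->]] := eqVneq (mx_norm u) 0.
  by rewrite RC_ge0 nrm1_ge0.
by rewrite normCE RC_le (ord1 i.1) nrm1_le.
Qed.

(** [diff_locally] bounds the error by the complex-valued sup norm, which [nrm1] dominates; the
    coefficients are the values of the differential on the canonical basis. *)
Lemma differentiable_cdiffn h z : differentiable h z -> exists D, cdiffn h z D.
Proof.
move=> dh; exists (fun i => 'd h z (delta_mx ord0 i)) => eps eps0.
have /eqaddoP H := diff_locally dh.
have e0 : 0 < RC eps by rewrite RC_gt0.
have /nbhs_ballP[e e1 He] := H _ e0.
have eE := gt0_RC e1; exists (ReC e).
  by rewrite -RC_gt0 -eE.
move=> u ue.
have /He : ball (0 : Cn R n) e u.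
  split => // i j; rewrite mxE /ball /= sub0r normrN normCE eE RC_lt.
  by rewrite (ord1 i) (le_lt_trans (nrm1_le u j)).
rewrite /= => Hu.
have -> : \sum_(i < n) 'd h z (delta_mx ord0 i) * u ord0 i = 'd h z u.
  rewrite [in RHS](row_sum_delta u) linear_sum; apply: eq_bigr => i _.
  by rewrite linearZ /= mulrC.
rewrite -RC_le -normCE RCM.
apply: le_trans (le_trans Hu _); last by rewrite ler_wpM2l ?mx_norm_le_nrm1// ltW.
by rewrite !fctE /= opprD addrA [u + z]addrC.
Qed.

Lemma holomorphic_holo h : holomorphic_ball h -> holo h.
Proof. by move=> H z /H /differentiable_cdiffn. Qed.

Lemma differentiable_homog k f z : homog_poly k f -> differentiable f z.
Proof.
move=> [c fE].
pose M (a : {ffun 'I_n -> 'I_k.+1}) : Cn R n -> Cx R := \prod_(i < n) (fun z : Cn R n => z ord0 i) ^+ a i.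
have -> : f = \sum_(a : {ffun 'I_n -> 'I_k.+1} | (\sum_(i < n) a i == k)%N) c a *: M a.
  apply/funext => y; rewrite fE fct_sumE; apply: eq_bigr => a _.
  rewrite /M [RHS]/GRing.scale /= fct_prodE; congr (_ * _).
  by apply: eq_bigr => i _; rewrite exprfctE.
apply: (big_ind (fun g : Cn R n -> Cx R => differentiable g z)) => [|f1 f2 d1 d2|a _].
- exact: differentiable_cst.
- exact: differentiableD.
apply: differentiableZ; apply: (big_ind (fun g : Cn R n -> Cx R => differentiable g z)) => [|f1 f2 d1 d2|i _].
- exact: differentiable_cst.
- exact: differentiableM.
case: (a i : nat) => [|j]; first exact: differentiable_cst.
by apply: differentiableX; exact: differentiable_coord.
Qed.

Lemma holomorphic_homog k f : homog_poly k f -> holomorphic_ball f.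
Proof. by move=> hf z _; exact: differentiable_homog hf. Qed.

Lemma holomorphic_ballB f h : holomorphic_ball f -> holomorphic_ball h ->
  holomorphic_ball (fun z => f z - h z).
Proof. by move=> hf hh z zb; apply: differentiableB; [exact: hf|exact: hh]. Qed.

End library_differentials.

(** * Weighted integrals over the ball *)

Section weighted_ball.
Context {R : realType} {m : nat} {lambda : R} (lam : -1 < lambda).
Implicit Types (f g h : Cn R m.+1 -> Cx R).
Notation mu := (@lebesgueCn R m.+1).
Notation ball := (@uball R m.+1).
Notation W := (@bergman_weight R m.+1 lambda).
Notation q := (lambda + 1).

Let mball : measurable ball. Proof. exact: measurable_uball. Qed.

Lemma lam_gt0 : 0 < q. Proof. by rewrite -ltrBlDr sub0r. Qed.

Definition weight_cst : R := Gamma (m.+1%:R + lambda + 1) / (pi ^+ m.+1 * Gamma (lambda + 1)).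

Lemma weight_cst_gt0 : 0 < weight_cst.
Proof.
rewrite divr_gt0 ?mulr_gt0 ?exprn_gt0 ?pi_gt0 ?Gamma_gt0 ?lam_gt0//.
by rewrite -addrA ltr_wpDl// lam_gt0.
Qed.

Lemma weight_wt z : W z = weight_cst * wt q (sqnorm z).
Proof. by rewrite /bergman_weight /wt addrK. Qed.

Lemma weight_ge0 z : 0 <= W z.
Proof. by rewrite weight_wt mulr_ge0 ?wt_ge0// ltW// weight_cst_gt0. Qed.

Lemma weight_gt0 z : ball z -> 0 < W z.
Proof.
by move=> zb; rewrite weight_wt mulr_gt0 ?weight_cst_gt0// powR_gt0// subr_gt0.
Qed.

Lemma weight_tact th z : W (tact th z) = W z.
Proof. by rewrite !weight_wt sqnorm_tact. Qed.

Lemma measurable_weight D : measurable_fun D W.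
Proof.
apply: measurable_funTS.
have -> : W = (fun z => weight_cst * (wt q \o @sqnorm R m.+1) z) by apply/funext => z; rewrite weight_wt.
apply: measurable_funM => //; apply: measurableT_comp; first exact: measurable_wt.
exact: measurable_sqnorm.
Qed.

Lemma ball_I01 z : ball z -> I01 (sqnorm z).
Proof. by move=> zb; apply/I01P; rewrite sqnorm_ge0. Qed.

(** The constant of [integral_monomial] does not depend on dimension, exponents or function, so it
    can be chosen once. *)
Definition area_cst : R := sval (cid2 (@integral_monomial R)).

Definition ball_cst : R := weight_cst * area_cst ^+ m.+1.

Lemma ball_cst_gt0 : 0 < ball_cst.
Proof.
by rewrite mulr_gt0 ?weight_cst_gt0// exprn_gt0// /area_cst; case: cid2.
Qed.

Let mom (a : 'I_m.+1 -> nat) (b : R -> R) (z : Cn R m.+1) : R :=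
  (\prod_(i < m.+1) absC (z ord0 i) ^+ (2 * a i)) * b (sqnorm z) * W z.

Let mom_cst (a : 'I_m.+1 -> nat) : R :=
  ball_cst * (\prod_(i < m.+1) (a i)`!)%:R / ((\sum_(i < m.+1) a i + m)`!)%:R.

Let measurable_mom a b D : measurable_fun setT b -> measurable_fun D (mom a b).
Proof.
move=> mb; apply: measurable_funM; last exact: measurable_weight.
apply: measurable_funTS; apply: measurable_funM; first exact: measurable_prod_sqnorm.
by apply: measurableT_comp => //; exact: measurable_sqnorm.
Qed.

Let ge0_moment a b : bm b -> (forall x, I01 x -> 0 <= b x) ->
  (\int[mu]_(z in ball) (mom a b z)%:E =
   (mom_cst a * wint q (fun x => b x * x ^+ (\sum_(i < m.+1) a i + m)))%:E)%E.
Proof.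
move=> bb b0; set N := (\sum_(i < m.+1) a i + m)%N.
pose f (t : R) : \bar R := (((fun t => weight_cst * (b t * wt q t)) \_ I01) t)%:E.
have mI : measurable (I01 : set (measurableTypeR R)) by exact: measurable_itv.
have mf : measurable_fun setT f.
  apply/measurable_EFinP/(measurable_restrictT _ mI); apply: measurable_funTS.
  apply: measurable_funM => //; apply: measurable_funM; [exact: bb.1|exact: measurable_wt].
have f0 t : (0 <= f t)%E.
  rewrite lee_fin patchE; case: ifPn => // /[!inE] tI.
  by rewrite mulr_ge0 ?(ltW weight_cst_gt0)// mulr_ge0 ?b0 ?wt_ge0.
have bN : bm (fun x => b x * x ^+ N) by apply: bmM => //; exact: bm_pow.
have H := (svalP (cid2 (@integral_monomial R))).2 m a f mf f0; rewrite -/area_cst -/N in H.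
rewrite integral_mkcond.
transitivity (\int[mu]_z ((\prod_(i < m.+1) absC (z ord0 i) ^+ (2 * a i))%:E * f (sqnorm z)))%E.
  apply: eq_integral => z _; rewrite /f !patchE.
  have -> : (sqnorm z \in I01) = (z \in ball).
    apply/idP/idP; rewrite !inE; last exact: ball_I01.
    by move/I01P => /andP[].
  by case: ifP => _; rewrite ?mule0// -EFinM /mom weight_wt; congr EFin; ring.
rewrite H.
have -> : (\int[lebesgue_measure]_(t in `[0%R, +oo[) ((t ^+ N)%:E * f t) =
    (weight_cst * wint q (fun x => b x * x ^+ N))%:E)%E.
  rewrite -(wintZ _ lam_gt0 bN) -(wintE lam_gt0 (bmZ _ bN)).
  rewrite integral_mkcond [RHS]integral_mkcond; apply: eq_integral => t _.
  rewrite /f !patchE; case: (boolP (t \in I01)) => [tI|_].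
    rewrite ifT; last by move: tI; rewrite !inE => /I01P/andP[t0 _]; rewrite /= in_itv /= t0.
    by rewrite -EFinM; congr EFin; ring.
  by case: ifP => //; rewrite mule0.
by rewrite -EFinM /mom_cst /ball_cst; congr EFin; ring.
Qed.

Let ge0_integrable_moment a b : bm b -> (forall x, I01 x -> 0 <= b x) ->
  mu.-integrable ball (EFin \o mom a b).
Proof.
move=> bb b0; apply/integrableP; split.
  by apply/measurable_EFinP; exact: measurable_mom bb.1.
have -> : (\int[mu]_(z in ball) `|(EFin \o mom a b) z| = \int[mu]_(z in ball) (mom a b z)%:E)%E.
  apply: eq_integral => z /[!inE] zb; rewrite gee0_abs// lee_fin.
  by rewrite mulr_ge0 ?weight_ge0// mulr_ge0 ?prod_absC_ge0// b0//; exact: ball_I01.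
by rewrite ge0_moment// ltry.
Qed.

Let integrable_moment a b : bm b -> mu.-integrable ball (EFin \o mom a b).
Proof.
move=> bb; apply: (le_integrable mball _ _ (ge0_integrable_moment a (bm_norm bb) _)) => //.
- by apply/measurable_EFinP; exact: measurable_mom bb.1.
- by move=> z zb /=; rewrite lee_fin /mom !normrM !(ger0_norm (prod_absC_ge0 _ _)) normr_id.
Qed.

Lemma ball_moment (a : 'I_m.+1 -> nat) b : bm b ->
  mu.-integrable ball (EFin \o (fun z : Cn R m.+1 => (\prod_(i < m.+1) absC (z ord0 i) ^+ (2 * a i)) * b (sqnorm z) * W z)) /\
  Rintegral mu ball (fun z : Cn R m.+1 => (\prod_(i < m.+1) absC (z ord0 i) ^+ (2 * a i)) * b (sqnorm z) * W z) =
  ball_cst * (\prod_(i < m.+1) (a i)`!)%:R / ((\sum_(i < m.+1) a i + m)`!)%:R *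
  wint q (fun x => b x * x ^+ (\sum_(i < m.+1) a i + m)).
Proof.
move=> bb; split; first exact: integrable_moment.
have [_ [K bK]] := bb; set N := (\sum_(i < m.+1) a i + m)%N.
(* Adding the bound makes the radial factor nonnegative; the contribution of the constant is then
   subtracted. *)
have bK0 : bm (fun=> `|K|) by exact: bm_cst.
have bp : bm (fun x => b x + `|K|) by exact: bmD.
have p0 x : I01 x -> 0 <= b x + `|K|.
  by move=> /bK; rewrite ler_norml => /andP[h _]; have := ler_norm K; lra.
have q0 := lam_gt0.
have E1 : Rintegral mu ball (mom a (fun x => b x + `|K|)) = mom_cst a * wint q (fun x => (b x + `|K|) * x ^+ N).
  by rewrite /Rintegral ge0_moment.
have E2 : Rintegral mu ball (mom a (fun=> `|K|)) = mom_cst a * wint q (fun x => `|K| * x ^+ N).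
  by rewrite /Rintegral ge0_moment.
transitivity (Rintegral mu ball (mom a (fun x => b x + `|K|)) - Rintegral mu ball (mom a (fun=> `|K|))).
  rewrite -(RintegralB mball (integrable_moment a bp) (integrable_moment a bK0)).
  by apply: eq_Rintegral => z _; rewrite /mom; ring.
rewrite E1 E2 -mulrBr /mom_cst -/N; congr (_ * _).
rewrite -(wintB q0 (bmM bp (bm_pow N)) (bmM bK0 (bm_pow N))).
by apply: eq_wint => x _; ring.
Qed.

Definition wintegrable f := cintegrable mu ball (fun z => RC (W z) * f z).

Definition wI f : Cx R := Cint mu ball (fun z => RC (W z) * f z).

Lemma eq_wI f g : (forall z, ball z -> f z = g z) -> wI f = wI g.
Proof. by move=> fg; apply: eq_Cint => z /fg ->. Qed.

Lemma wintegrableZ c f : wintegrable f -> wintegrable (fun z => c * f z).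
Proof.
move=> fi; apply: eq_cintegrable (cintegrableZ mball c fi) => // z _.
by rewrite mulrCA.
Qed.

Lemma wID f g : wintegrable f -> wintegrable g -> wI (fun z => f z + g z) = wI f + wI g.
Proof.
move=> fi gi; rewrite /wI -(CintD mball fi gi).
by apply: eq_Cint => z _; rewrite mulrDr.
Qed.

Lemma wIZ c f : wintegrable f -> wI (fun z => c * f z) = c * wI f.
Proof.
by move=> fi; rewrite /wI -(CintZ mball c fi); apply: eq_Cint => z _; rewrite mulrCA.
Qed.

Lemma wIB f g : wintegrable f -> wintegrable g -> wI (fun z => f z - g z) = wI f - wI g.
Proof.
move=> fi gi; rewrite /wI -(CintB mball fi gi).
by apply: eq_Cint => z _; rewrite mulrBr.
Qed.

Lemma wI_sum I (r : seq I) (P : pred I) (F : I -> Cn R m.+1 -> Cx R) :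
  (forall i, P i -> wintegrable (F i)) ->
  wI (fun z => \sum_(i <- r | P i) F i z) = \sum_(i <- r | P i) wI (F i).
Proof.
move=> Fi; rewrite /wI -(Cint_sum mball r Fi).
by apply: eq_Cint => z _; rewrite mulr_sumr.
Qed.

Lemma cmeas_weight f : cmeas ball f -> cmeas ball (fun z => RC (W z) * f z).
Proof. by move=> mf; apply: cmeasM => //; apply: cmeas_RC; exact: measurable_weight. Qed.

Lemma wI_tact th f : cmeas ball f -> wI (fun z => f (tact th z)) = wI f.
Proof.
move=> mf; rewrite /wI -(Cint_tact th (cmeas_weight mf)).
by apply: eq_Cint => z _; rewrite weight_tact.
Qed.

Lemma wI_conj f : wintegrable f -> wI (fun z => (f z)^*) = (wI f)^*.
Proof.
move=> [_ fi]; apply: Cx_eq; rewrite ?ReC_conj ?ImC_conj /wI /Cint /=.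
  by apply: eq_Rintegral => z _; rewrite !ReC_RCM ReC_conj.
transitivity (Rintegral mu ball (fun z => -1 * ImC (RC (W z) * f z))).
  by apply: eq_Rintegral => z _; rewrite !ImC_RCM ImC_conj mulrN mulN1r.
by rewrite (RintegralZl _ mball fi) mulN1r.
Qed.

Lemma inner_wI f g : inner lambda f g = wI (fun z => f z * (g z)^*).
Proof.
by apply: Cx_eq; rewrite /inner /wI /Cint /=; apply: eq_Rintegral => z _;
  rewrite ?ReC_RCM ?ImC_RCM mulrC.
Qed.

Lemma wintegrable_dom f (b : Cn R m.+1 -> R) : cmeas ball f ->
  mu.-integrable ball (EFin \o (fun z => b z * W z)) ->
  (forall z, ball z -> absC (f z) <= b z) -> wintegrable f.
Proof.
move=> mf bi fb; have [m1 m2] := cmeas_weight mf; apply: cintegrable_absP => //.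
apply: (le_integrable mball _ _ bi).
  by apply/measurable_EFinP; apply: cmeas_absC => //; exact: cmeas_weight.
move=> z zb /=; rewrite lee_fin [leLHS]ger0_norm ?absC_ge0// absCM absC_RC ger0_norm ?weight_ge0//.
apply: le_trans (ler_norm _); rewrite mulrC; apply: ler_wpM2r; first exact: weight_ge0.
exact: fb.
Qed.

Lemma integrable_weight b : bm b -> mu.-integrable ball (EFin \o (fun z => b (sqnorm z) * W z)).
Proof.
move=> bb; have [+ _] := ball_moment (fun=> 0%N) bb.
apply: eq_integrable => // z _ /=; congr (EFin (_ * _)).
by rewrite big1 ?mul1r// => i _; rewrite muln0 expr0.
Qed.

Lemma wintegrable_bounded f K : cmeas ball f -> (forall z, ball z -> absC (f z) <= K) ->
  wintegrable f.
Proof. by move=> mf fK; apply: (wintegrable_dom mf (integrable_weight (bm_cst K))). Qed.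

Lemma wI_RC b : bm b -> wI (fun z => RC (b (sqnorm z))) =
  RC (ball_cst / m`!%:R * wint q (fun x => b x * x ^+ m)).
Proof.
move=> bb; have [_] := ball_moment (fun=> 0%N) bb.
rewrite big1 ?fact0// big1// add0n mulr1 => E.
apply: Cx_eq; rewrite /wI /Cint /=.
  rewrite -E; apply: eq_Rintegral => z _; rewrite mulr0 subr0 mulrC /=; congr (_ * _).
  by rewrite big1 ?mul1r// => i _; rewrite muln0 expr0.
rewrite (_ : (fun z => _) = cst 0) ?Rintegral_cst// ?mul0r//.
by apply/funext => z; rewrite mulr0 mul0r addr0.
Qed.

End weighted_ball.

(** * Monomials and the Bergman space *)

Section bergman_space.
Context {R : realType} {m : nat} {lambda : R} (lam : -1 < lambda).
Implicit Types (f g h : Cn R m.+1 -> Cx R) (a b : 'I_m.+1 -> nat) (z : Cn R m.+1).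
Notation mu := (@lebesgueCn R m.+1).
Notation ball := (@uball R m.+1).
Notation W := (@bergman_weight R m.+1 lambda).
Notation q := (lambda + 1).
Notation wI := (@wI R m lambda).
Notation wintegrable := (@wintegrable R m lambda).
Notation ball_cst := (@ball_cst R m lambda).

Let mball : measurable ball. Proof. exact: measurable_uball. Qed.

Lemma cis_nat k (t : R) : cis (k%:R * t) = cis t ^+ k.
Proof.
elim: k => [|k IH]; first by rewrite mul0r cis0.
by rewrite -natr1 mulrDl mul1r cisD IH exprSr.
Qed.

Definition monom a z : Cx R := \prod_(i < m.+1) z ord0 i ^+ a i.

Lemma cmeas_monom D a : cmeas D (monom a).
Proof.
apply: (@cmeasS _ _ _ setT) => //.
by apply: cmeas_prod => i _; apply: cmeasX; exact: cmeas_coord.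
Qed.

Lemma absC_monom_le1 a z : ball z -> absC (monom a z) <= 1.
Proof.
move=> zb; rewrite absC_prod.
suff /andP[] : 0 <= \prod_(i < m.+1) absC (z ord0 i ^+ a i) <= 1 by [].
apply: (big_ind (fun x => 0 <= x <= 1)) => [|x y /andP[x0 x1] /andP[y0 y1]|i _].
- by rewrite ler01 lexx.
- by rewrite mulr_ge0// mulr_ile1.
rewrite absC_ge0 absCX exprn_ile1 ?absC_ge0//.
by rewrite -(@expr_le1 _ 2) ?absC_ge0// (le_trans (coord_le_sqnorm z i))// ltW.
Qed.

Lemma monom_tact th a z : monom a (tact th z) = cis (\sum_(i < m.+1) (a i)%:R * th i) * monom a z.
Proof.
have -> : cis (\sum_(i < m.+1) (a i)%:R * th i) = \prod_(i < m.+1) cis (th i) ^+ a i.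
  by rewrite (big_morph cis (@cisD R) (@cis0 R)); apply: eq_bigr => i _; exact: cis_nat.
rewrite /monom -big_split /=; apply: eq_bigr => i _.
by rewrite mxE exprMn.
Qed.

Lemma absC_monom a z : absC (monom a z) ^+ 2 = \prod_(i < m.+1) absC (z ord0 i) ^+ (2 * a i).
Proof.
rewrite absC_prod -prodrXl; apply: eq_bigr => i _.
by rewrite absCX -exprM mulnC.
Qed.

(* Rotating the i-th coordinate by [pi / (a i - b i)] changes the sign of the integral. *)
Lemma wI_monom_orth a b i : a i != b i -> wI (fun z => monom a z * (monom b z)^*) = 0.
Proof.
move=> abi; pose th j : R := if j == i then pi / ((a i)%:R - (b i)%:R) else 0.
have thE (c : 'I_m.+1 -> nat) : \sum_(j < m.+1) (c j)%:R * th j = (c i)%:R * (pi / ((a i)%:R - (b i)%:R)).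
  rewrite (bigD1 i)//= /th eqxx big1 ?addr0// => j /negbTE ->.
  by rewrite mulr0.
have mf : cmeas ball (fun z => monom a z * (monom b z)^*).
  by apply: cmeasM; [|apply: cmeas_conj]; exact: cmeas_monom.
have fb z : ball z -> absC (monom a z * (monom b z)^*) <= 1.
  by move=> zb; rewrite absCM absC_conj mulr_ile1 ?absC_ge0 ?absC_monom_le1.
have fi := wintegrable_bounded lam mf fb.
have H : wI (fun z => monom a z * (monom b z)^*) = - wI (fun z => monom a z * (monom b z)^*).
  rewrite -[LHS](wI_tact th mf) -[RHS]mulN1r -(wIZ _ fi); apply: eq_wI => z _.
  rewrite !monom_tact !thE rmorphM /= cis_conj mulrACA -cisD -mulrBl.
  have d0 : (a i)%:R - (b i)%:R != 0 :> R by rewrite subr_eq0 eqr_nat.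
  rewrite [_ * (pi / _)]mulrC divfK//; congr (_ * _).
  by apply: Cx_eq; rewrite /= ?cospi ?sinpi ?oppr0.
have : wI (fun z => monom a z * (monom b z)^*) *+ 2 = 0 by rewrite mulr2n {1}H addNr.
by move/eqP; rewrite mulrn_eq0 /= => /eqP.
Qed.

Definition monom_cst a : R :=
  ball_cst * (\prod_(i < m.+1) (a i)`!)%:R / ((\sum_(i < m.+1) a i + m)`!)%:R *
  bfun q (\sum_(i < m.+1) a i + m).

Lemma monom_cst_gt0 a : 0 < monom_cst a.
Proof.
apply: mulr_gt0; last exact: bfun_gt0 (lam_gt0 lam).
apply: divr_gt0; last by rewrite ltr0n fact_gt0.
apply: mulr_gt0; first exact: ball_cst_gt0.
by rewrite ltr0n prodn_gt0// => i; exact: fact_gt0.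
Qed.

Lemma wI_monom_norm a : wI (fun z => monom a z * (monom a z)^*) = RC (monom_cst a).
Proof.
have [_ E] := ball_moment lam a (bm_cst 1).
have -> : monom_cst a = Rintegral mu ball (fun z => \prod_(i < m.+1) absC (z ord0 i) ^+ (2 * a i) * 1 * W z).
  rewrite E /monom_cst; congr (_ * _); apply: eq_wint => x _; by rewrite mul1r.
transitivity (wI (fun z => RC (absC (monom a z) ^+ 2))).
  by apply: eq_wI => z _; rewrite conjCM_abs.
apply: Cx_eq; rewrite /wI /Cint /=.
  by apply: eq_Rintegral => z _; rewrite mulr0 subr0 mulr1 absC_monom mulrC.
rewrite (_ : (fun z => _) = cst 0) ?Rintegral_cst// ?mul0r//.
by apply/funext => z; rewrite mulr0 mul0r addr0.
Qed.

Lemma homog_bounded k f : homog_poly k f -> cmeas ball f /\ exists K, forall z, ball z -> absC (f z) <= K.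
Proof.
move=> [c fE].
have E : f = (fun z => \sum_(al : {ffun 'I_m.+1 -> 'I_k.+1} | (\sum_(i < m.+1) al i == k)%N)
  c al * monom (fun i => al i) z) by apply/funext => z; rewrite fE.
rewrite E; split.
  by apply: cmeas_sum => al _; apply: cmeasM; [exact: cmeas_cst|exact: cmeas_monom].
exists (\sum_(al : {ffun 'I_m.+1 -> 'I_k.+1} | (\sum_(i < m.+1) al i == k)%N) absC (c al)) => z zb.
apply: (le_trans (absC_sum _ _ _)); apply: ler_sum => al _.
by rewrite absCM ler_piMr ?absC_ge0// absC_monom_le1.
Qed.

Lemma L2_ballP f : L2_ball lambda f <->
  cmeas ball f /\ mu.-integrable ball (EFin \o (fun z => absC (f z) ^+ 2 * W z)).
Proof.
have E : (\int[mu]_(z in ball) `|(EFin \o (fun z => (absC (f z) ^+ 2 * W z)%R)) z| =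
    \int[mu]_(z in ball) (absC (f z) ^+ 2 * W z)%:E)%E.
  apply: eq_integral => z _ /=; rewrite ger0_norm// mulr_ge0 ?sqr_ge0//.
  exact: weight_ge0.
split => [[mf If]|[mf /integrableP[_ If]]]; split => //; last by rewrite -E.
apply/integrableP; split; last by rewrite E.
apply/measurable_EFinP; apply: measurable_funM; last exact: measurable_weight.
by apply: measurable_funX; exact: cmeas_absC.
Qed.

(** A common majorant of |f g| and of |f - g|^2. *)
Let integrable_sq2 f g : L2_ball lambda f -> L2_ball lambda g ->
  mu.-integrable ball (EFin \o (fun z => (2 * (absC (f z) ^+ 2 + absC (g z) ^+ 2)) * W z)).
Proof.
move=> /L2_ballP[mf fi] /L2_ballP[mg gi].
have := integrableZl mball 2 (integrableD mball fi gi).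
by apply: eq_integrable => // z _ /=; rewrite -EFinD -EFinM; congr EFin; ring.
Qed.

Lemma L2_mul f g : L2_ball lambda f -> L2_ball lambda g -> wintegrable (fun z => f z * (g z)^*).
Proof.
move=> fi gi; apply: (wintegrable_dom lam _ (integrable_sq2 fi gi)).
  by apply: cmeasM; [exact: fi.1|apply: cmeas_conj; exact: gi.1].
move=> z _; rewrite absCM absC_conj; have := absC_ge0 (f z); have := absC_ge0 (g z).
by move: (absC _) (absC _) => x y; nra.
Qed.

Lemma L2B f g : L2_ball lambda f -> L2_ball lambda g -> L2_ball lambda (fun z => f z - g z).
Proof.
move=> fi gi; apply/L2_ballP; have mfg : cmeas ball (fun z => f z - g z).
  by apply: cmeasB; [exact: fi.1|exact: gi.1].
split => //; apply: (le_integrable mball _ _ (integrable_sq2 fi gi)).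
  apply/measurable_EFinP; apply: measurable_funM; last exact: measurable_weight.
  by apply: measurable_funX; exact: cmeas_absC.
move=> z _ /=; rewrite lee_fin !normrM; apply: ler_wpM2r => //.
have p0 : 0 <= 2 * (absC (f z) ^+ 2 + absC (g z) ^+ 2) by rewrite mulr_ge0// addr_ge0// sqr_ge0.
rewrite -[leRHS]normrM (ger0_norm p0) (ger0_norm (absC_ge0 _)).
have := absC_ge0 (f z); have := absC_ge0 (g z); have := absC_ge0 (f z - g z); have := absCB (f z) (g z).
move: (absC (f z - g z)) (absC (f z)) (absC (g z)) => u x y uxy u0 y0 x0.
apply: (@le_trans _ _ ((x + y) * (x + y))); first exact: ler_pM.
by have := sqr_ge0 (x - y); lra.
Qed.

Lemma L2_bounded f K : cmeas ball f -> (forall z, ball z -> absC (f z) <= K) -> L2_ball lambda f.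
Proof.
move=> mf fK; apply/L2_ballP; split => //.
apply: (le_integrable mball _ _ (integrable_weight lam (bm_cst (K ^+ 2)))).
  apply/measurable_EFinP; apply: measurable_funM; last exact: measurable_weight.
  by apply: measurable_funX; exact: cmeas_absC.
move=> z zb /=; rewrite lee_fin !normrM; apply: ler_wpM2r => //.
have h := fK _ zb; rewrite (ger0_norm (absC_ge0 _)) -normrM ger0_norm -?expr2 ?sqr_ge0//.
by apply: ler_pM => //; exact: absC_ge0.
Qed.

Lemma bergman_homog k f : homog_poly k f -> bergman lambda f.
Proof.
move=> hf; have [mf [K fK]] := homog_bounded hf; split; first exact: L2_bounded fK.
exact: holomorphic_homog hf.
Qed.

Lemma bergmanB f g : bergman lambda f -> bergman lambda g -> bergman lambda (fun z => f z - g z).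
Proof. by move=> [f1 f2] [g1 g2]; split; [exact: L2B|exact: holomorphic_ballB]. Qed.

(** By continuity a nonzero value persists on a box inside the ball, which has positive measure.
    This is what determines the choice made in [bergman_proj] on the ball. *)
Lemma bergman_definite f : bergman lambda f -> wI (fun z => f z * (f z)^*) = 0 ->
  forall z, ball z -> f z = 0.
Proof.
move=> [/L2_ballP[mf fi] hf] I0 z0 z0b; apply/eqP/negPn/negP => f0.
have [D /cdiffn_cont cf] := holomorphic_holo hf z0b.
have fp : 0 < absC (f z0) by rewrite lt0r absC_eq0 f0 absC_ge0.
have [d1 d10 H1] := cf (absC (f z0) / 2) ltac:(by rewrite divr_gt0).
have [d2 d20 H2] := uball_open z0b.
pose d := Num.min d1 d2; have d0 : 0 < d by rewrite lt_min d10 d20.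
pose e := d / (2 * m.+1%:R); have e0 : 0 < e by rewrite divr_gt0// mulr_gt0.
have boxE z : Cbox z0 e z -> nrm1 (z - z0) < d.
  move=> zb; have -> : d = \sum_(i < m.+1) (e + e).
    by rewrite sumr_const card_ord -mulr_natr /e; field.
  rewrite /nrm1 [X in _ < X]big_ord_recl [X in X < _]big_ord_recl; apply: ltr_leD.
    have [h1 h2] := zb ord0; apply: (le_lt_trans (absC_le _)).
    by rewrite !mxE ReCB ImCB ltrD.
  apply: ler_sum => i _; have [h1 h2] := zb (lift ord0 i); apply: (le_trans (absC_le _)).
  by rewrite !mxE ReCB ImCB lerD// ltW.
have zE z : z = z0 + (z - z0) by rewrite addrC subrK.
have pos : (0 < \int[mu]_(z in ball) (absC (f z) ^+ 2 * W z)%:E)%E.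
  apply: (@integral_gt0 _ _ _ _ _ (Cbox z0 e)) => //.
  - exact: measurable_int fi.
  - by move=> z _; rewrite lee_fin mulr_ge0 ?sqr_ge0//; exact: weight_ge0.
  - exact: measurable_Cbox.
  - move=> z /boxE; rewrite lt_min => /andP[_ h]; rewrite (zE z); exact: H2.
  - exact: Cbox_gt0.
  move=> z /boxE; rewrite lt_min => /andP[h1 h2].
  rewrite lte_fin mulr_gt0//; last by apply: weight_gt0 => //; rewrite (zE z); exact: H2.
  rewrite exprn_gt0// lt0r absC_eq0 absC_ge0 andbT; apply/eqP => fz.
  have := H1 _ h1; rewrite -zE fz sub0r absCN; lra.
move: I0 => /(congr1 ReC); rewrite /wI /Cint /=.
have -> : (fun z => ReC (RC (W z) * (f z * (f z)^*))) = (fun z => absC (f z) ^+ 2 * W z).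
  by apply/funext => z; rewrite conjCM_abs ReC_RCM mulrC.
rewrite /Rintegral => I0; have := integrable_fin_num mball fi.
move=> /fineK; rewrite /comp I0 => E; by move: pos; rewrite -E ltxx.
Qed.

End bergman_space.

(** * Fubini's theorem for complex-valued functions *)

Section complex_fubini.
Context {R : realType} {d1 d2 : measure_display}.
Context {T1 : measurableType d1} {T2 : measurableType d2}.
Variables (m1 : {sigma_finite_measure set T1 -> \bar R}) (m2 : {sigma_finite_measure set T2 -> \bar R}).

Let Rint_Fubini (f : T1 * T2 -> R) :
  (m1 \x m2)%E.-integrable setT (EFin \o f) ->
  (forall x, m2.-integrable setT (EFin \o (fun y => f (x, y)))) ->
  (forall y, m1.-integrable setT (EFin \o (fun x => f (x, y)))) ->
  Rintegral m1 setT (fun x => Rintegral m2 setT (fun y => f (x, y))) =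
  Rintegral m2 setT (fun y => Rintegral m1 setT (fun x => f (x, y))).
Proof.
move=> fi fx fy; have := Fubini fi; rewrite /Rintegral => E.
have E1 : (\int[m1]_x (fine (\int[m2]_y (f (x, y))%:E))%:E = \int[m1]_x \int[m2]_y (EFin \o f) (x, y))%E.
  by apply: eq_integral => x _; rewrite fineK//; exact: (integrable_fin_num measurableT (fx x)).
have E2 : (\int[m2]_y (fine (\int[m1]_x (f (x, y))%:E))%:E = \int[m2]_y \int[m1]_x (EFin \o f) (x, y))%E.
  by apply: eq_integral => y _; rewrite fineK//; exact: (integrable_fin_num measurableT (fy y)).
by rewrite E1 E2 E.
Qed.

(** Every section is assumed integrable, so that the inner integrals are finite everywhere and
    [fine] can be undone under the outer integral. *)
Lemma Cint_Fubini (F : T1 * T2 -> Cx R) : cmeas setT F ->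
  (\int[m1]_x \int[m2]_y (absC (F (x, y)))%:E < +oo)%E ->
  (forall x, cintegrable m2 setT (fun y => F (x, y))) ->
  (forall y, cintegrable m1 setT (fun x => F (x, y))) ->
  Cint m1 setT (fun x => Cint m2 setT (fun y => F (x, y))) =
  Cint m2 setT (fun y => Cint m1 setT (fun x => F (x, y))).
Proof.
move=> mF Foo Fx Fy.
have Fi : cintegrable (m1 \x m2)%E setT F.
  apply: cintegrable_absP => //; [exact: mF.1|exact: mF.2|].
  apply/integrable12ltyP; first by apply/measurable_EFinP; exact: cmeas_absC.
  apply: le_lt_trans Foo; rewrite le_eqVlt; apply/orP; left; apply/eqP.
  apply: eq_integral => x _; apply: eq_integral => y _ /=.
  by rewrite ger0_norm ?absC_ge0.
apply: Cx_eq; rewrite /Cint /=.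
- apply: (Rint_Fubini (f := fun p => ReC (F p))); [exact: Fi.1| |].
  + by move=> x; exact: (Fx x).1.
  + by move=> y; exact: (Fy y).1.
- apply: (Rint_Fubini (f := fun p => ImC (F p))); [exact: Fi.2| |].
  + by move=> x; exact: (Fx x).2.
  + by move=> y; exact: (Fy y).2.
Qed.

End complex_fubini.

(** * Extension by zero and equality almost everywhere *)

Section complex_integral_complements.
Context {R : realType} {d : measure_display} {T : measurableType d}.
Variable mu : {measure set T -> \bar R}.
Implicit Types (f g : T -> Cx R) (D : set T).

Lemma cmeas_comp d' (T' : measurableType d') (f : T -> Cx R) (phi : T' -> T) :
  cmeas setT f -> measurable_fun setT phi -> cmeas setT (fun x => f (phi x)).
Proof. by move=> [f1 f2] mphi; split; [exact: measurableT_comp f1 mphi|exact: measurableT_comp f2 mphi]. Qed.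

Definition cut D f x : Cx R := if x \in D then f x else 0.

Lemma cmeas_cut D f : measurable D -> cmeas D f -> cmeas setT (cut D f).
Proof.
move=> mD [f1 f2]; split.
- have -> : (fun x => ReC (cut D f x)) = (fun x => ReC (f x)) \_ D.
    by apply/funext => x; rewrite patchE /cut; case: ifP.
  exact/(measurable_restrictT _ mD).
- have -> : (fun x => ImC (cut D f x)) = (fun x => ImC (f x)) \_ D.
    by apply/funext => x; rewrite patchE /cut; case: ifP.
  exact/(measurable_restrictT _ mD).
Qed.

Lemma Cint_cut D f : Cint mu setT (cut D f) = Cint mu D f.
Proof.
apply: Cx_eq; rewrite /Cint /= [RHS]Rintegral_mkcond; apply: eq_Rintegral => x _;
  by rewrite patchE /cut; case: ifP.
Qed.

Lemma cintegrable_cut D f : measurable D -> cintegrable mu D f -> cintegrable mu setT (cut D f).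
Proof.
move=> mD [f1 f2]; split.
- move: f1; rewrite (integrable_mkcond _ mD); apply: eq_integrable => // x _.
  by rewrite patchE /= /cut; case: ifP.
- move: f2; rewrite (integrable_mkcond _ mD); apply: eq_integrable => // x _.
  by rewrite patchE /= /cut; case: ifP.
Qed.

Lemma ae_eq_Cint D f g : measurable D -> cmeas D f -> cmeas D g ->
  {ae mu, forall x, D x -> f x = g x} -> Cint mu D f = Cint mu D g.
Proof.
move=> mD [f1 f2] [g1 g2] fg; apply: Cx_eq; rewrite /Cint /= /Rintegral; congr fine;
  apply: ae_eq_integral => //; try exact/measurable_EFinP;
  by apply: filterS fg => x H Dx; rewrite H.
Qed.

End complex_integral_complements.

(** * Joint measurability of the circle action *)

Section circle_action.
Context {R : realType}.

Lemma cmeas_cis : cmeas setT (@cis R : measurableTypeR R -> Cx R).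
Proof.
split; apply: continuous_measurable_fun.
- exact: continuous_cos.
- exact: continuous_sin.
Qed.

Lemma measurable_circle n :
  measurable_fun setT (fun p : measurableTypeR R * Cn R n => cis p.1 *: p.2).
Proof.
apply: measurable_fun_coordRRP => i.
have [m1 m2] : cmeas setT (fun p : measurableTypeR R * Cn R n => cis p.1 * p.2 ord0 i).
  apply: cmeasM.
    exact: (cmeas_comp cmeas_cis measurable_fst).
  exact: (cmeas_comp (cmeas_coord i) measurable_snd).
rewrite (_ : _ \o _ = (fun p : measurableTypeR R * Cn R n =>
  (ReC (cis p.1 * p.2 ord0 i), ImC (cis p.1 * p.2 ord0 i)))).
  exact: measurable_fun_pair.
by apply/funext => p; rewrite /coordRR /= !mxE.
Qed.

End circle_action.

(** * Orthogonality to the whole Bergman space by averaging over rotations *)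

Section toeplitz_orthogonality.
Context {R : realType} {m : nat} {lambda : R} (lam : -1 < lambda).
Implicit Types (f g h : Cn R m.+1 -> Cx R) (z : Cn R m.+1).
Notation mu := (@lebesgueCn R m.+1).
Notation leb := (@lebesgue_measure R).
Notation ball := (@uball R m.+1).
Notation W := (@bergman_weight R m.+1 lambda).
Notation wI := (@wI R m lambda).
Notation wintegrable := (@wintegrable R m lambda).

Let mball : measurable ball. Proof. exact: measurable_uball. Qed.

Lemma monom_cis (a : 'I_m.+1 -> nat) t z : monom a (cis t *: z) = cis t ^+ (\sum_(i < m.+1) a i) * monom a z.
Proof.
rewrite -tact_cst monom_tact -mulr_suml -natr_sum; congr (_ * _).
exact: cis_nat.
Qed.

Lemma homog_cis k f t z : homog_poly k f -> f (cis t *: z) = cis t ^+ k * f z.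
Proof.
move=> [c fE]; rewrite !fE mulr_sumr; apply: eq_bigr => al /eqP alk.
have := monom_cis (fun i => al i) t z; rewrite alk /monom => ->.
by rewrite mulrCA.
Qed.

Lemma ccont_holo_circle h z : holo h -> ball z -> forall t, ccont (fun t => h (cis t *: z)) t.
Proof.
move=> hh zb t; have [D hD] := hh _ (uball_cis t zb).
exact: cderiv_ccont (cdiffn_circle hD).
Qed.

Lemma ccont_cisN k t : ccont (fun t : R => cis (- t) ^+ k) t.
Proof. by apply: ccontX; exact: cderiv_ccont (cderiv_cisN t). Qed.

Lemma integral_sq_cis h t :
  measurable_fun ball (fun z => (absC (h z) ^+ 2 * W z)%:E) ->
  (\int[mu]_(z in ball) (absC (h (cis t *: z)) ^+ 2 * W z)%:E =
   \int[mu]_(z in ball) (absC (h z) ^+ 2 * W z)%:E)%E.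
Proof.
move=> mh; rewrite -[RHS](@ge0_integral_ball_tact _ _ (fun=> t) (fun z => (absC (h z) ^+ 2 * W z)%:E)).
- by apply: eq_integral => z _; rewrite weight_tact tact_cst.
- exact: mh.
- by move=> z; rewrite lee_fin mulr_ge0 ?sqr_ge0//; exact: weight_ge0.
Qed.

Lemma L2_cis h t : L2_ball lambda h -> L2_ball lambda (fun z => h (cis t *: z)).
Proof.
move=> h2; have [_ /measurable_int mh] := (L2_ballP lam h).1 h2.
move: h2 => [[m1 m2] hi]; split; last by rewrite integral_sq_cis.
split.
- by have := measurable_tact_comp (fun=> t) m1; under eq_fun do rewrite tact_cst.
- by have := measurable_tact_comp (fun=> t) m2; under eq_fun do rewrite tact_cst.
Qed.

(** Integrated over the angle it replaces h by its component of degree k; integrated over the ball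
    it does not depend on the angle when G has degree k under rotations. *)
Let slice (h G : Cn R m.+1 -> Cx R) k (p : measurableTypeR R * Cn R m.+1) : Cx R :=
  cis (- p.1) ^+ k * (h (cis p.1 *: p.2) * (G p.2)^*).

Let I2 : set (measurableTypeR R) := `[0, pi2]%classic.
Let mI2 : measurable I2. Proof. exact: measurable_itv. Qed.

Let full h G k (p : measurableTypeR R * Cn R m.+1) : Cx R :=
  cut I2 (fun t => cut ball (fun z => RC (W z) * slice h G k (t, z)) p.2) p.1.

Let cmeas_full h G k : cmeas ball h -> cmeas ball G -> cmeas setT (full h G k).
Proof.
move=> mh mG.
(* h is measurable on the ball only, so it is extended by 0 before being composed with the rotation,
   which preserves the ball. *)
have E : full h G k = (fun p => cut I2 (fun=> 1) p.1 * (cut ball (fun z => RC (W z)) p.2 *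
   (cis (- p.1) ^+ k * (cut ball h (cis p.1 *: p.2) * (cut ball G p.2)^*)))).
  apply/funext => -[t z]; rewrite /full /cut /slice /=.
  case: (t \in I2); last by rewrite mul0r.
  have -> : (cis t *: z \in ball) = (z \in ball) by rewrite -tact_cst mem_uball_tact.
  by case: (z \in ball); rewrite ?mul1r ?mul0r// mulr0.
rewrite E; apply: cmeasM.
  apply: (cmeas_comp _ measurable_fst); apply: cmeas_cut => //; exact: cmeas_cst.
apply: cmeasM.
  apply: (cmeas_comp _ measurable_snd); apply: cmeas_cut => //.
  by apply: cmeas_RC; exact: measurable_weight.
apply: cmeasM.
  apply: cmeasX.
  have mN : measurable_fun setT (fun p : measurableTypeR R * Cn R m.+1 => - p.1 : measurableTypeR R).
    exact: measurableT_comp (@oppr_measurable R setT) measurable_fst.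
  exact: (cmeas_comp cmeas_cis mN).
apply: cmeasM.
  exact: (cmeas_comp (cmeas_cut mball mh) (@measurable_circle R m.+1)).
apply: cmeas_conj; exact: (cmeas_comp (cmeas_cut mball mG) measurable_snd).
Qed.

Let slice_integrable h G k t : L2_ball lambda h -> L2_ball lambda G ->
  wintegrable (fun z => slice h G k (t, z)).
Proof.
move=> h2 G2; exact: (wintegrableZ (cis (- t) ^+ k) (L2_mul lam (L2_cis t h2) G2)).
Qed.

(** The integrand is at most |h (e^(it) z)|^2 + |G z|^2 times the weight, and by rotation invariance
    the integral of this bound over the ball is the same for every angle. *)
Let full_lty h G k : L2_ball lambda h -> L2_ball lambda G ->
  (\int[leb]_t \int[mu]_z (absC (full h G k (t, z)))%:E < +oo)%E.
Proof.
move=> h2 G2.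
pose S (f : Cn R m.+1 -> Cx R) : \bar R := (\int[mu]_(z in ball) (absC (f z) ^+ 2 * W z)%:E)%E.
have S0 f : (0 <= S f)%E.
  by apply: integral_ge0 => z _; rewrite lee_fin mulr_ge0 ?sqr_ge0//; exact: weight_ge0.
have mS f : L2_ball lambda f -> measurable_fun ball (fun z => (absC (f z) ^+ 2 * W z)%:E).
  by move=> /(L2_ballP lam)[_ /measurable_int].
have St t : S (fun z => h (cis t *: z)) = S h.
  by apply: integral_sq_cis; exact: mS.
have [r rE] : exists r : R, (S h + S G = r%:E)%E.
  have := h2.2; have := G2.2; rewrite -/(S h) -/(S G).
  move: (S h) (S G) (S0 h) (S0 G) => [x| |] [y| |]// _ _ _ _.
  by exists (x + y).
have r0 : 0 <= r by rewrite -lee_fin -rE adde_ge0.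
have le1 t : (\int[mu]_z (absC (full h G k (t, z)))%:E <= (r * \1_I2 t)%:E)%E.
  rewrite indicE; case: (boolP (t \in I2)) => tI; last first.
    rewrite (_ : (fun z => _) = cst 0%E) ?integral0 ?mulr0//.
    by apply/funext => z; rewrite /full /cut (negbTE tI) absC0.
  rewrite mulr1 -rE -(St t).
  rewrite -ge0_integralD//; [|by move=> z _; rewrite lee_fin mulr_ge0 ?sqr_ge0//; exact: weight_ge0| |by move=> z _; rewrite lee_fin mulr_ge0 ?sqr_ge0//; exact: weight_ge0|]; last 2 first.
  - by apply: mS; exact: L2_cis.
  - exact: mS.
  rewrite [leRHS]integral_mkcond; apply: ge0_le_integral => //.
  - by move=> z _; rewrite lee_fin absC_ge0.
  - apply/measurable_EFinP; apply: cmeas_absC => //.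
    by apply: (cmeas_comp (cmeas_full k h2.1 G2.1)); exact: measurable_pair1.
  - apply/(measurable_restrictT _ mball); apply: emeasurable_funD.
      by apply: mS; exact: L2_cis.
    exact: mS.
  move=> z _; rewrite patchE /full /cut tI /=; case: (z \in ball); last by rewrite absC0.
  rewrite -EFinD lee_fin -mulrDl !absCM absC_RC absCX absC_cis expr1n mul1r absC_conj.
  rewrite mulrC ger0_norm ?weight_ge0//; apply: ler_wpM2r; first exact: weight_ge0.
  have := absC_ge0 (h (cis t *: z)); have := absC_ge0 (G z).
  by move: (absC _) (absC _) => x y; nra.
apply: (@le_lt_trans _ _ (\int[leb]_t (r * \1_I2 t)%:E)%E).
  apply: ge0_le_integral => //.
  - by move=> t _; apply: integral_ge0 => z _; rewrite lee_fin absC_ge0.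
  - apply: (@measurable_fun_fubini_tonelli_F _ _ _ _ _ mu (fun p => (absC (full h G k p))%:E)) => //.
      by apply/measurable_EFinP; apply: cmeas_absC => //; exact: cmeas_full k h2.1 G2.1.
    by move=> p; rewrite lee_fin absC_ge0.
  - by apply/measurable_EFinP; apply: measurable_funM => //; exact: measurable_indic.
under eq_integral do rewrite EFinM.
rewrite ge0_integralZl_EFin//; last by apply/measurable_EFinP; exact: measurable_indic.
rewrite integral_indic// setIT.
have I2E : lebesgue_measure (`[0, pi2]%classic : set R) = pi2%:E.
  by rewrite lebesgue_measure_itv /= lte_fin pi2_gt0 oppr0 adde0.
rewrite [X in (_ * X)%E](_ : _ = pi2%:E); last exact: I2E.
by rewrite -EFinM ltry.
Qed.

(* Averaging over the rotations replaces [h] by its homogeneous component of degree [k]. *)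
Lemma orth_bergman k (G : Cn R m.+1 -> Cx R) h : L2_ball lambda G -> bergman lambda h ->
  (forall t, {ae mu, forall z, ball z -> G (cis t *: z) = cis t ^+ k * G z}) ->
  (forall p, homog_poly k p -> wI (fun z => G z * (p z)^*) = 0) ->
  wI (fun z => G z * (h z)^*) = 0.
Proof.
move=> G2 [h2 hh] Grot Gp.
have hol := holomorphic_holo hh.
pose J := wI (fun z => h z * (G z)^*).
(* The factor that G picks up under the rotation is compensated by [cis (- t) ^+ k]. *)
have Jt t : wI (fun z => slice h G k (t, z)) = J.
  have mhG : cmeas ball (fun z => h z * (G z)^*).
    by apply: cmeasM; [exact: h2.1|apply: cmeas_conj; exact: G2.1].
  rewrite /J -(wI_tact (fun=> t) mhG); apply: ae_eq_Cint => //.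
  - apply: cmeas_weight; rewrite /slice /=; apply: cmeasM; first exact: cmeas_cst.
    by apply: cmeasM; [exact: (L2_cis t h2).1|apply: cmeas_conj; exact: G2.1].
  - apply: cmeas_weight; have [m1 m2] := mhG; split.
      exact: (measurable_tact_comp (fun=> t) m1).
    exact: (measurable_tact_comp (fun=> t) m2).
  apply: filterS (Grot t) => z Gz zb; rewrite tact_cst (Gz zb) rmorphM rmorphXn /= cis_conj /slice /=.
  by congr (_ * _); ring.
have [p hp pE] := homog_component k hol.
have F := Cint_Fubini (m1 := leb) (m2 := mu) (cmeas_full k h2.1 G2.1) (full_lty k h2 G2).
have F1 : Cint leb setT (fun t => Cint mu setT (fun z => full h G k (t, z))) = RC pi2 * J.
  transitivity (Cint leb setT (cut I2 (fun=> J))).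
    apply: eq_Cint => t _; rewrite /full /cut /=; case: ifP => _; last exact: Cint0.
    by rewrite -(Jt t) -[RHS]Cint_cut.
  rewrite Cint_cut -/(CI 0 pi2 (fun=> J)) CI_cst ?subr0//; exact: ltW pi2_gt0.
(* In this order the angle is integrated first and leaves a homogeneous polynomial, to which G is
   orthogonal. *)
have F2 : Cint mu setT (fun z => Cint leb setT (fun t => full h G k (t, z))) = 0.
  transitivity (Cint mu setT (cut ball (fun z => RC (W z) * (p z * (G z)^*)))).
    apply: eq_Cint => z _; rewrite /full /cut /=; case: ifPn => [zb|_]; last first.
      transitivity (Cint leb setT (fun=> 0)); last exact: Cint0.
      by apply: eq_Cint => t _; case: ifP.
    move: zb; rewrite inE => zb.
    rewrite -(pE _ zb).
    transitivity (Cint leb setT (cut I2 (fun t => RC (W z) * slice h G k (t, z)))); first by [].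
    rewrite Cint_cut.
    rewrite -/(CI 0 pi2 (fun t => RC (W z) * slice h G k (t, z))).
    have cc t : ccont (fun t => cis (- t) ^+ k * h (cis t *: z)) t.
      by apply: ccontM; [exact: ccont_cisN|exact: ccont_holo_circle].
    transitivity (CI 0 pi2 (fun t => RC (W z) * (G z)^* * (cis (- t) ^+ k * h (cis t *: z)))).
      by apply: eq_CI => t _; rewrite /slice /=; ring.
    by rewrite (CIZ _ (fun t _ => cc t)); ring.
  rewrite Cint_cut -/(wI (fun z => p z * (G z)^*)).
  have Gp2 : wintegrable (fun z => G z * (p z)^*) := L2_mul lam G2 (bergman_homog lam hp).1.
  rewrite (_ : (fun z => _) = (fun z => (G z * (p z)^*)^*)); last first.
    by apply/funext => z; rewrite rmorphM /= conjCK mulrC.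
  by rewrite (wI_conj Gp2) Gp// rmorph0.
have : RC pi2 * J = 0.
  rewrite -F1 F ?F2// => [t|z].
    rewrite /full /cut /=; case: (t \in I2); last exact: cintegrable0.
    exact: (cintegrable_cut mball (slice_integrable k t h2 G2)).
  rewrite /full {2}/cut /=; case: (boolP (z \in ball)) => zb; last first.
    by apply: (cintegrable_cut (f := fun=> 0) mI2); exact: cintegrable0.
  apply: (cintegrable_cut (f := fun t => RC (W z) * slice h G k (t, z)) mI2).
  apply: CI_integrable => t _; apply: ccontM; first exact: ccont_cst.
  apply: ccontM; first exact: ccont_cisN.
  by apply: ccontM; [apply: ccont_holo_circle => //; rewrite inE in zb|exact: ccont_cst].
move/eqP; rewrite mulf_eq0 RC_eq0 gt_eqF ?pi2_gt0//= => /eqP J0.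
have hG2 : wintegrable (fun z => h z * (G z)^*) := L2_mul lam h2 G2.
rewrite (_ : (fun z => _) = (fun z => (h z * (G z)^*)^*)); last first.
  by apply/funext => z; rewrite rmorphM /= conjCK mulrC.
by rewrite (wI_conj hG2) -/J J0 rmorph0.
Qed.

End toeplitz_orthogonality.

(** * The trace computed in a given basis *)

Section trace_of_a_basis.
Context {R : realType} {n : nat}.
Implicit Types (f : Cn R n -> Cx R).

(** The basis behind the chosen trace is related to [e] by mutually inverse matrices [P] and [Q]
    that conjugate [M'] to [M]. Linearity of [T] and freeness of [e] are asked for on the ball, the
    only place where Toeplitz operators are determined. *)
Lemma trace_onE (V : set (Cn R n -> Cx R)) (T : (Cn R n -> Cx R) -> Cn R n -> Cx R)
    N (e : 'I_N -> Cn R n -> Cx R) (M : 'M[Cx R]_N) :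
  is_basis V e ->
  (forall c : 'I_N -> Cx R, (forall z, uball z -> \sum_(i < N) c i * e i z = 0) -> forall i, c i = 0) ->
  (forall c : 'I_N -> Cx R, forall z, uball z ->
     T (fun z => \sum_(j < N) c j * e j z) z = \sum_(j < N) c j * T (e j) z) ->
  (forall j z, uball z -> T (e j) z = \sum_(i < N) M i j * e i z) ->
  trace_on V T = \tr M.
Proof.
move=> eV free lin TM; rewrite /trace_on; case: xgetP => [t _ [N' [e' [M' [eV' TM' ->]]]]|/(_ (\tr M)) []]; last first.
  by exists N, e, M.
have coord (f : Cn R n -> Cx R) : exists c : 'I_N -> Cx R, V f -> forall z, f z = \sum_(i < N) c i * e i z.
  have [Vf|nVf] := pselect (V f); last by exists (fun=> 0).
  by have [c [cE _]] := eV.2 _ Vf; exists (fun i => c i ord0).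
have coord' (f : Cn R n -> Cx R) : exists c : 'I_N' -> Cx R, V f -> forall z, f z = \sum_(i < N') c i * e' i z.
  have [Vf|nVf] := pselect (V f); last by exists (fun=> 0).
  by have [c [cE _]] := eV'.2 _ Vf; exists (fun i => c i ord0).
have [p Hp] := choice coord; have [q Hq] := choice coord'.
pose P : 'M[Cx R]_(N, N') := \matrix_(i, j) p (e' j) i.
pose Q : 'M[Cx R]_(N', N) := \matrix_(j, i) q (e i) j.
have eP j z : e' j z = \sum_(i < N) P i j * e i z.
  by rewrite (Hp _ (eV'.1 j)); apply: eq_bigr => i _; rewrite mxE.
have eQ i z : e i z = \sum_(j < N') Q j i * e' j z.
  by rewrite (Hq _ (eV.1 i)); apply: eq_bigr => j _; rewrite mxE.
have free' (c : 'I_N' -> Cx R) : (forall z, \sum_(i < N') c i * e' i z = 0) -> forall i, c i = 0.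
  (* Adding the relation c to the coordinates of [e' i0] gives coordinates of the same function;
     uniqueness forces c to vanish. *)
  move=> c0 i0; have N'0 := eV'.1 i0.
  have [c1 [c1E c1u]] := eV'.2 _ N'0.
  have := c1u (c1 + \col_i c i) => /(_ _)/(congr1 (fun v : 'cV_N' => v i0 ord0)) H.
  have : c1 i0 ord0 = (c1 + \col_i c i) i0 ord0.
    apply: H => z; transitivity (\sum_(i < N') c1 i ord0 * e' i z + \sum_(i < N') c i * e' i z).
      by rewrite c0 addr0.
    by rewrite -big_split; apply: eq_bigr => i _; rewrite !mxE mulrDl.
  by rewrite !mxE => /eqP; rewrite addrC -subr_eq subrr eq_sym => /eqP.
have exch (N1 N2 : nat) (A : 'M[Cx R]_(N1, N2)) (c : 'I_N2 -> Cx R) (g : 'I_N1 -> Cn R n -> Cx R) z :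
    \sum_(j < N2) c j * (\sum_(i < N1) A i j * g i z) = \sum_(i < N1) (\sum_(j < N2) A i j * c j) * g i z.
  under eq_bigr do rewrite mulr_sumr.
  rewrite exchange_big; apply: eq_bigr => i _; rewrite mulr_suml; apply: eq_bigr => j _.
  by rewrite mulrCA mulrA.
have QP : Q *m P = 1%:M.
  apply/matrixP => i j; apply/eqP; rewrite -subr_eq0; apply/eqP; move: i.
  apply: (free' (fun i => (Q *m P) i j - (1%:M : 'M[Cx R]_N') i j)) => z.
  under eq_bigr do rewrite mulrBl; rewrite sumrB.
  have -> : \sum_(i < N') (Q *m P) i j * e' i z = e' j z.
    rewrite [RHS]eP; under [RHS]eq_bigr do rewrite eQ.
    by rewrite exch; apply: eq_bigr => i _; rewrite mxE.
  rewrite (bigD1 j)//= mxE eqxx mul1r big1 ?addr0 ?subrr// => i ij.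
  by rewrite mxE (negbTE ij) mul0r.
have PQ : P *m Q = 1%:M.
  apply/matrixP => i j; apply/eqP; rewrite -subr_eq0; apply/eqP; move: i.
  apply: (free (fun i => (P *m Q) i j - (1%:M : 'M[Cx R]_N) i j)) => z _.
  under eq_bigr do rewrite mulrBl; rewrite sumrB.
  have -> : \sum_(i < N) (P *m Q) i j * e i z = e j z.
    rewrite [RHS]eQ; under [RHS]eq_bigr do rewrite eP.
    by rewrite exch; apply: eq_bigr => i _; rewrite mxE.
  rewrite (bigD1 j)//= mxE eqxx mul1r big1 ?addr0 ?subrr// => i ij.
  by rewrite mxE (negbTE ij) mul0r.
(* Column j on either side holds the coordinates of [T (e' j)] in the basis [e]. *)
have PM : P *m M' = M *m P.
  apply/matrixP => i j; apply/eqP; rewrite -subr_eq0; apply/eqP; move: i.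
  apply: (free (fun i => (P *m M') i j - (M *m P) i j)) => z zb.
  under eq_bigr do rewrite mulrBl; rewrite sumrB; apply/eqP; rewrite subr_eq0; apply/eqP.
  transitivity (T (e' j) z).
    rewrite TM'//; under [RHS]eq_bigr do rewrite eP.
    by rewrite exch; apply: eq_bigr => i _; rewrite mxE.
  have -> : e' j = (fun z => \sum_(i < N) P i j * e i z) by apply/funext => y; exact: eP.
  rewrite lin//; under eq_bigr => i _ do rewrite TM//.
  by rewrite exch; apply: eq_bigr => i _; rewrite mxE.
by rewrite -[M']mul1mx -QP -mulmxA PM mulmxA mxtrace_mulC mulmxA PQ mul1mx.
Qed.

End trace_of_a_basis.

(** * The monomial basis of homogeneous polynomials and the orthogonal projection onto them *)

Section homogeneous_basis.
Context {R : realType} {m : nat} {lambda : R} (lam : -1 < lambda) (k : nat).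
Implicit Types (f g h : Cn R m.+1 -> Cx R) (z : Cn R m.+1).
Notation mu := (@lebesgueCn R m.+1).
Notation ball := (@uball R m.+1).
Notation wI := (@wI R m lambda).
Notation wintegrable := (@wintegrable R m lambda).
Notation ball_cst := (@ball_cst R m lambda).
Notation q := (lambda + 1).

Definition idx : {set {ffun 'I_m.+1 -> 'I_k.+1}} :=
  [set al : {ffun 'I_m.+1 -> 'I_k.+1} | (\sum_(i < m.+1) al i == k)%N].

Definition expo (i : 'I_#|idx|) (j : 'I_m.+1) : nat := (enum_val i : {ffun 'I_m.+1 -> 'I_k.+1}) j.

Definition bas (i : 'I_#|idx|) : Cn R m.+1 -> Cx R := monom (expo i).

Definition nrm (i : 'I_#|idx|) : R := @monom_cst R m lambda (expo i).

Lemma sum_expo i : (\sum_(j < m.+1) expo i j = k)%N.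
Proof. by have := enum_valP i; rewrite inE => /eqP. Qed.

Lemma bas_homog i : homog_poly k (bas i).
Proof. exact: homog_poly_monom (sum_expo i). Qed.

Lemma homog_bas f : homog_poly k f ->
  exists c : 'I_#|idx| -> Cx R, forall z, f z = \sum_(i < #|idx|) c i * bas i z.
Proof.
move=> [c fE]; exists (fun i => c (enum_val i)) => z; rewrite fE.
rewrite -(big_enum_val (fun al : {ffun 'I_m.+1 -> 'I_k.+1} => c al * \prod_(i < m.+1) z ord0 i ^+ al i)).
by apply: eq_bigl => al; rewrite inE.
Qed.

Lemma nrm_gt0 i : 0 < nrm i. Proof. exact: monom_cst_gt0. Qed.

Lemma bas_wintegrable f i : L2_ball lambda f -> wintegrable (fun z => f z * (bas i z)^*).
Proof. by move=> f2; apply: L2_mul => //; exact: (bergman_homog lam (bas_homog i)).1. Qed.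

Lemma bas_orth i j : wI (fun z => bas i z * (bas j z)^*) = (i == j)%:R * RC (nrm i).
Proof.
have [<-|ij] := eqVneq i j; first by rewrite mul1r; exact: wI_monom_norm.
rewrite mul0r; have [l El] : exists l, expo i l != expo j l.
  apply: contra_notP (elimN eqP ij) => H; apply/enum_val_inj/ffunP => l; apply/val_inj.
  by apply/eqP/negPn/negP => El; apply: H; exists l.
exact: wI_monom_orth El.
Qed.

Lemma wI_lincomb_bas c j :
  wI (fun z => (\sum_(i < #|idx|) c i * bas i z) * (bas j z)^*) = c j * RC (nrm j).
Proof.
transitivity (wI (fun z => \sum_(i < #|idx|) c i * (bas i z * (bas j z)^*))).
  by apply: eq_wI => z _; rewrite mulr_suml; apply: eq_bigr => i _; rewrite mulrA.
have bi i : wintegrable (fun z => bas i z * (bas j z)^*).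
  exact: bas_wintegrable (bergman_homog lam (bas_homog i)).1.
rewrite wI_sum => [|i _]; last exact: wintegrableZ.
rewrite (bigD1 j)//= wIZ// bas_orth eqxx mul1r big1 ?addr0// => i ij.
by rewrite wIZ// bas_orth (negbTE ij) mul0r mulr0.
Qed.

(** Orthogonality gives independence already for the restrictions to the ball, as [trace_onE]
    requires. *)
Lemma bas_free c : (forall z, ball z -> \sum_(i < #|idx|) c i * bas i z = 0) -> forall i, c i = 0.
Proof.
move=> c0 j; have := wI_lincomb_bas c j.
rewrite (@eq_wI _ _ _ _ (fun=> 0)); last by move=> z zb; rewrite c0// mul0r.
rewrite [in LHS](_ : (fun=> 0) = (fun z => 0 * 0)); last by apply/funext => z; rewrite mulr0.
rewrite wIZ ?mul0r; last first.
  by apply: (@wintegrable_bounded _ _ _ lam _ 0) => [|z _]; [exact: cmeas_cst|rewrite absC0].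
by move/esym/eqP; rewrite mulf_eq0 RC_eq0 (gt_eqF (nrm_gt0 j)) orbF => /eqP.
Qed.

Lemma bas_basis : is_basis (@homog_poly R m.+1 k) bas.
Proof.
split; first exact: bas_homog.
move=> f /homog_bas[c cE]; exists (\col_i c i); split.
  by move=> z; rewrite cE; apply: eq_bigr => i _; rewrite mxE.
move=> c' c'E; apply/colP => i; rewrite mxE; apply/eqP; rewrite -subr_eq0; apply/eqP; move: i.
apply: (bas_free (c := fun i => c i - c' i ord0)) => z _.
under eq_bigr do rewrite mulrBl.
by rewrite sumrB -cE -c'E subrr.
Qed.

Definition pcoef f i : Cx R := wI (fun z => f z * (bas i z)^*) / RC (nrm i).

Definition hproj f z : Cx R := \sum_(i < #|idx|) pcoef f i * bas i z.

Lemma hproj_homog f : homog_poly k (hproj f).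
Proof. by apply: homog_poly_sum => i _; apply: homog_polyZ; exact: bas_homog. Qed.

Lemma hproj_orth f p : L2_ball lambda f -> homog_poly k p ->
  wI (fun z => (f z - hproj f z) * (p z)^*) = 0.
Proof.
move=> f2 /homog_bas[c cE].
have g2 := L2B lam f2 (bergman_homog lam (hproj_homog f)).1.
transitivity (wI (fun z => \sum_(i < #|idx|) (c i)^* * ((f z - hproj f z) * (bas i z)^*))).
  apply: eq_wI => z _; rewrite cE rmorph_sum mulr_sumr; apply: eq_bigr => i _.
  by rewrite rmorphM mulrCA.
rewrite wI_sum => [|i _]; last by apply: wintegrableZ; exact: bas_wintegrable.
rewrite big1// => i _; rewrite wIZ; last exact: bas_wintegrable.
rewrite (@eq_wI _ _ _ _ (fun z => f z * (bas i z)^* - hproj f z * (bas i z)^*)); last first.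
  by move=> z _; rewrite mulrBl.
rewrite wIB; [|exact: bas_wintegrable|]; last first.
  by apply: bas_wintegrable; exact: (bergman_homog lam (hproj_homog f)).1.
rewrite wI_lincomb_bas /pcoef divfK ?subrr ?mulr0//.
by rewrite RC_eq0 gt_eqF// nrm_gt0.
Qed.

End homogeneous_basis.

(** * The compression of a Toeplitz operator to a fixed degree and its trace *)

Section toeplitz_trace.
Context {R : realType} {m : nat} {lambda : R} (lam : -1 < lambda).
Implicit Types (a f g h : Cn R m.+1 -> Cx R) (z : Cn R m.+1).
Notation mu := (@lebesgueCn R m.+1).
Notation ball := (@uball R m.+1).
Notation wI := (@wI R m lambda).
Notation wintegrable := (@wintegrable R m lambda).
Notation ball_cst := (@ball_cst R m lambda).
Notation q := (lambda + 1).

Let mball : measurable ball. Proof. exact: measurable_uball. Qed.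

Definition bounded_symbol M a := cmeas ball a /\ forall z, absC (a z) <= M.

Definition rotation_invariant a :=
  forall t : R, {ae mu, forall z, ball z -> a (cis t *: z) = a z}.

Lemma L2_symbolM M a k f : bounded_symbol M a -> homog_poly k f -> L2_ball lambda (fun z => a z * f z).
Proof.
move=> [ma aM] hf; have [mf [K fK]] := homog_bounded hf.
apply: (@L2_bounded _ _ _ lam _ (M * K)); first exact: cmeasM.
by move=> z zb; rewrite absCM; apply: ler_pM; rewrite ?absC_ge0 ?fK.
Qed.

(** Invariance of the symbol makes a f minus its polynomial projection transform with degree k, so
    [orth_bergman] gives orthogonality to the whole Bergman space. The projection thus has the
    property defining [bergman_proj], and definiteness identifies it on the ball with the element
    chosen. *)
Lemma toeplitz_homog M a k f z : bounded_symbol M a -> rotation_invariant a ->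
  homog_poly k f -> ball z -> toeplitz lambda a f z = hproj (lambda := lambda) k (fun z => a z * f z) z.
Proof.
move=> aM arot hf zb; pose F z := a z * f z.
have F2 : L2_ball lambda F := L2_symbolM aM hf.
have pb : bergman lambda (hproj (lambda := lambda) k F) := bergman_homog lam (hproj_homog k F).
rewrite /toeplitz /bergman_proj; set S := (X in xget _ X).
have Sp : S (hproj (lambda := lambda) k F).
  split => // h hb; rewrite inner_wI; apply: (orth_bergman (k := k) lam _ hb).
  - have G2 := L2B lam F2 pb.1; exact: G2.
  - move=> t; apply: filterS (arot t) => y ay yb.
    by rewrite /F ay// (homog_cis _ _ hf) (homog_cis _ _ (hproj_homog k F)); ring.
  - by move=> p hp; exact: hproj_orth.
have [gb gorth] : S (xget (fun=> 0) S) by exact: xgetPex (ex_intro _ _ Sp).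
set g := xget _ S in gb gorth *.
have db := bergmanB lam gb pb.
apply/eqP; rewrite -subr_eq0; apply/eqP; apply: (bergman_definite lam db) => //.
have h1 := gorth _ db; have h2 := Sp.2 _ db; rewrite !inner_wI in h1 h2.
have i1 := L2_mul lam (L2B lam F2 gb.1) db.1.
have i2 := L2_mul lam (L2B lam F2 pb.1) db.1.
transitivity (wI (fun z => (F z - hproj (lambda := lambda) k F z) * (g z - hproj (lambda := lambda) k F z)^* -
   (F z - g z) * (g z - hproj (lambda := lambda) k F z)^*)).
  by apply: eq_wI => y _; ring.
by rewrite (wIB i2 i1) h1 h2 subrr.
Qed.

(* The normalised trace of [T_a] on the homogeneous polynomials of degree [k]:
   it involves [a] only through its mean on spheres, because
   [sum_(|al| = k) |z ^ al|^2 / al! = |z|^(2k) / k!]. *)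
Definition seqT a k : Cx R :=
  RC (m`!%:R / (ball_cst * bfun q (k + m))) * wI (fun z => a z * RC (sqnorm z ^+ k)).

Let sum_bas k z : \sum_(i < #|@idx m k|) absC (bas (R := R) i z) ^+ 2 / (\prod_(j < m.+1) (expo i j)`!)%:R =
  sqnorm z ^+ k / k`!%:R.
Proof.
rewrite /sqnorm -(multinomial_exp k (fun i => absC (z ord0 i) ^+ 2)).
rewrite -(big_enum_val (fun al : {ffun 'I_m.+1 -> 'I_k.+1} => absC (monom (fun j => al j) z) ^+ 2 / (\prod_(j < m.+1) (al j)`!)%:R)).
apply: eq_big => [al|al _]; first by rewrite inE.
by rewrite absC_monom; congr (_ / _); apply: eq_bigr => j _; rewrite exprM.
Qed.

Lemma toeplitz_trace M a k : bounded_symbol M a -> rotation_invariant a ->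
  (k`! * m`!)%:R / (m + k)`!%:R * trace_on (@homog_poly R m.+1 k) (toeplitz lambda a) = seqT a k.
Proof.
move=> aM arot.
pose A : 'M[Cx R]_#|@idx m k| := \matrix_(i, j) pcoef (lambda := lambda) (fun z => a z * bas j z) i.
have af2 f : homog_poly k f -> L2_ball lambda (fun z => a z * f z) by move=> hf; exact: L2_symbolM aM hf.
have b2 (i : 'I_#|@idx m k|) : L2_ball lambda (fun z => a z * bas i z) by exact: af2 (bas_homog i).
have bi (i j : 'I_#|@idx m k|) : wintegrable (fun z => a z * bas i z * (bas j z)^*).
  exact: bas_wintegrable.
rewrite (trace_onE (M := A) (bas_basis lam k) (@bas_free _ _ _ lam k)); last 2 first.
- move=> c z zb; have hc : homog_poly k (fun z => \sum_(j < #|@idx m k|) c j * bas (R := R) j z).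
    by apply: homog_poly_sum => i _; apply: homog_polyZ; exact: bas_homog.
  rewrite (toeplitz_homog aM arot hc zb).
  under [RHS]eq_bigr => j _ do rewrite (toeplitz_homog aM arot (bas_homog j) zb) /hproj mulr_sumr.
  rewrite exchange_big /hproj; apply: eq_bigr => i _.
  under [RHS]eq_bigr do rewrite mulrA.
  rewrite -mulr_suml; congr (_ * _); rewrite /pcoef.
  transitivity (wI (fun z => \sum_(j < #|@idx m k|) c j * (a z * bas j z * (bas i z)^*)) / RC (nrm (lambda := lambda) i)).
    by congr (_ / _); apply: eq_wI => y _; rewrite mulr_sumr mulr_suml; apply: eq_bigr => j _; ring.
  rewrite wI_sum => [|j _]; last exact: wintegrableZ.
  by rewrite mulr_suml; apply: eq_bigr => j _; rewrite wIZ// mulrA.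
- move=> j z zb; rewrite (toeplitz_homog aM arot (bas_homog j) zb) /hproj.
  by apply: eq_bigr => i _; rewrite mxE.
have K0 := ball_cst_gt0 lam (m := m); have B0 := bfun_gt0 (k + m) (lam_gt0 lam).
have f0 (j : nat) : (j`!%:R : R) != 0 by rewrite pnatr_eq0 -lt0n fact_gt0.
have wi (b : R) (i : 'I_#|@idx m k|) : wintegrable (fun z => RC b * (a z * bas i z * (bas i z)^*)).
  exact: wintegrableZ.
(* The squared norm of z^al is al! times a factor depending on the degree alone, so the diagonal
   entries add up to an integral in which [sum_bas] applies. *)
transitivity (wI (fun z => \sum_(i < #|@idx m k|)
   RC ((k`! * m`!)%:R / (m + k)`!%:R / nrm (lambda := lambda) i) * (a z * bas i z * (bas i z)^*))).
  rewrite wI_sum => [|i _]; last exact: wi.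
  rewrite /mxtrace mulr_sumr; apply: eq_bigr => i _; rewrite mxE /pcoef wIZ; last exact: bi.
  by rewrite RC_div RC_div !RC_nat; ring.
have aw : wintegrable (fun z => a z * RC (sqnorm z ^+ k)).
  have [ma aM'] := aM; apply: (@wintegrable_bounded _ _ _ lam _ M).
    apply: cmeasM => //; apply: cmeas_RC; apply: measurable_funX.
    exact: measurable_funTS (@measurable_sqnorm R m.+1).
  move=> z zb; rewrite absCM absC_RC ger0_norm ?exprn_ge0 ?sqnorm_ge0//.
  apply: (@le_trans _ _ (M * 1)); last by rewrite mulr1.
  by apply: ler_pM; rewrite ?absC_ge0 ?exprn_ge0 ?sqnorm_ge0// exprn_ile1 ?sqnorm_ge0// ltW.
rewrite /seqT -wIZ//; apply: eq_wI => z _.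
transitivity (a z * RC (\sum_(i < #|@idx m k|) (k`!%:R * m`!%:R / (ball_cst * bfun q (k + m))) *
  (absC (bas (R := R) i z) ^+ 2 / (\prod_(j < m.+1) (expo i j)`!)%:R))).
  rewrite RC_sum mulr_sumr; apply: eq_bigr => i _.
  rewrite -[a z * _ * _]mulrA conjCM_abs mulrCA -RCM; congr (_ * RC _).
  rewrite /nrm /monom_cst sum_expo natrM [(m + k)%N]addnC.
  have p0 : ((\prod_(j < m.+1) (expo i j)`!)%:R : R) != 0.
    by rewrite pnatr_eq0 -lt0n prodn_gt0// => j; exact: fact_gt0.
  by field; rewrite ?f0 ?p0 ?(lt0r_neq0 K0) ?(lt0r_neq0 B0).
rewrite -mulr_sumr sum_bas [RHS]mulrCA; congr (_ * _); rewrite -RCM; congr RC.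
by field; rewrite ?f0 ?(lt0r_neq0 K0) ?(lt0r_neq0 B0).
Qed.

(* An essentially bounded symbol is replaced by a bounded one. *)
Let truncation M a z : Cx R := if absC (a z) <= M then a z else 0.

Let truncation_ae M a : {ae mu, forall z, ball z -> absC (a z) <= M} ->
  {ae mu, forall z, ball z -> a z = truncation M a z}.
Proof. by apply: filterS => z aM zb; rewrite /truncation aM. Qed.

Let truncation_bounded M a : cmeas ball a -> bounded_symbol `|M| (truncation M a).
Proof.
move=> ma; split; last first.
  move=> z; rewrite /truncation; case: ifP => [aM|_]; last by rewrite absC0.
  by rewrite (le_trans aM)// ler_norm.
have -> : truncation M a = (fun z => RC (if absC (a z) <= M then 1 else 0) * a z).
  by apply/funext => z; rewrite /truncation; case: ifP; rewrite ?mul1r ?mul0r.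
apply: cmeasM => //; apply: cmeas_RC; apply: measurable_fun_if => //.
by apply: measurable_fun_ler => //; exact: cmeas_absC.
Qed.

(** The sets of candidates for the two projections coincide, so the chosen functions are equal, off
    the ball as well. *)
Let toeplitz_ae M a a' k f : cmeas ball a -> bounded_symbol M a' ->
  {ae mu, forall z, ball z -> a z = a' z} -> homog_poly k f -> toeplitz lambda a f = toeplitz lambda a' f.
Proof.
move=> ma [ma' _] aa' hf; have [mf _] := homog_bounded hf.
have E g h : bergman lambda g -> bergman lambda h ->
    inner lambda (fun z => a z * f z - g z) h = inner lambda (fun z => a' z * f z - g z) h.
  move=> gb hb; rewrite !inner_wI; apply: ae_eq_Cint => //.
  - apply: cmeas_weight; apply: cmeasM; last by apply: cmeas_conj; exact: hb.1.1.
    by apply: cmeasB; [exact: cmeasM|exact: gb.1.1].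
  - apply: cmeas_weight; apply: cmeasM; last by apply: cmeas_conj; exact: hb.1.1.
    by apply: cmeasB; [exact: cmeasM|exact: gb.1.1].
  by apply: filterS aa' => z az zb; rewrite az.
rewrite /toeplitz /bergman_proj; congr (xget _ _); apply/seteqP; split => g /= [gb H]; split => // h hb.
  by rewrite -E// H.
by rewrite E// H.
Qed.

Lemma trace_on_eq (V : set (Cn R m.+1 -> Cx R)) T1 T2 : (forall f, V f -> T1 f = T2 f) ->
  trace_on V T1 = trace_on V T2.
Proof.
move=> T12; congr (xget _ _); apply/seteqP; split => t /= [N [e [M [eV TM tE]]]]; exists N, e, M; split => // j z zb.
  by rewrite -T12 ?TM//; exact: eV.1.
by rewrite T12 ?TM//; exact: eV.1.
Qed.

Lemma absC1_cis (t : Cx R) : `|t| = 1 -> exists s, t = cis s.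
Proof.
have [s ts] := polarC t; rewrite normCE => /(@RC_inj _ _ 1) t1; exists s.
by rewrite ts t1 mul1r.
Qed.

Lemma ST_sub_seqT (x : nat -> Cx R) : ST m.+1 lambda x ->
  exists M a, bounded_symbol M a /\ x = seqT a.
Proof.
move=> [a [[ma [M aM]] aT] <-].
exists `|M|, (truncation M a); split; first exact: truncation_bounded.
have aa' := truncation_ae aM.
apply/funext => k; rewrite -(toeplitz_trace k (truncation_bounded M ma)); last first.
  move=> t; have t1 : `|cis t| = 1 :> Cx R by rewrite normCE absC_cis.
  by apply: filterS (aT _ t1) => z az zb; rewrite /truncation az.
rewrite addSn /=; congr (_ * _); apply: trace_on_eq => f hf.
exact: (toeplitz_ae ma (truncation_bounded M ma) aa' hf).
Qed.

Lemma seqT_sub_ST M a : bounded_symbol M a ->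
  (forall t z, ball z -> a (cis t *: z) = a z) -> ST m.+1 lambda (seqT a).
Proof.
move=> aM arot; have arot' : rotation_invariant a by move=> t; apply: aeW => z; exact: arot.
exists a.
  split; first by split; [exact: aM.1|exists M; apply: aeW => z _; exact: aM.2].
  by move=> t /absC1_cis[s ->]; exact: arot'.
by apply/funext => k; rewrite addSn /= (toeplitz_trace k aM arot').
Qed.

End toeplitz_trace.

(** * Estimates for the sequences, and radial symbols *)

Section toeplitz_sequences.
Context {R : realType} {m : nat} {lambda : R} (lam : -1 < lambda).
Implicit Types (a f : Cn R m.+1 -> Cx R) (b : R -> R) (z : Cn R m.+1).
Notation mu := (@lebesgueCn R m.+1).
Notation ball := (@uball R m.+1).
Notation W := (@bergman_weight R m.+1 lambda).
Notation wI := (@wI R m lambda).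
Notation wintegrable := (@wintegrable R m lambda).
Notation ball_cst := (@ball_cst R m lambda).
Notation seqT := (@seqT R m lambda).
Notation q := (lambda + 1).

Let mball : measurable ball. Proof. exact: measurable_uball. Qed.

Let c k : R := m`!%:R / (ball_cst * bfun q (k + m)).

Let c_gt0 k : 0 < c k.
Proof.
rewrite divr_gt0 ?ltr0n ?fact_gt0// mulr_gt0//; first exact: ball_cst_gt0.
exact: bfun_gt0 (lam_gt0 lam).
Qed.

Let wI_pow b k : bm b -> wI (fun z => RC (b (sqnorm z) * sqnorm z ^+ k)) = RC (gam q m b k / c k).
Proof.
move=> bb; rewrite (wI_RC lam (b := fun x => b x * x ^+ k)); last first.
  by apply: bmM => //; exact: bm_pow.
have K0 := ball_cst_gt0 lam (m := m); have B0 := bfun_gt0 (k + m) (lam_gt0 lam).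
have f0 : (m`!%:R : R) != 0 by rewrite pnatr_eq0 -lt0n fact_gt0.
congr RC; rewrite /gam /c.
have -> : wint q (fun x => b x * x ^+ k * x ^+ m) = wint q (fun x => b x * x ^+ (k + m)).
  by apply: eq_wint => x _; rewrite exprD mulrA.
by field; rewrite f0 (lt0r_neq0 K0) (lt0r_neq0 B0).
Qed.

Lemma wintegrable_sqnorm a M k : cmeas ball a -> (forall z, ball z -> absC (a z) <= M) ->
  wintegrable (fun z => a z * RC (sqnorm z ^+ k)).
Proof.
move=> ma aM; apply: (@wintegrable_bounded _ _ _ lam _ M).
  apply: cmeasM => //; apply: cmeas_RC; apply: measurable_funX.
  exact: measurable_funTS (@measurable_sqnorm R m.+1).
move=> z zb; rewrite absCM absC_RC ger0_norm ?exprn_ge0 ?sqnorm_ge0//.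
apply: (@le_trans _ _ (M * 1)); last by rewrite mulr1.
by apply: ler_pM; rewrite ?absC_ge0 ?aM ?exprn_ge0 ?sqnorm_ge0// exprn_ile1 ?sqnorm_ge0// ltW.
Qed.

(** [seqT] is an average against a probability density, so a radial majorant of |a| bounds it by its
    own moment. *)
Lemma seqT_le a b k : cmeas ball a -> bm b -> (forall z, ball z -> absC (a z) <= b (sqnorm z)) ->
  absC (seqT a k) <= gam q m b k.
Proof.
move=> ma bb ab; have [mb [K bK]] := bb.
have ai : wintegrable (fun z => a z * RC (sqnorm z ^+ k)).
  apply: (@wintegrable_sqnorm _ K) => // z zb.
  by rewrite (le_trans (ab _ zb))// (le_trans (ler_norm _))// bK//; exact: ball_I01.
rewrite /seqT -/(c k) absCM absC_RC (gtr0_norm (c_gt0 k)) -ler_pdivlMl// mulrC.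
apply: (le_trans (absC_Cint_le mball ai)).
have -> : gam q m b k / c k = ReC (wI (fun z => RC (b (sqnorm z) * sqnorm z ^+ k))) by rewrite wI_pow.
have bi : wintegrable (fun z => RC (b (sqnorm z) * sqnorm z ^+ k)).
  apply: (@wintegrable_bounded _ _ _ lam _ K).
    apply: cmeas_RC; apply: measurable_funTS; apply: measurable_funM.
      by apply: measurableT_comp => //; exact: measurable_sqnorm.
    by apply: measurable_funX; exact: measurable_sqnorm.
  move=> z zb; rewrite absC_RC normrM; apply: (@le_trans _ _ (K * 1)); last by rewrite mulr1.
  apply: ler_pM => //; first by apply: bK; exact: ball_I01.
  by rewrite ger0_norm ?exprn_ge0 ?sqnorm_ge0// exprn_ile1 ?sqnorm_ge0// ltW.
rewrite /wI /Cint ReC_mk; apply: le_Rintegral => //.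
- have h := integrable_absC mball ai; exact: h.
- by have [] := bi.
move=> z zb; rewrite !absCM !absC_RC ReC_RCM (ger0_norm (weight_ge0 lam z)).
rewrite -[ReC (RC _)]/(b (sqnorm z) * sqnorm z ^+ k).
apply: ler_wpM2l; first exact: weight_ge0.
rewrite ger0_norm ?exprn_ge0 ?sqnorm_ge0//.
by apply: ler_wpM2r; [rewrite exprn_ge0 ?sqnorm_ge0|exact: ab].
Qed.

(** The density for k+1 is the one for k times [sqnorm z / rho], where rho = N / (N + q) is the mean
    of [sqnorm]. The step is therefore 1 / rho times the mean of a (|z|^2 - rho), and both 1 - |z|^2
    and 1 - rho have mean q / (N + q). *)
Lemma seqT_step M a k : bounded_symbol M a ->
  absC (seqT a k.+1 - seqT a k) <= 2 * q * M / k.+1%:R.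
Proof.
move=> [ma aM]; have q0 := lam_gt0 lam.
have M0 : 0 <= M by apply: le_trans (absC_ge0 _) (aM 0).
set N : R := (k + m).+1%:R; have N0 : 0 < N by [].
have Nq : 0 < N + q by rewrite addr_gt0.
pose rho := N / (N + q).
have r0 : 0 < rho by rewrite divr_gt0.
have frac (x y : R) : 0 < x + y -> 1 - x / (x + y) = y / (x + y).
  by move=> xy; field; exact: lt0r_neq0.
have r1 : 1 - rho = q / (N + q) := frac _ _ Nq.
have B0 := bfun_gt0 (k + m) q0; have K0 := ball_cst_gt0 lam (m := m).
have ck : c k.+1 = rho^-1 * c k.
  rewrite /c addSn (bfunS _ q0) -/N -/rho; move: r0; move: (rho) => t t0.
  by field; rewrite !lt0r_neq0.
pose d z := a z * RC (sqnorm z - rho).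
have mS : measurable_fun ball (@sqnorm R m.+1) by exact: measurable_funTS (@measurable_sqnorm R m.+1).
have md : cmeas ball d by apply: cmeasM => //; apply: cmeas_RC; exact: measurable_funB.
have E : seqT a k.+1 - seqT a k = RC rho^-1 * seqT d k.
  have i1 : wintegrable (fun z => a z * RC (sqnorm z ^+ k.+1)) by exact: wintegrable_sqnorm.
  have i2 : wintegrable (fun z => a z * RC (sqnorm z ^+ k)) by exact: wintegrable_sqnorm.
  have Ed : wI (fun z => d z * RC (sqnorm z ^+ k)) =
      wI (fun z => a z * RC (sqnorm z ^+ k.+1)) - RC rho * wI (fun z => a z * RC (sqnorm z ^+ k)).
    rewrite -(wIZ _ i2) -(wIB i1 (wintegrableZ _ i2)); apply: eq_wI => z _.
    by rewrite /d exprS RCM RCB; ring.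
  have rr : RC rho^-1 * RC rho = 1 by rewrite -RCM mulVf ?lt0r_neq0.
  rewrite /seqT -/(c k.+1) -/(c k) ck Ed RCM.
  move: (wI _) (wI _) => X0 X1.
  transitivity (RC rho^-1 * RC (c k) * X1 - (RC rho^-1 * RC rho) * (RC (c k) * X0)).
    by rewrite rr mul1r.
  by ring.
have bb : bm (fun x : R => M * ((1 - x) + q / (N + q))).
  by apply: bmZ; apply: bmD; [exact: bm_onem|exact: bm_cst].
have db z : ball z -> absC (d z) <= M * ((1 - sqnorm z) + q / (N + q)).
  move=> zb; rewrite absCM absC_RC; apply: ler_pM; rewrite ?absC_ge0//.
  have z1 : sqnorm z < 1 by []. have r1' : 0 <= q / (N + q) by rewrite divr_ge0// ltW.
  by rewrite -r1 ler_norml; apply/andP; split; lra.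
rewrite E absCM absC_RC ger0_norm ?invr_ge0 ?(ltW r0)//.
apply: (@le_trans _ _ (rho^-1 * (2 * q * M / (N + q)))).
  rewrite ler_wpM2l ?invr_ge0 ?(ltW r0)//; apply: (le_trans (seqT_le k md bb db)).
  rewrite gamZ//; last by apply: bmD; [exact: bm_onem|exact: bm_cst].
  rewrite (gamD _ _ q0 bm_onem (bm_cst _)) gam_cst//.
  have -> : gam q m (fun x => 1 - x) k = q / (N + q).
    rewrite /gam (@eq_wint _ _ _ (fun x => x ^+ (k + m) * (1 - x))); last by move=> x _; rewrite mulrC.
    by rewrite (wint_onem _ q0) mulfK// lt0r_neq0.
  by rewrite le_eqVlt; apply/orP; left; apply/eqP; ring.
have -> : rho^-1 * (2 * q * M / (N + q)) = 2 * q * M / N.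
  have frac' (x y w : R) : 0 < x -> 0 < x + y -> (x / (x + y))^-1 * (w / (x + y)) = w / x.
    by move=> x0 xy; field; rewrite !lt0r_neq0.
  by rewrite /rho frac'.
apply: ler_wpM2l; first by rewrite !mulr_ge0// ltW.
by rewrite lef_pV2 ?posrE// ler_nat ltnS leq_addr.
Qed.

(** Cut off outside the ball because [bounded_symbol] asks for a bound everywhere, while [bm]
    controls [0, 1[ only. *)
Definition radial_symbol b1 b2 : Cn R m.+1 -> Cx R :=
  cut ball (fun z => mkC (b1 (sqnorm z)) (b2 (sqnorm z))).

Lemma radial_symbol_bounded b1 b2 : bm b1 -> bm b2 -> exists M, bounded_symbol M (radial_symbol b1 b2).
Proof.
move=> [mb1 [K1 bK1]] [mb2 [K2 bK2]]; exists (`|K1| + `|K2|); split.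
  apply: (cmeasS (D := setT)) => //; apply: cmeas_cut => //.
  by split; apply: measurable_funTS; apply: measurableT_comp => //; exact: measurable_sqnorm.
move=> z; rewrite /radial_symbol /cut; case: (boolP (z \in ball)) => [|_]; last by rewrite absC0 addr_ge0.
rewrite inE => zb; apply: (le_trans (absC_le _)); apply: lerD.
  by apply: le_trans (ler_norm _); apply: bK1; exact: ball_I01.
by apply: le_trans (ler_norm _); apply: bK2; exact: ball_I01.
Qed.

Lemma seqT_radial b1 b2 k : bm b1 -> bm b2 ->
  seqT (radial_symbol b1 b2) k = mkC (gam q m b1 k) (gam q m b2 k).
Proof.
move=> bb1 bb2.
have bi b : bm b -> wintegrable (fun z => RC (b (sqnorm z) * sqnorm z ^+ k)).
  move=> bb; have bx : bm (fun x => b x * x ^+ k) by apply: bmM => //; exact: bm_pow.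
  have [K bK] := bx.2; apply: (@wintegrable_bounded _ _ _ lam _ K).
    by apply: cmeas_RC; apply: measurable_funTS; apply: measurableT_comp bx.1 _; exact: measurable_sqnorm.
  by move=> z zb; rewrite absC_RC; apply: bK; exact: ball_I01.
have E : wI (fun z => radial_symbol b1 b2 z * RC (sqnorm z ^+ k)) =
    RC (gam q m b1 k / c k) + mkC 0 1 * RC (gam q m b2 k / c k).
  rewrite -!wI_pow// -(wIZ _ (bi _ bb2)) -(wID (bi _ bb1) (wintegrableZ _ (bi _ bb2))).
  apply: eq_wI => z zb; rewrite /radial_symbol /cut ifT ?inE//.
  by apply: Cx_eq; rewrite ?(ReCM, ImCM, ReCD, ImCD) /=; ring.
rewrite /seqT -/(c k) E; have c0 := lt0r_neq0 (c_gt0 k).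
apply: Cx_eq; rewrite ?ReC_RCM ?ImC_RCM ?(ReCM, ImCM, ReCD, ImCD) /=; field; exact: c0.
Qed.

Lemma ST_radial b1 b2 : bm b1 -> bm b2 -> ST m.+1 lambda (fun k => mkC (gam q m b1 k) (gam q m b2 k)).
Proof.
move=> bb1 bb2; have [M bM] := radial_symbol_bounded bb1 bb2.
have -> : (fun k => mkC (gam q m b1 k) (gam q m b2 k)) = seqT (radial_symbol b1 b2).
  by apply/funext => k; rewrite seqT_radial.
apply: (seqT_sub_ST lam bM) => t z zb; rewrite /radial_symbol /cut.
by rewrite -tact_cst mem_uball_tact sqnorm_tact.
Qed.

End toeplitz_sequences.

(** * Slowly oscillating sequences form a closed self-adjoint algebra *)

Section slow_oscillation.
Context {R : realType}.
Implicit Types (x y : nat -> Cx R).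

Lemma step_slow_osc x C : 0 <= C -> (forall k, absC (x k.+1 - x k) <= C / k.+1%:R) ->
  forall s d, absC (x (s + d)%N - x s) <= C * d%:R / s.+1%:R.
Proof.
move=> C0 xC s; elim=> [|d IH]; first by rewrite addn0 subrr absC0 mulr0 mul0r.
rewrite addnS; apply: (le_trans (absC_dist_trans (x (s + d)%N) _ _)).
rewrite -[d.+1%:R]natr1 mulrDr mulrDl mulr1 addrC; apply: lerD => //.
apply: (le_trans (xC _)); apply: ler_wpM2l => //.
by rewrite lef_pV2 ?posrE// ler_nat ltnS leq_addr.
Qed.

Lemma SO_step x C : 0 <= C -> linf x -> (forall k, absC (x k.+1 - x k) <= C / k.+1%:R) -> SO x.
Proof.
move=> C0 xl xC; split => // eps eps0.
have C1 : 0 < C + 1 by rewrite ltr_wpDl.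
(* The bound 1/2 gives s + 1 <= 2 (r + 1) when r < s, where the telescoped bound has denominator r +
   1; the factor 4 leaves slack for this 2. *)
exists (Num.min (1 / 2) (eps / (4 * (C + 1)))).
  by rewrite lt_min !divr_gt0// mulr_gt0.
move=> r s; rewrite lt_min => /andP[h1 h2].
have h3 : C * 4 * `|r.+1%:R / s.+1%:R - 1| < eps.
  move: h2; rewrite ltr_pdivlMr ?mulr_gt0// => h2; apply: le_lt_trans h2.
  by have := normr_ge0 (r.+1%:R / s.+1%:R - 1 : R); nra.
have S0 : 0 < s.+1%:R :> R by []. have R0 : 0 < r.+1%:R :> R by [].
have [sr|rs] := leqP s r.
  have := step_slow_osc C0 xC s (r - s); rewrite subnKC// => h; apply: (le_lt_trans h).
  have E : (r - s)%:R / s.+1%:R = r.+1%:R / s.+1%:R - 1 :> R.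
    by rewrite natrB// -[r.+1%:R]natr1 -[s.+1%:R in RHS]natr1 -[s.+1%:R]natr1; field; rewrite natr1 lt0r_neq0.
  rewrite -mulrA E; apply: le_lt_trans h3; apply: (le_trans (ler_wpM2l C0 (ler_norm _))).
  have : 0 <= C * `|r.+1%:R / s.+1%:R - 1| by rewrite mulr_ge0.
  lra.
have sr := ltnW rs.
have := step_slow_osc C0 xC r (s - r); rewrite subnKC// absC_distC => h; apply: (le_lt_trans h).
have E : (s - r)%:R = s.+1%:R * (1 - r.+1%:R / s.+1%:R) :> R.
  by rewrite mulrBr mulr1 mulrCA divff ?lt0r_neq0// mulr1 natrB// -[r.+1%:R]natr1 -[s.+1%:R]natr1; ring.
have h4 : s.+1%:R / r.+1%:R <= 2 :> R.
  rewrite ler_pdivrMr// -ler_pdivrMl//; move: h1; rewrite ltr_norml => /andP[h1 _].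
  have half (A : R) : - (1 / 2) < A - 1 -> 2^-1 < A by lra.
  by have := half _ h1; rewrite ltr_pdivlMr// => /ltW.
have -> : C * (s - r)%:R / r.+1%:R = C * (1 - r.+1%:R / s.+1%:R) * (s.+1%:R / r.+1%:R).
  by rewrite E; ring.
apply: le_lt_trans h3; rewrite distrC.
have h5 := ler_norm (1 - r.+1%:R / s.+1%:R : R); have h6 := normr_ge0 (1 - r.+1%:R / s.+1%:R : R).
have h7 : 0 <= s.+1%:R / r.+1%:R :> R by rewrite divr_ge0.
apply: (@le_trans _ _ (C * `|1 - r.+1%:R / s.+1%:R| * 2)).
  apply: (@le_trans _ _ (C * `|1 - r.+1%:R / s.+1%:R| * (s.+1%:R / r.+1%:R))).
    by apply: ler_wpM2r => //; apply: ler_wpM2l.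
  by apply: ler_wpM2l => //; rewrite mulr_ge0.
have : 0 <= C * `|1 - r.+1%:R / s.+1%:R| by rewrite mulr_ge0.
lra.
Qed.

Lemma real_SO_Re x : SO x -> real_SO (fun k => ReC (x k)).
Proof.
move=> [[M xM] xs]; split; first by exists M => k; exact: le_trans (ReC_le _) (xM k).
move=> eps /xs[d d0 H]; exists d => // r s /H h; rewrite -ReCB.
exact: le_lt_trans (ReC_le _) h.
Qed.

Lemma real_SO_Im x : SO x -> real_SO (fun k => ImC (x k)).
Proof.
move=> [[M xM] xs]; split; first by exists M => k; exact: le_trans (ImC_le _) (xM k).
move=> eps /xs[d d0 H]; exists d => // r s /H h; rewrite -ImCB.
exact: le_lt_trans (ImC_le _) h.
Qed.

Let SOD x y : SO x -> SO y -> SO (fun k => x k + y k).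
Proof.
move=> [[M xM] xs] [[K yK] ys]; split.
  by exists (M + K) => k; apply: (le_trans (absCD _ _)); exact: lerD.
move=> e e0; have e2 : 0 < e / 2 by rewrite divr_gt0.
have [d1 d10 H1] := xs _ e2; have [d2 d20 H2] := ys _ e2.
exists (Num.min d1 d2); first by rewrite lt_min d10 d20.
move=> r s; rewrite lt_min => /andP[/H1 h1 /H2 h2].
by rewrite opprD addrACA (splitr e) (le_lt_trans (absCD _ _))// ltrD.
Qed.

Let SOM x y : SO x -> SO y -> SO (fun k => x k * y k).
Proof.
move=> [[M xM] xs] [[K yK] ys].
have M0 : 0 <= M by exact: le_trans (absC_ge0 _) (xM 0%N).
have K0 : 0 <= K by exact: le_trans (absC_ge0 _) (yK 0%N).
split; first by exists (M * K) => k; rewrite absCM; apply: ler_pM; rewrite ?absC_ge0.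
move=> e e0; have D0 : 0 < M + K + 1 by rewrite ltr_wpDl// addr_ge0.
have e2 : 0 < e / (M + K + 1) by rewrite divr_gt0.
have [d1 d10 H1] := xs _ e2; have [d2 d20 H2] := ys _ e2.
exists (Num.min d1 d2); first by rewrite lt_min d10 d20.
move=> r s; rewrite lt_min => /andP[/H1 h1 /H2 h2].
have -> : x r * y r - x s * y s = x r * (y r - y s) + y s * (x r - x s) by ring.
apply: (le_lt_trans (absCD _ _)); rewrite !absCM.
apply: (@le_lt_trans _ _ (M * (e / (M + K + 1)) + K * (e / (M + K + 1)))).
  by apply: lerD; apply: ler_pM; rewrite ?absC_ge0// ltW.
rewrite -mulrDl mulrA ltr_pdivrMr// [e * _]mulrC ltr_pM2r//; lra.
Qed.

Let SO_cst (w : Cx R) : SO (fun=> w).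
Proof.
split; first by exists (absC w).
by move=> e e0; exists 1 => // r s _; rewrite subrr absC0.
Qed.

Lemma SO_Cstar_subalg : is_Cstar_subalg (SO (R := R)).
Proof.
split.
- by move=> x [].
- split; [exact: SO_cst|exact: SOD|].
  by move=> w x; exact: SOM (SO_cst w).
- exact: SOM.
- move=> x [[M xM] xs]; split; first by exists M => k; rewrite absC_conj.
  by move=> e /xs[d d0 H]; exists d => // r s /H; rewrite -rmorphB absC_conj.
move=> x [xl xc]; split => // e e0; have e4 : 0 < e / 4 by rewrite divr_gt0.
have [y [_ ys] xy] := xc _ e4; have [d d0 H] := ys _ e4.
exists d => // r s /H h.
apply: (le_lt_trans (absC_dist_trans (y r) _ _)).
have h1 := absC_dist_trans (y s) (y r) (x s).
have h2 := xy r; have h3 := xy s; rewrite absC_distC in h3; lra.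
Qed.

End slow_oscillation.

(** * The inclusions between [ST], its closure and [SO] *)

Section main_inclusions.
Context {R : realType} {m : nat} {lambda : R} (lam : -1 < lambda).

Lemma ST_sub_SO : ST m.+1 lambda `<=` SO (R := R).
Proof.
move=> x /(ST_sub_seqT lam)[M [a [aM ->]]].
have M0 : 0 <= M by apply: le_trans (absC_ge0 _) (aM.2 0).
have C0 : 0 <= 2 * (lambda + 1) * M by rewrite !mulr_ge0// ltW// lam_gt0.
apply: (SO_step C0); last by move=> k; exact: seqT_step.
exists M => k; rewrite -(gam_cst m M k (lam_gt0 lam)).
by apply: (seqT_le lam) => [||z _]; [exact: aM.1|exact: bm_cst|exact: aM.2].
Qed.

Lemma SO_sub_closure : SO (R := R) `<=` linf_closure (ST m.+1 lambda).
Proof.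
move=> x xSO; split; first by case: xSO.
move=> e e0; have e2 : 0 < e / 2 by rewrite divr_gt0.
have [b1 bb1 h1] := gam_closure_SO m (lam_gt0 lam) (real_SO_Re xSO) e2.
have [b2 bb2 h2] := gam_closure_SO m (lam_gt0 lam) (real_SO_Im xSO) e2.
exists (fun k => mkC (gam (lambda + 1) m b1 k) (gam (lambda + 1) m b2 k)).
  exact: ST_radial.
move=> k; apply: (le_trans (absC_le _)); rewrite ReCB ImCB /= (splitr e).
by apply: lerD; rewrite distrC.
Qed.

End main_inclusions.

Lemma linf_closureS (R : realType) (S1 S2 : set (nat -> Cx R)) :
  S1 `<=` S2 -> linf_closure S1 `<=` linf_closure S2.
Proof.
move=> S12 x [xl xc]; split => // e /xc[s Ss xs]; exists s => //; exact: S12.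
Qed.

Theorem theorem5p7 (R : realType) (n : nat) (lambda : R)
    (hn : (0 < n)%N) (hlambda : -1 < lambda) :
  Cstar_generated (ST n lambda) = SO (R := R) /\
  linf_closure (ST n lambda) = SO (R := R).
Proof.
case: n hn => // m _.
have sub := @ST_sub_SO R m lambda hlambda; have sup := @SO_sub_closure R m lambda hlambda.
have [_ _ _ _ clo] := @SO_Cstar_subalg R.
(* As [SO] is a closed algebra between [ST] and its closure, it contains all that [ST] generates,
   and every closed algebra containing [ST] contains [SO]. *)
split; apply/seteqP; split.
- by apply: smallest_sub => //; exact: SO_Cstar_subalg.
- move=> x /sup xc A [[_ _ _ _ cloA] STA]; apply: cloA; exact: linf_closureS STA _ xc.
- by move=> x xc; apply: clo; exact: linf_closureS sub _ xc.
- exact: sup.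
Qed.
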